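(* Let $1<p\le q\le\frac{np}{n-p}<\infty$, $\beta=n-\frac qp(n-p)$, and let $\Omega\subset\mathbb{R}^n$ be a Boman domain with constant $N\ge1$ such that $w(x)=d(x,\partial\Omega)^{-\beta}$ is doubling in $\Omega$ with constant $D$. Then there is a constant $C=C(n,p,q,D,N)$ such that $$\inf_{c\in\mathbb{R}}\left(\int_\Omega|u(x)-c|^q\,d(x,\partial\Omega)^{-n+\frac qp(n-p)}\,dx\right)^{1/q}\le C\left(\int_\Omega|\nabla u(x)|^p\,dx\right)^{1/p}$$ for every $u\in\mathrm{Lip}_{\mathrm{loc}}(\Omega)$.
   Context: A cube in $\mathbb{R}^n$ is a half-open set $[a_1,b_1)\times\cdots\times[a_n,b_n)$ with equal side lengths; $Q(x_Q,r_Q)$ is the cube with midpoint $x_Q$ and side length $l(Q)=2r_Q$, and $NQ=Q(x_Q,Nr_Q)$. Whitney decomposition: $\mathcal{W}(\Omega)$ is the standard Whitney decomposition of the open set $\Omega\subsetneq\mathbb{R}^n$ into pairwise disjoint half-open dyadic cubes with $\bigcup_{Q\in\mathcal{W}(\Omega)}Q=\Omega$ and $\sqrt n\,l(Q)\le d(Q,\mathbb{R}^n\setminus\Omega)\le 4\sqrt n\,l(Q)$. For $Q\in\mathcal{W}(\Omega)$, $Q^*=\frac98Q\subset\Omega$; these satisfy $\sum_{Q}\chi_{Q^*}\le C(n)$ and $l(Q^* )/C(n)\le d(Q^*,\partial\Omega)\le C(n)l(Q^* )$. Chains: for a bounded domain $\Omega$, a tuple $\mathcal{C}(Q)=(Q_0,\dots,Q_k)$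 of Whitney cubes is a chain joining $Q_0$ to $Q=Q_k$ if $Q_i\ne Q_j$ for $i\ne j$ and for each $j\in\{1,\dots,k\}$ there is a cube $R\subset Q_j^*\cap Q_{j-1}^*$ with $l(R)\ge c(n)\max\{l(Q_j^* ),l(Q_{j-1}^* )\}$, where $c(n)>0$ is a fixed dimensional constant. A chain decomposition of $\Omega$ is a collection $\{\mathcal{C}(Q):Q\in\mathcal{W}(\Omega)\}$ of such chains, all starting from one fixed Whitney cube $Q_0$. The shadow of $R\in\mathcal{W}(\Omega)$ is $\mathcal{S}(R)=\{Q\in\mathcal{W}(\Omega):R\in\mathcal{C}(Q)\}$. $\Omega$ is a Boman domain with constant $N\ge1$ if it is a bounded domain having a chain decomposition with $\bigcup_{Q\in\mathcal{S}(R)}Q\subset NR$ for all $R\in\mathcal{W}(\Omega)$. A weight in $\Omega$ is a locally integrable function on $\Omega$ that is positive almost everywhere; $w(E)=\int_Ew(x)\,dx$. A weight $w$ is doubling in $\Omega$ with constant $D$ if $w(\Omega\cap Q(x,2r))\le D\,w(\Omega\cap Q(x,r))$ for every $x\in\Omega$ and $r>0$. $\mathrm{Lip}_{\mathrm{loc}}(\Omega)$ is the set of real-valued functions that are Lipschitz continuous on every compact subset of $\Omega$; $\nabla u$ is defined almost everywhere. The notation $1<p\le q\le\frac{np}{n-p}<\infty$ entails $1<p<n$. *)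

(* Defs.v *)
From HB Require Import structures.
From mathcomp Require Import all_boot all_order all_algebra.
From mathcomp Require Import all_classical all_reals all_analysis.

Set Implicit Arguments.
Unset Strict Implicit.
Unset Printing Implicit Defensive.

Import Order.TTheory GRing.Theory Num.Theory.
Import numFieldNormedType.Exports.

Local Open Scope classical_set_scope.
Local Open Scope ring_scope.

Definition measure_rV_display : measure_display.
Proof. exact: default_measure_display. Qed.

(* The sigma-algebra generated by the coordinates, i.e. the Borel one. *)
Section measurable_rV.
Variables (R : realType) (n : nat).

Definition rV_coord (i : 'I_n) (x : 'rV[R]_n) : measurableTypeR R := x 0 i.

Let rV_set0 : g_sigma_preimage rV_coord set0.
Proof. exact: sigma_algebra0. Qed.

Let rV_setC A : g_sigma_preimage rV_coord A -> g_sigma_preimage rV_coord (~` A).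
Proof. exact: sigma_algebraC. Qed.

Let rV_bigcup (F : (set 'rV[R]_n)^nat) :
  (forall i, g_sigma_preimage rV_coord (F i)) ->
  g_sigma_preimage rV_coord (\bigcup_i (F i)).
Proof. exact: sigma_algebra_bigcup. Qed.

HB.instance Definition _ := @isMeasurable.Build measure_rV_display
  'rV[R]_n (g_sigma_preimage rV_coord) rV_set0 rV_setC rV_bigcup.

Lemma measurable_rV_coord i : measurable_fun [set: 'rV[R]_n] (rV_coord i).
Proof.
move=> _ Y mY; rewrite setTI; apply: sub_sigma_algebra => /=.
rewrite -bigcup_seq/=; exists i => /=; first by rewrite mem_index_enum.
by exists Y => //; rewrite setTI.
Qed.

Lemma measurable_fun_rVP d (T : measurableType d) (f : T -> 'rV[R]_n) :
  (forall i, measurable_fun [set: T] (rV_coord i \o f)) ->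
  measurable_fun [set: T] f.
Proof.
move=> mf; suff H : g_sigma_preimage (fun i => rV_coord i \o f) `<=` measurable.
  move=> _ A mA; rewrite g_sigma_preimage_comp in H.
  by apply: H; exists A.
apply: smallest_sub; first exact: sigma_algebra_measurable.
rewrite -bigcup_seq/=; apply: bigcup_sub => i _.
by move=> A [B mB <-]; exact: mf.
Qed.

End measurable_rV.

Definition cons_rV (R : realType) n (z : measurableTypeR R * 'rV[R]_n) :
    'rV[R]_n.+1 :=
  \row_i oapp (z.2 0) z.1 (unlift ord0 i).

Lemma measurable_cons_rV (R : realType) n :
  measurable_fun setT (@cons_rV R n).
Proof.
apply: measurable_fun_rVP => i; rewrite /rV_coord /cons_rV /comp/=.
case: (unliftP ord0 i) => [j ->|->].
  under eq_fun do rewrite mxE liftK/=.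
  exact: (measurableT_comp (@measurable_rV_coord R n j) measurable_snd).
under eq_fun do rewrite mxE unlift_none/=.
exact: measurable_fst.
Qed.

(* Lebesgue measure on R^n, as an iterated product measure. *)
Fixpoint lebesgue_rV (R : realType) n : set 'rV[R]_n -> \bar R :=
  match n with
  | 0 => dirac (0 : 'rV[R]_0)
  | m.+1 => pushforward (@lebesgue_measure R \x @lebesgue_rV R m)%E (@cons_rV R m)
  end.
Arguments lebesgue_rV {R n}.

Section cons_rV_measure.
Local Open Scope ereal_scope.
Variables (R : realType) (n : nat).
Variable mu : {sigma_finite_measure set 'rV[R]_n -> \bar R}.

Let nu : set 'rV[R]_n.+1 -> \bar R :=
  pushforward (@lebesgue_measure R \x mu) (@cons_rV R n).

Let nu0 : nu set0 = 0.
Proof. by rewrite /nu /pushforward preimage_set0 measure0. Qed.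

Let nu_ge0 A : 0 <= nu A.
Proof. exact: (measure_ge0 (@lebesgue_measure R \x mu)). Qed.

Let nu_sigma_additive : semi_sigma_additive nu.
Proof.
move=> F mF tF mUF; rewrite /nu /pushforward preimage_bigcup.
have mf := @measurable_cons_rV R n.
apply: (@measure_semi_sigma_additive _ _ _ (@lebesgue_measure R \x mu)).
- by move=> k; rewrite -[X in measurable X]setTI; exact: mf.
- apply/trivIsetP => /= i j _ _ ij; rewrite -preimage_setI.
  by move/trivIsetP : tF => /(_ _ _ _ _ ij) ->//; rewrite preimage_set0.
- by rewrite -preimage_bigcup -[X in measurable X]setTI; exact: mf.
Qed.

HB.instance Definition _ := isMeasure.Build _ _ _ nu
  nu0 nu_ge0 nu_sigma_additive.

Let nu_sigma_finite : sigma_finite setT nu.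
Proof.
pose leb1 : {sigma_finite_measure set (measurableTypeR R) -> \bar R} :=
  @lebesgue_measure R.
have [F TF mF] : sigma_finite setT (leb1 \x mu).
  have /sigma_finiteP[F [TF ndF Foo]] := sigma_finiteT leb1.
  have /sigma_finiteP[G [TG ndG Goo]] := sigma_finiteT mu.
  exists (fun k => F k `*` G k).
    rewrite -setXTT TF TG predeqE => -[x y]; split.
      move=> [/= [i _ Fix] [k _ Gky]]; exists (maxn i k) => //; split.
      - by move: x Fix; exact/subsetPset/ndF/leq_maxl.
      - by move: y Gky; exact/subsetPset/ndG/leq_maxr.
    by move=> [i _ []/= ? ?]; split; exists i.
  move=> k; have [? ?] := Foo k; have [? ?] := Goo k.
  split; first exact: measurableX.
  by rewrite product_measure1E// lte_mul_pinfty// ge0_fin_numE.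
pose g (x : 'rV[R]_n.+1) : measurableTypeR R * 'rV[R]_n :=
  (rV_coord ord0 x, (\row_j x 0 (lift ord0 j))%R).
have mg : measurable_fun setT g.
  apply: measurable_fun_pair; first exact: measurable_rV_coord.
  apply: measurable_fun_rVP => i.
  rewrite [X in measurable_fun _ X](_ : _ = rV_coord (lift ord0 i)).
    exact: measurable_rV_coord.
  by apply/funext => x; rewrite /rV_coord/= mxE.
have gK : cancel (@cons_rV R n) g.
  move=> [x y]; rewrite /g /rV_coord/= /cons_rV mxE unlift_none/=.
  by congr pair; apply/rowP => j; rewrite !mxE liftK.
exists (fun k => g @^-1` F k).
  by rewrite -preimage_bigcup -TF preimage_setT.
move=> k; have [mFk Fk] := mF k; split.
  by rewrite -[X in measurable X]setTI; exact: mg.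
rewrite /nu /pushforward (_ : _ @^-1` _ = F k)//.
by apply/seteqP; split => x /=; rewrite gK.
Qed.

HB.instance Definition _ := Measure_isSigmaFinite.Build _ _ _ nu
  nu_sigma_finite.

Lemma cons_rV_sigma_finite_measure :
  exists nu' : {sigma_finite_measure set 'rV[R]_n.+1 -> \bar R},
    pushforward (@lebesgue_measure R \x mu) (@cons_rV R n) = nu'.
Proof. by exists nu. Qed.

End cons_rV_measure.

Lemma lebesgue_rV_sigma_finite_measure (R : realType) n :
  exists mu : {sigma_finite_measure set 'rV[R]_n -> \bar R},
    lebesgue_rV = mu :> (set 'rV[R]_n -> \bar R).
Proof.
elim: n => [|n [mu IH]]; first by exists (dirac (0 : 'rV[R]_0)).
by have [nu nuE] := cons_rV_sigma_finite_measure mu; exists nu; rewrite /= IH.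
Qed.

Section lebesgue_rV_measure.
Local Open Scope ereal_scope.
Variables (R : realType) (n : nat).

Let leb : set 'rV[R]_n -> \bar R := lebesgue_rV.

Let leb0 : leb set0 = 0.
Proof.
by rewrite /leb; have [mu ->] := lebesgue_rV_sigma_finite_measure R n.
Qed.

Let leb_ge0 A : 0 <= leb A.
Proof.
by rewrite /leb; have [mu ->] := lebesgue_rV_sigma_finite_measure R n.
Qed.

Let leb_sigma_additive : semi_sigma_additive leb.
Proof.
rewrite /leb; have [mu ->] := lebesgue_rV_sigma_finite_measure R n.
exact: measure_semi_sigma_additive.
Qed.

HB.instance Definition _ := isMeasure.Build _ _ _ (@lebesgue_rV R n)
  leb0 leb_ge0 leb_sigma_additive.

Let leb_sigma_finite : sigma_finite setT leb.
Proof.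
rewrite /leb; have [mu ->] := lebesgue_rV_sigma_finite_measure R n.
exact: sigma_finiteT.
Qed.

HB.instance Definition _ := Measure_isSigmaFinite.Build _ _ _
  (@lebesgue_rV R n) leb_sigma_finite.

End lebesgue_rV_measure.

Lemma lebesgue_rV_box (R : realType) n (a b : 'rV[R]_n) :
  (forall i, a 0 i <= b 0 i) ->
  lebesgue_rV [set x : 'rV[R]_n | forall i, a 0 i <= x 0 i < b 0 i] =
  (\prod_(i < n) (b 0 i - a 0 i))%:E.
Proof.
elim: n => [|n IH] in a b * => ab.
  by rewrite big_ord0 /= diracE mem_set//= => -[].
pose tl (x : 'rV[R]_n.+1) : 'rV[R]_n := \row_j x 0 (lift ord0 j).
have mbox : measurable [set x : 'rV[R]_n |
    forall i, tl a 0 i <= x 0 i < tl b 0 i].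
  rewrite (_ : mkset _ = \big[setI/setT]_(i < n)
      (@rV_coord R n i @^-1` `[tl a 0 i, tl b 0 i[%classic)).
    apply: bigsetI_measurable => i _; rewrite -[X in measurable X]setTI.
    by apply: measurable_rV_coord => //; exact: measurable_itv.
  rewrite -bigcap_seq; apply/seteqP; split => x /= H.
    by move=> i _ /=; rewrite /rV_coord in_itv/= H.
  by move=> i; have := H i (mem_index_enum _); rewrite /= /rV_coord in_itv.
rewrite /= /pushforward (_ : _ @^-1` _ = `[a 0 0, b 0 0[%classic `*`
    [set x : 'rV[R]_n | forall i, tl a 0 i <= x 0 i < tl b 0 i]); last first.
  apply/seteqP; split => -[x y] /=.
    move=> H; split => [|i].
      by have := H 0; rewrite in_itv/= mxE unlift_none.
    by have := H (lift ord0 i); rewrite !mxE liftK.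
  rewrite in_itv/= => -[xab H] i; rewrite mxE.
  case: (unliftP ord0 i) => [j ->|->] //=.
  by have := H j; rewrite !mxE.
rewrite product_measure1E//= IH => [|i]; last by rewrite !mxE.
rewrite lebesgue_measure_itv/= lte_fin big_ord_recl.
under eq_bigr do rewrite !mxE.
case: ltP => [_|ba]; first by rewrite EFinM EFinB.
by rewrite mul0e (_ : b 0 ord0 = a 0 ord0) ?subrr ?mul0r//; apply/le_anti; rewrite ba ab.
Qed.

(* The norm, topology and distance that the library puts on 'rV[R]_n come from
   the sup norm; the Euclidean ones are needed here. *)
Section euclidean.
Variables (R : realType) (n : nat).
Implicit Types (x y : 'rV[R]_n) (A B : set 'rV[R]_n).

Definition enorm x : R := Num.sqrt (\sum_(i < n) x 0 i ^+ 2).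

Definition set_dist A B : R := inf [set enorm (x - y) | x in A & y in B].

Definition pt_dist x A : R := inf [set enorm (x - y) | y in A].

Definition bdry A : set 'rV[R]_n := closure A `\` interior A.

End euclidean.

Section cubes.
Variables (R : realType) (n : nat).

(* The pair (x, r) stands for the cube Q(x, r), with midpoint x and side
   length 2 * r. *)
Definition cube : Type := ('rV[R]_n * R)%type.
HB.instance Definition _ := Choice.on cube.

Implicit Type Q : cube.

Definition cube_set Q : set 'rV[R]_n :=
  [set y : 'rV[R]_n | forall i, Q.1 0 i - Q.2 <= y 0 i < Q.1 0 i + Q.2].

Definition side Q : R := 2 * Q.2.

Definition dilate (t : R) Q : cube := (Q.1, t * Q.2).

Definition dyadic Q : Prop :=
  exists (k : int) (m : 'I_n -> int),
    side Q = 2 ^ k /\ forall i, Q.1 0 i - Q.2 = (m i)%:~R * 2 ^ k.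

Record whitney (Omega : set 'rV[R]_n) (W : set cube) : Prop := Whitney {
  whitney_open : open Omega ;
  whitney_proper : Omega <> setT ;
  whitney_dyadic : forall Q, W Q -> dyadic Q ;
  whitney_disjoint : trivIset W cube_set ;
  whitney_cover : \bigcup_(Q in W) cube_set Q = Omega ;
  whitney_dist : forall Q, W Q ->
    Num.sqrt n%:R * side Q <= set_dist (cube_set Q) (~` Omega)
      <= 4 * Num.sqrt n%:R * side Q }.

Definition star Q : cube := dilate (9 / 8) Q.

Definition linked (c : R) Q Q' : Prop :=
  exists P : cube, cube_set P `<=` cube_set (star Q) `&` cube_set (star Q') /\
    c * Num.max (side (star Q)) (side (star Q')) <= side P.

(* The chain (Q_0, ..., Q_k) is the sequence Q0 :: s. *)
Definition chain (c : R) (W : set cube) (Q0 Q : cube) (s : seq cube) : Prop :=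
  [/\ (forall P, P \in Q0 :: s -> W P), last Q0 s = Q, uniq (Q0 :: s) &
      forall j, (j < size s)%N ->
        linked c (nth Q0 (Q0 :: s) j.+1) (nth Q0 (Q0 :: s) j)].

Definition shadow (W : set cube) (C : cube -> seq cube) (P : cube) : set cube :=
  [set Q | W Q /\ P \in C Q].

Definition chain_decomposition (c : R) (W : set cube) (C : cube -> seq cube) :
    Prop :=
  exists2 Q0, W Q0 &
    forall Q, W Q -> exists2 s, C Q = Q0 :: s & chain c W Q0 Q s.

Definition bounded_domain (Omega : set 'rV[R]_n) : Prop :=
  [/\ open Omega, connected Omega, Omega !=set0 & bounded_set Omega].

Definition boman (c : R) (W : set cube) (N : R) (Omega : set 'rV[R]_n) : Prop :=
  [/\ 1 <= N, bounded_domain Omega &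
    exists2 C : cube -> seq cube, chain_decomposition c W C &
      forall P, W P ->
        \bigcup_(Q in shadow W C P) cube_set Q `<=` cube_set (dilate N P)].

End cubes.

Section weights.
Variables (R : realType) (n : nat).
Implicit Types (Omega : set 'rV[R]_n) (w u : 'rV[R]_n -> R).

Definition weight Omega w : Prop :=
  [/\ measurable_fun Omega w,
      (forall K, compact K -> K `<=` Omega ->
        (\int[lebesgue_rV]_(x in K) `|w x|%:E < +oo)%E) &
      {ae lebesgue_rV, forall x, Omega x -> 0 < w x}].

Definition wmeas w (E : set 'rV[R]_n) : \bar R :=
  (\int[lebesgue_rV]_(x in E) (w x)%:E)%E.

Definition doubling Omega w (D : R) : Prop :=
  weight Omega w /\
  forall x (r : R), Omega x -> 0 < r ->
    (wmeas w (Omega `&` cube_set (x, (2 * r)%R))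
      <= D%:E * wmeas w (Omega `&` cube_set (x, r)))%E.

Definition lip_loc Omega u : Prop :=
  forall K, compact K -> K `<=` Omega ->
    exists L : R, forall x y, K x -> K y -> `|u x - u y| <= L * enorm (x - y).

(* Junk-valued where a partial derivative does not exist; for a locally
   Lipschitz u this is a null set. *)
Definition grad u (x : 'rV[R]_n) : 'rV[R]_n :=
  \row_i 'D_(delta_mx 0 i) (u : 'rV[R]_n -> R^o) x.

End weights.

(* Main.v *)
Require Import Defs.
From HB Require Import structures.
From mathcomp Require Import all_boot all_order all_algebra.
From mathcomp Require Import all_classical all_reals all_analysis.
From mathcomp Require Import measurable_realfun ring lra.

(* On each cube Q* the function u satisfies a Sobolev inequality with some mean m_Q.  Since
   the weight is comparable to l(Q)^-beta on a Whitney cube Q, by Hoelder's inequality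
   \int_Q |u - m_Q|^q w <= C F_Q^q, where F_Q^p = \int_{Q*} |grad u|^p.  Along the chain C(Q)
   consecutive means differ by at most C (a_R + a_R') with a_R = C l(R)^(1-n/p) F_R, whence
   |m_Q - m_{Q_0}| <= C \sum_{R in C(Q)} a_R.  In the Boman condition R in C(Q) forces
   Q in N R, so by doubling (Bojarski's lemma)
   \sum_Q w(Q) (\sum_{R in C(Q)} a_R)^q <= C \sum_R w(R) a_R^q <= C \sum_R F_R^q.
   As q >= p the last sum is at most (\sum_R F_R^p)^(q/p), and the cubes R* have bounded
   overlap. *)

Set Implicit Arguments.
Unset Strict Implicit.
Unset Printing Implicit Defensive.

Import Order.TTheory GRing.Theory Num.Theory.
Import numFieldNormedType.Exports.

Local Open Scope classical_set_scope.
Local Open Scope ring_scope.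

(** * Borel functions and Fubini on row vectors *)

(** The numbers called means are values of [u] at well-chosen points, so no average of [u] is ever
    formed. The Sobolev inequality on cubes and Bojarski's lemma, usually derived from Riesz
    potentials and from duality with the maximal function, rest here on one mechanism: [sum_powR_le]
    expands the q-th power of a sum into terms linear in one summand, an exchange of integrals or
    sums produces the volume or the mass of a cube, and [young_eps] leaves a small multiple of an
    expression of the original kind. Absorbing that multiple requires finite quantities, whence the
    truncated sums [T m] and the finite lists of cubes, with bounds independent of the truncation;
    [whitney_integral_le] passes to the limit. Since [u] is Lipschitz only on compact subsets, it is
    replaced on each Q* by a globally Lipschitz function, for which slices and difference quotients
    are defined everywhere. *)

Lemma natSinv_lt (R : realType) (e : R) : 0 < e -> exists k : nat, k.+1%:R^-1 < e.
Proof.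
move=> e0; exists (Num.bound e^-1).
rewrite -[ltRHS]invrK ltf_pV2 ?posrE ?invr_gt0//.
apply: lt_trans (_ : (Num.bound e^-1)%:R < _); last by rewrite ltr_nat.
by rewrite archi_boundP// invr_ge0 ltW.
Qed.

Lemma lip_continuous (R : realType) (f : R -> R) (M : R) :
  (forall x y, `|f x - f y| <= M * `|x - y|) -> continuous f.
Proof.
move=> lf x; apply/(@cvgrPdist_lt _ R^o _ (nbhs x) (nbhs_filter x)) => e e0.
have M0 : 0 < `|M| + 1 by rewrite ltr_wpDl.
near=> y; apply: le_lt_trans (lf x y) _.
apply: le_lt_trans (_ : _ <= (`|M| + 1) * `|x - y|) _.
  by rewrite ler_wpM2r// (le_trans (ler_norm _))// lerDl.
rewrite mulrC -ltr_pdivlMr//.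
near: y; apply: (@cvgr_dist_lt _ R^o _ (nbhs x) _ _ _ cvg_id).
exact: divr_gt0.
Unshelve. all: by end_near. Qed.

Section rV_borel.
Variables (R : realType) (n : nat).

(** The sigma-algebra is generated by the coordinates while openness refers to the sup norm; the two
    meet in the countably many boxes with rational centers and radii [k.+1%:R^-1]. *)
Lemma open_measurable_rV (A : set 'rV[R]_n) : open A -> measurable A.
Proof.
move=> oA.
pose box (z : 'rV[rat]_n * nat) : set 'rV[R]_n :=
  [set x | forall i, `|x 0 i - ratr (z.1 0 i)| < z.2.+1%:R^-1].
have mbox z : measurable (box z).
  rewrite (_ : box z = \big[setI/setT]_(i < n) (@rV_coord R n i @^-1`
      ball (ratr (z.1 0 i) : R) (z.2.+1%:R^-1))).
    apply: bigsetI_measurable => i _; rewrite -[X in measurable X]setTI.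
    by apply: measurable_rV_coord => //; exact: measurable_ball.
  rewrite -bigcap_seq; apply/seteqP; split => x /= H.
    by move=> i _ /=; rewrite /rV_coord /ball/= distrC.
  by move=> i; have := H i (mem_index_enum _); rewrite /rV_coord/= /ball/= distrC.
have -> : A = \bigcup_(z in [set z | box z `<=` A]) box z.
  apply/seteqP; split=> [x Ax|x [z zA]]; last exact: zA.
  have /nbhs_ballP[e/= e0 eA] : nbhs x A by exact: open_nbhs_nbhs.
  have [k ke] : exists k : nat, k.+1%:R^-1 < e / 2.
    by apply: natSinv_lt; exact: divr_gt0.
  have /choice[q qP] : forall i : 'I_n, exists q : rat,
      `|x 0 i - ratr q| < k.+1%:R^-1 :> R.
    move=> i; have : 0 < k.+1%:R^-1 :> R by rewrite invr_gt0.
    set d := _^-1 => d0; have dd : x 0 i - d < x 0 i + d by lra.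
    have [q] := rat_in_itvoo dd.
    rewrite in_itv/= => /andP[q1 q2]; exists q.
    by rewrite ltr_norml; apply/andP; split; lra.
  exists (\row_i q i, k) => /=; last by move=> i; rewrite mxE/=.
  move=> y /= by_; apply: eA; rewrite -ball_normE/=.
  apply: le_lt_trans (_ : _ <= k.+1%:R^-1 * 2) _; last first.
    by rewrite -ltr_pdivlMr.
  rewrite [leLHS]/Num.Def.normr/= mx_normrE; apply/bigmax_leP; split.
    by rewrite mulr_ge0.
  move=> [i j] _; rewrite (ord1 i)/= !mxE.
  have := by_ j; rewrite mxE/= => yj; have xj := qP j.
  rewrite (_ : _ - _ = (x 0 j - ratr (q j)) - (y 0 j - ratr (q j))); last by lra.
  apply: (le_trans (ler_normB _ _)); move: yj xj; set d := _^-1; lra.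
rewrite -[X in measurable X]/(\bigcup_(z in _) _) (bigcup_mkcond _ box).
apply: countable_bigcupT_measurable => // z.
by case: ifP => _; [exact: mbox|exact: measurable0].
Qed.

Lemma continuous_measurable_rV (f : 'rV[R]_n -> R) :
  continuous f -> measurable_fun setT f.
Proof.
move=> cf; apply: (measurability _ (RGenOpens.measurableE R)) => //.
move=> _ [_ [a [b ->] <-]]; rewrite setTI.
apply: open_measurable_rV; apply: open_comp => // x _; exact: cf.
Qed.

End rV_borel.

(** * Tonelli on rectangles, and integration over cubes one coordinate at a time *)

Section tonelli.
Local Open Scope ereal_scope.

Section domain.
Context d1 d2 (T1 : measurableType d1) (T2 : measurableType d2) (R : realType).
Variables (m1 : {sigma_finite_measure set T1 -> \bar R})
  (m2 : {sigma_finite_measure set T2 -> \bar R}).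
Variables (A : set T1) (B : set T2) (f : T1 * T2 -> \bar R).
Hypotheses (mA : measurable A) (mB : measurable B) (mf : measurable_fun setT f)
  (f0 : forall z, 0 <= f z).

Let fr1 : T1 * T2 -> \bar R := f \_ (A `*` B).

Let mfr1 : measurable_fun setT fr1.
Proof.
by apply/(measurable_restrictT _ (measurableX mA mB)); exact: measurable_funTS.
Qed.

Let fr1_ge0 z : 0 <= fr1 z.
Proof. by rewrite /fr1 patchE; case: ifP. Qed.

Lemma ge0_measurable_fun_integral_snd :
  measurable_fun setT (fun x => \int[m2]_(y in B) f (x, y)).
Proof.
under eq_fun do rewrite integral_mkcond.
have -> : (fun x => \int[m2]_y ((fun y => f (x, y)) \_ B) y) =
  (fun x => \int[m2]_y (f \_ (setT `*` B)) (x, y)).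
  by apply/funext => x; apply: eq_integral => y _; rewrite !patchE in_setX in_setT.
apply: (@measurable_fun_fubini_tonelli_F _ _ _ _ _ m2 (f \_ (setT `*` B))).
- by apply/(measurable_restrictT _ (measurableX measurableT mB)); exact: measurable_funTS.
- by move=> z; rewrite patchE; case: ifP.
Qed.

Lemma ge0_measurable_fun_integral_fst :
  measurable_fun setT (fun y => \int[m1]_(x in A) f (x, y)).
Proof.
under eq_fun do rewrite integral_mkcond.
have -> : (fun y => \int[m1]_x ((fun x => f (x, y)) \_ A) x) =
  (fun y => \int[m1]_x (f \_ (A `*` setT)) (x, y)).
  by apply/funext => x; apply: eq_integral => y _; rewrite !patchE in_setX in_setT andbT.
apply: (@measurable_fun_fubini_tonelli_G _ _ _ _ _ m1 (f \_ (A `*` setT))).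
- by apply/(measurable_restrictT _ (measurableX mA measurableT)); exact: measurable_funTS.
- by move=> z; rewrite patchE; case: ifP.
Qed.

Lemma ge0_integral_swap :
  \int[m1]_(x in A) \int[m2]_(y in B) f (x, y) =
  \int[m2]_(y in B) \int[m1]_(x in A) f (x, y).
Proof.
transitivity (\int[m1]_x \int[m2]_y fr1 (x, y)).
  rewrite integral_mkcond; apply: eq_integral => x _; rewrite patchE.
  case: ifPn => xA; last first.
    rewrite integral0_eq// => y _; rewrite /fr1 patchE in_setX/=.
    by rewrite (negbTE xA).
  rewrite integral_mkcond; apply: eq_integral => y _.
  by rewrite /fr1 !patchE in_setX xA.
rewrite fubini_tonelli//; apply/esym.
rewrite integral_mkcond; apply: eq_integral => y _; rewrite patchE.
case: ifPn => yB; last first.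
  rewrite integral0_eq// => x _; rewrite /fr1 patchE in_setX/=.
  by rewrite (negbTE yB) andbF.
rewrite integral_mkcond; apply: eq_integral => x _.
by rewrite /fr1 !patchE in_setX yB andbT.
Qed.

End domain.

Section cons.
Variables (R : realType) (n : nat).

Lemma ge0_integral_cons_rV (f : 'rV[R]_n.+1 -> \bar R) :
  measurable_fun setT f -> (forall x, 0 <= f x) ->
  \int[lebesgue_rV]_x f x =
  \int[@lebesgue_measure R]_t \int[@lebesgue_rV R n]_y f (cons_rV (t, y)).
Proof.
move=> mf f0.
have mc := @measurable_cons_rV R n.
(* In dimension [n.+1] the measure is this pushforward by definition; only the measure structure
   attached to the set function changes. *)
transitivity (\int[pushforward (@lebesgue_measure R \x @lebesgue_rV R n)%E
  (@cons_rV R n)]_x f x).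
  by apply: eq_measure_integral => A mA _.
rewrite ge0_integral_pushforward//= preimage_setT.
rewrite fubini_tonelli1//.
exact: measurableT_comp.
Qed.

Definition tl_rV (x : 'rV[R]_n.+1) : 'rV[R]_n := \row_j x ord0 (lift ord0 j).

Lemma cube_set_cons (c : 'rV[R]_n.+1) r t y :
  cube_set (c, r) (cons_rV (t, y)) <->
  (c ord0 ord0 - r <= t < c 0 ord0 + r)%R /\ cube_set (tl_rV c, r) y.
Proof.
split=> [H|[H1 H2] i]; first split=> [|i].
- by have := H ord0; rewrite mxE unlift_none.
- by have := H (lift ord0 i); rewrite !mxE liftK.
- rewrite mxE; case: (unliftP ord0 i) => [j ->|->] //=.
  by have := H2 j; rewrite /= mxE.
Qed.

Lemma measurable_cube_set m (Q : cube R m) : measurable (cube_set Q).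
Proof.
rewrite (_ : cube_set Q = \big[setI/setT]_(i < m)
  (@rV_coord R m i @^-1` `[(Q.1 0 i - Q.2)%R, (Q.1 0 i + Q.2)%R[%classic)).
  apply: bigsetI_measurable => i _; rewrite -[X in measurable X]setTI.
  by apply: measurable_rV_coord => //; exact: measurable_itv.
rewrite -bigcap_seq; apply/seteqP; split => x /= H.
  by move=> i _ /=; rewrite /rV_coord in_itv/= H.
by move=> i; have := H i (mem_index_enum _); rewrite /= /rV_coord in_itv.
Qed.

Lemma ge0_integral_cube_cons (c : 'rV[R]_n.+1) r (f : 'rV[R]_n.+1 -> \bar R) :
  measurable_fun setT f -> (forall x, 0 <= f x) ->
  \int[lebesgue_rV]_(x in cube_set (c, r)) f x =
  \int[@lebesgue_measure R]_(t in `[(c ord0 ord0 - r)%R, (c ord0 ord0 + r)%R[)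
    \int[@lebesgue_rV R n]_(y in cube_set (tl_rV c, r)) f (cons_rV (t, y)).
Proof.
move=> mf f0; rewrite integral_mkcond ge0_integral_cons_rV; last 2 first.
- apply/(measurable_restrictT _ (measurable_cube_set _)); exact: measurable_funTS.
- by move=> z; rewrite patchE; case: ifP.
rewrite [RHS]integral_mkcond; apply: eq_integral => t _; rewrite patchE.
case: ifPn => tI.
  rewrite [RHS]integral_mkcond; apply: eq_integral => y _; rewrite !patchE.
  congr (if _ then _ else _); apply/idP/idP; rewrite !inE.
    by move=> /cube_set_cons[].
  move=> H; apply/cube_set_cons; split => //.
  by move: tI; rewrite inE/= in_itv.
apply: integral0_eq => y _; rewrite patchE; case: ifPn => //; rewrite inE.
move=> /cube_set_cons[+ _]; move: tI; rewrite notin_setE/= in_itv/=.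
by move=> /[swap] ->.
Qed.

Lemma lebesgue_cube (Q : cube R n) : (0 <= Q.2)%R ->
  lebesgue_rV (cube_set Q) = (side Q ^+ n)%:E.
Proof.
move=> Q0; have := @lebesgue_rV_box R n (\row_i (Q.1 0 i - Q.2)%R)
  (\row_i (Q.1 0 i + Q.2)%R).
rewrite (_ : mkset _ = cube_set Q); last first.
  by apply/seteqP; split => x /= H i; have := H i; rewrite !mxE.
move=> -> => [|i]; last by rewrite !mxE; lra.
congr (_%:E); rewrite (eq_bigr (fun=> side Q)) ?prodr_const ?card_ord//.
by move=> i _; rewrite !mxE /side; lra.
Qed.

End cons.
End tonelli.

(** * Functions Lipschitz in the sup norm and their slices *)

Section lipschitz.
Variables (R : realType) (n : nat).

Lemma ler_mx_norm_rV (x : 'rV[R]_n) (e : R) : 0 <= e ->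
  (`|x| <= e) <-> (forall i, `|x 0 i| <= e).
Proof.
move=> e0; split=> [xe i|H].
  by apply: le_trans xe; rewrite [leRHS]/Num.Def.normr /= mx_normrE;
    apply/bigmax_geP; right => /=; exists (0, i).
rewrite [leLHS]/Num.Def.normr /= mx_normrE; apply/bigmax_leP; split => // -[i j] _ /=.
by rewrite (ord1 i).
Qed.

(* [`| _ |] is the sup norm. *)
Definition lipf (L : R) (U : 'rV[R]_n -> R) :=
  forall x y, `|U x - U y| <= L * `|x - y|.

Lemma lipf_continuous L U : lipf L U -> continuous U.
Proof.
move=> lU x; apply/(@cvgrPdist_lt _ R^o _ (nbhs x) (nbhs_filter x)) => e e0.
have M0 : 0 < `|L| + 1 by rewrite ltr_wpDl.
near=> y; rewrite distrC.
apply: le_lt_trans (lU y x) _.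
apply: le_lt_trans (_ : _ <= (`|L| + 1) * `|y - x|) _.
  by rewrite ler_wpM2r// (le_trans (ler_norm _))// lerDl.
rewrite mulrC -ltr_pdivlMr//.
near: y; apply/nbhs_ballP; exists (e / (`|L| + 1)) => /=; first exact: divr_gt0.
by move=> y; rewrite -ball_normE/= distrC.
Unshelve. all: by end_near. Qed.

Lemma lipf_measurable L U : lipf L U -> measurable_fun setT U.
Proof. by move=> /lipf_continuous; exact: continuous_measurable_rV. Qed.

End lipschitz.

Lemma norm_cons_head (R : realType) n (t s : R) (y : 'rV[R]_n) :
  `|cons_rV (t, y) - cons_rV (s, y)| <= `|t - s|.
Proof.
apply/ler_mx_norm_rV => // i; rewrite !mxE.
by case: (unliftP ord0 i) => [j _|_] //=; rewrite subrr normr0.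
Qed.

Lemma norm_cons_tail (R : realType) n (t : R) (y z : 'rV[R]_n) :
  `|cons_rV (t, y) - cons_rV (t, z)| <= `|y - z|.
Proof.
apply/ler_mx_norm_rV => // i; rewrite !mxE.
case: (unliftP ord0 i) => [j _|_] //=; last by rewrite subrr normr0.
by have /ler_mx_norm_rV := lexx `|y - z| => /(_ (normr_ge0 _) j); rewrite !mxE.
Qed.

Section lipf_slices.
Variables (R : realType) (n : nat) (L : R) (U : 'rV[R]_n.+1 -> R).
Hypotheses (L0 : 0 <= L) (lU : lipf L U).

Lemma lipf_slice_tail t : lipf L (fun y => U (cons_rV (t, y))).
Proof.
move=> y z; apply: (le_trans (lU _ _)); rewrite ler_wpM2l//.
exact: norm_cons_tail.
Qed.

Lemma lipf_slice_head y t s :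
  `|U (cons_rV (t, y)) - U (cons_rV (s, y))| <= L * `|t - s|.
Proof.
apply: (le_trans (lU _ _)); rewrite ler_wpM2l//.
exact: norm_cons_head.
Qed.

End lipf_slices.

(** * Lipschitz functions on the line *)

(** The shape is that of [f = 2 * M * F - M * id + const], the inversion in [lipschitz_ftc] of the
    monotone substitute for [f]. *)
Lemma derive_affine_comp (R : realType) (F : R -> R) (k M c x : R) :
  derivable (F : R -> R^o) x 1 ->
  'D_1 (fun y => k * F y - M * y + c : R^o) x = k * 'D_1 (F : R -> R^o) x - M.
Proof.
move=> dF.
have dF' : is_derive x 1 (F : R -> R^o) ('D_1 (F : R -> R^o) x) by apply: DeriveDef.
have H : is_derive x 1 ((k \*: (F : R -> R^o)) - (M \*: (id : R -> R^o)) + cst c)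
    (k *: 'D_1 (F : R -> R^o) x - M *: 1 + 0).
  by apply: is_deriveD.
rewrite -[LHS]/('D_1 ((k \*: (F : R -> R^o)) - (M \*: (id : R -> R^o)) + cst c) x).
by rewrite derive_val addr0 /GRing.scale/= mulr1.
Qed.

(* [g x = f x / (2 M) + x / 2] is nondecreasing and 1-Lipschitz, so its Lebesgue-Stieltjes
   measure is below Lebesgue measure; by Lebesgue differentiation its Radon-Nikodym density
   is the derivative of [g] almost everywhere. *)
Section lipschitz_ftc.
Variables (R : realType) (f : R -> R) (M : R).
Hypotheses (M0 : 0 < M) (lf : forall x y, `|f x - f y| <= M * `|x - y|).
Notation mu := (@lebesgue_measure R).

Let g (x : R) : R := f x / (2 * M) + x / 2.

Let gD (x y : R) : x <= y -> 0 <= g y - g x <= y - x.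
Proof.
move=> xy; have := lf y x; have yx : 0 <= y - x by rewrite subr_ge0.
rewrite (ger0_norm yx).
rewrite ler_norml => /andP[h1 h2].
have -> : g y - g x = (f y - f x) / (2 * M) + (y - x) / 2.
  by rewrite /g; field; rewrite gt_eqF.
have -> : (y - x) / 2 = M * (y - x) / (2 * M) by field; rewrite gt_eqF.
rewrite -mulrDl; apply/andP; split.
  by apply: divr_ge0; [lra|rewrite mulr_ge0// ltW].
rewrite ler_pdivrMr ?mulr_gt0//; lra.
Qed.

Let g_nd : {homo g : x y / x <= y}.
Proof. by move=> x y /gD/andP[]; rewrite subr_ge0. Qed.

Let g_rc : right_continuous g.
Proof.
apply/right_continuousW/(@lip_continuous _ _ 1) => x y; rewrite mul1r.
have [xy|/ltW yx] := leP x y.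
  have /andP[h1 h2] := gD xy; rewrite distrC (distrC x) !ger0_norm// subr_ge0//.
have /andP[h1 h2] := gD yx; rewrite !ger0_norm// subr_ge0//.
Qed.

HB.instance Definition _ := isCumulative.Build R _ R g g_nd g_rc.

Local Open Scope ereal_scope.

Let lsg := lebesgue_stieltjes_measure g.

(** Both sides are outer measures, infima over the same coverings by half-open intervals, and each
    increment of [g] is at most the length; so [A] may be any set. *)
Let lsg_le A : lsg A <= mu A.
Proof.
apply: le_ereal_inf_tmp => _ [F [mF AF] <-].
apply: (@le_trans _ _ (\sum_(k <oo) wlength g (F k))).
  by apply: ereal_inf_lbound; exists F.
apply: lee_nneseries => [k _ _|k _]; first exact: wlength_ge0.
have [->|[[a b]/= ab ->]] := iffLR (ocitvP _) (mF k).
  by rewrite !wlength0.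
rewrite !wlength_itv_bnd ?(ltW ab)// lee_fin/=.
by have /andP[] := gD (ltW ab).
Qed.

Let lsg_itv (a b : R) : (a <= b)%R -> lsg `]a, b]%classic = (g b - g a)%:E.
Proof.
move=> ab; rewrite /lsg /lebesgue_stieltjes_measure /measure_extension/=.
rewrite measurable_mu_extE/=; first exact: wlength_itv_bnd.
exact: is_ocitv.
Qed.

Lemma lipschitz_ftc (a b : R) : (a <= b)%R ->
  measurable_fun setT (fun x => 'D_1 (f : R -> R^o) x) ->
  `|f b - f a|%:E <= \int[mu]_(x in `[a, b]) `|'D_1 (f : R -> R^o) x|%:E.
Proof.
rewrite le_eqVlt => /predU1P[-> _|ab mD].
  by rewrite subrr normr0; apply: integral_ge0 => x _; rewrite lee_fin.
have mab : measurable (`]a, b]%classic : set (measurableTypeR R)) by exact: measurable_itv.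
have nuoo : lsg `]a, b]%classic < +oo by rewrite lsg_itv ?ltW// ltry.
(* Restricting to []a, b]] makes the Stieltjes measure finite, so that its density is integrable. *)
pose nu : {finite_measure set (measurableTypeR R) -> \bar R} := mfrestr mab nuoo.
have numu : nu `<< mu.
  apply/null_content_dominatesP => A mA A0; apply/eqP.
  rewrite eq_le measure_ge0 andbT -A0 /nu/= /mfrestr /mrestr.
  apply: le_trans (lsg_le _) _.
  by rewrite le_measure ?inE//; exact: measurableI.
have [h [h0 hfin inth hE]] := radon_nikodym_sigma_finite numu.
pose h' : R -> R := fine \o h.
have hh' : h = EFin \o h' by apply/funext => x; rewrite /h'/= fineK.
have inth' : mu.-integrable setT (EFin \o h') by rewrite -hh'.
have loch' : locally_integrable setT h'.
  exact: open_integrable_locally openT inth'.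
pose F (x : R) := (\int[mu]_(t in `]a, x]) h' t)%R.
have FE x : (a <= x <= b)%R -> F x = (g x - g a)%R.
  move=> /andP[ax xb]; rewrite /F /Rintegral.
  rewrite -[in LHS]/(EFin \o h') -hh' -hE//.
  have -> : nu `]a, x]%classic = lsg `]a, x]%classic.
    rewrite /nu/= /mfrestr /mrestr setIidl//.
    by apply: subset_itvl; rewrite bnd_simp.
  by rewrite lsg_itv.
have inth'y y : mu.-integrable [set` Interval (BRight a) (BRight y)] (EFin \o h').
  by apply: integrableS inth' => //.
have FTC := FTC1 inth'y loch'.
have Dae : {ae mu, forall x, x \in `]a, b[ ->
    'D_1 (f : R -> R^o) x = (2 * M * h' x - M)%R}.
  apply: (@filterS _ _ (ae_filter_ringOfSetsType mu) _ _ _ FTC) => x + xab.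
  have := xab; rewrite in_itv/= => /andP[ax xb].
  move=> /(_ ax); rewrite -/F derive1E => -[dF DF].
  (* On [[a, b]] one has [F = g - g a]; solving for [f] shows that it agrees with this combination
     of [F] near the interior point [x]. *)
  have <- : 'D_1 (fun y => 2 * M * F y - M * y + (f a + M * a) : R^o)%R x = (2 * M * h' x - M)%R.
    by rewrite -DF derive_affine_comp.
  apply: near_eq_derive.
  near=> y; rewrite FE; last first.
    by apply/andP; split; apply/ltW; near: y; [exact: lt_nbhsr|exact: lt_nbhsl].
  rewrite /g; field; rewrite gt_eqF//.
have inthab : mu.-integrable `]a, b] (EFin \o h') by exact: integrableS inth'.
have fin_ab : mu `]a, b] < +oo.
  by rewrite lebesgue_measure_itv/=; case: ifP => _; rewrite ?ltry// -EFinB ltry.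
have intM : mu.-integrable `]a, b] (EFin \o cst M).
  apply/integrableP; split; first exact/measurable_EFinP.
  by rewrite /= (integral_cst mu mab `|M|%:E) lte_mul_pinfty// lee_fin.
have intk : mu.-integrable `]a, b] (fun x => (2 * M * h' x)%:E).
  rewrite (_ : (fun x => _) = (fun x => (2 * M)%:E * (EFin \o h') x)).
    exact: integrableZl.
  by apply/funext => x.
rewrite -abse_EFin.
have -> : (f b - f a)%:E = \int[mu]_(x in `]a, b]) (2 * M * h' x - M)%:E.
  under eq_integral do rewrite EFinB.
  rewrite integralB_EFin// integral_cst//.
  under eq_integral do rewrite EFinM.
  rewrite integralZl//.
  have hab : \int[mu]_(x in `]a, b]) (h' x)%:E = (g b - g a)%:E.
    rewrite -(FE b) ?lexx ?ltW// /F /Rintegral fineK//.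
    exact: integrable_fin_num.
  have muab : mu `]a, b] = (b - a)%:E by rewrite lebesgue_measure_itv/= lte_fin ab.
  transitivity ((2 * M)%:E * (g b - g a)%:E - M%:E * (b - a)%:E); last first.
    by rewrite -hab -muab.
  rewrite -!EFinM -EFinB.
  by congr (_%:E); rewrite /g; field; rewrite gt_eqF.
apply: le_trans (le_abse_integral _ _ _) _ => //.
  apply/measurable_EFinP/measurable_funB => //.
  by case/integrableP : intk => /measurable_EFinP.
apply: (@le_trans _ _ (\int[mu]_(x in `]a, b]) `|'D_1 (f : R -> R^o) x|%:E)).
  apply: ae_ge0_le_integral => //.
  - apply/measurableT_comp => //; apply/measurable_EFinP/measurable_funB => //.
    by case/integrableP : intk => /measurable_EFinP.
  - apply/measurable_EFinP/measurableT_comp => //; exact: measurable_funTS.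
  (* [Dae] concerns the open interval, so the endpoint [b] is discarded as a null set. *)
  have Nb : {ae mu, forall x, x != b}.
    exists [set b]; split => //; first exact: lebesgue_measure_set1.
    by move=> x /= /negP; rewrite negbK => /eqP.
  apply: (@filterS2 _ _ (ae_filter_ringOfSetsType mu) _ _ _ _ Nb Dae) => x xb xD; rewrite /= in_itv/= => /andP[ax xb'].
  by rewrite xD// in_itv/= ax lt_neqAle xb xb'.
apply: ge0_subset_integral => //.
- apply/measurable_EFinP/measurableT_comp => //; exact: measurable_funTS.
- by apply: subset_itvr; rewrite bnd_simp.
Unshelve. all: by end_near. Qed.

End lipschitz_ftc.

(** * Measurability of partial derivatives *)

(* The derivative exists exactly on the set [E] where the difference quotients along rational
   increments are Cauchy; off [E], ['D_v U] is the constant junk value of [lim]. *)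
Section measurable_derive.
Variables (R : realType) (n : nat) (L : R) (U : 'rV[R]_n -> R) (v : 'rV[R]_n).
Hypothesis lU : lipf L U.

Let q (h : R) (x : 'rV[R]_n) : R := h^-1 * (U (h *: v + x) - U x).

Let mq h : measurable_fun setT (q h).
Proof.
apply: measurable_funM => //; apply: measurable_funB; last exact: lipf_measurable lU.
apply: (@lipf_measurable _ _ L) => x y; apply: (le_trans (lU _ _)).
by rewrite opprD addrACA subrr add0r.
Qed.

Let cq x h : h != 0 -> {for h, continuous (q ^~ x)}.
Proof.
move=> h0; apply: cvgM; first exact: (@cvgV R _ _ (nbhs_filter h) id h h0 cvg_id).
apply: (@cvgB R R^o _ (nbhs h) (nbhs_filter h)); last exact: cvg_cst.
apply: (@lip_continuous _ _ (L * `|v|)) => y z; apply: (le_trans (lU _ _)).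
by rewrite opprD addrACA subrr addr0 -scalerBl normrZ mulrAC mulrA.
Qed.

Let small m (h : R) : Prop := h != 0 /\ `|h| < m.+1%:R^-1.

Let E := [set x | forall k, exists m, forall r : rat * rat,
   small m (ratr r.1) -> small m (ratr r.2) ->
   `|q (ratr r.1) x - q (ratr r.2) x| <= k.+1%:R^-1].

Let mE : measurable E.
Proof.
have -> : E = \bigcap_k \bigcup_m ~` \bigcup_(r : rat * rat)
   (if `[< small m (ratr r.1) /\ small m (ratr r.2) >] then
   [set x | k.+1%:R^-1 < `|q (ratr r.1) x - q (ratr r.2) x| ] else set0).
  apply/seteqP; split => x.
    move=> Ex k _; have [m Hm] := Ex k; exists m => //= -[r _].
    case: asboolP => // -[s1 s2] /=; rewrite ltNge; apply/negP; rewrite negbK.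
    exact: Hm.
  move=> H k; have [m _ Hm] := H k I; exists m => r s1 s2.
  rewrite leNgt; apply/negP => qq; apply: Hm; exists r => //.
  by case: asboolP => // -[].
apply: bigcap_measurable => [|k _]; first by exists 0%N.
 apply: bigcup_measurable => m _.
apply: measurableC; apply: countable_bigcupT_measurable => // r.
case: asboolP => // _.
have mqq : measurable_fun setT (fun x => `|q (ratr r.1) x - q (ratr r.2) x|).
  by apply/measurableT_comp => //; exact: measurable_funB.
have := @measurable_fun_ltr _ _ _ setT (cst (k.+1%:R^-1)) _ (measurable_cst _) mqq measurableT [set true] I.
rewrite setTI; congr measurable; apply/seteqP; split => x //=.
Qed.

(** The set [E] tests rational increments only, which suffices because [q h x] is continuous in [h]
    away from 0: any small increment has a rational one nearby, also small, with almost the same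
    quotient. *)
Let q_cauchy x : E x -> cauchy (q h x @[h --> 0^']).
Proof.
move=> Ex; apply/cauchyP => e e0.
have [k ke] : exists k : nat, k.+1%:R^-1 < e / 2.
  by apply: natSinv_lt; exact: divr_gt0.
have [m Hm] := Ex k.
pose d : R := m.+1%:R^-1; have d0 : 0 < d by rewrite invr_gt0.
have dense h : small m h -> forall eta, 0 < eta ->
    exists2 r : rat, small m (ratr r) & `|q h x - q (ratr r) x| < eta.
  move=> [h0 hm] eta eta0.
  have : \forall h' \near h, small m h' /\ `|q h x - q h' x| < eta.
    apply: filterI; last first.
      by move/cvgrPdist_lt : (cq (x := x) h0); exact.
    apply: filterI.
      apply/nbhs_ballP; exists `|h|; first by rewrite /= normr_gt0.
      move=> h' /=; rewrite /ball/=; apply: contraTneq => ->.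
      by rewrite subr0 ltxx.
    by apply: (@cvgr_norm_lt _ R^o _ (nbhs h) (nbhs_filter h) id h cvg_id).
  move=> /nbhs_ballP[/= r r0 hr].
  have hh : h < h + r by rewrite ltrDl.
  have [s] := rat_in_itvoo hh; rewrite in_itv/= => /andP[s1 s2].
  have [] := hr (ratr s); first by rewrite /ball/= ltr_norml; apply/andP; split; lra.
  by exists s.
have key h h' : small m h -> small m h' -> `|q h x - q h' x| < e.
  move=> sh sh'.
  have e4 : 0 < e / 4 by lra.
  have [r sr rh] := dense h sh _ e4; have [r' sr' rh'] := dense h' sh' _ e4.
  have := Hm (r, r') sr sr' => /= Hrr.
  have -> : q h x - q h' x = (q h x - q (ratr r) x) +
    (q (ratr r) x - q (ratr r') x) - (q h' x - q (ratr r') x) by ring.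
  apply: (le_lt_trans (ler_normB _ _)); apply: (le_lt_trans (lerD (ler_normD _ _) (lexx _))).
  by move: ke Hrr; set w := _^-1 => ke Hrr; lra.
have d2 : 0 < d / 2 by lra.
exists (q (d / 2) x).
have sd : small m (d / 2) by split; [rewrite gt_eqF|rewrite gtr0_norm// -/d; lra].
suff H : nbhs (0 : R) (fun h => h != 0 -> small m h).
  apply: filterS H => h + h0 => /(_ h0) sh; rewrite /= -ball_normE/=; exact: key.
apply/nbhs_ballP; exists d => //= h; rewrite -ball_normE/= sub0r normrN => hd h0.
by split.
Unshelve. all: by end_near. Qed.

Lemma measurable_derive : measurable_fun setT (fun x => 'D_v (U : _ -> R^o) x).
Proof.
pose c : R := @point R^o.
pose s k x := if `[< E x >] then q (k.+1%:R^-1) x else c.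
have ms k : measurable_fun setT (s k).
  apply: measurable_fun_ifT => //.
  apply: (@measurable_fun_bool _ _ _ _ true).
  rewrite setTI; move: mE; congr measurable.
  by apply/seteqP; split => x /= /asboolP.
apply: (measurable_fun_cvg ms) => x _.
rewrite /s; case: asboolP => Ex; last first.
  rewrite [X in _ --> X](_ : _ = c); first exact: cvg_cst.
  apply: dvgP => cvq; apply: Ex => k.
  have : cauchy_ex (q h x @[h --> 0^']) by exact/cauchyP/cauchy_cvgP.
  have k2 : 0 < k.+1%:R^-1 / 2 :> R by rewrite divr_gt0.
  move=> /(_ _ k2)[l Hl].
  have /nbhs_ballP[d/= d0 H] : nbhs (0 : R)
    (fun h => h != 0 -> ball l (k.+1%:R^-1 / 2) (q h x)) := Hl.
  have [m md] := natSinv_lt d0.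
  exists m => r [r0 rm] [r0' rm'].
  have H1 := H (ratr r.1); have H2 := H (ratr r.2).
  have {}H1 : `|l - q (ratr r.1) x| < k.+1%:R^-1 / 2.
    by apply: H1 => //; rewrite -ball_normE/= sub0r normrN (lt_trans rm).
  have {}H2 : `|l - q (ratr r.2) x| < k.+1%:R^-1 / 2.
    by apply: H2 => //; rewrite -ball_normE/= sub0r normrN (lt_trans rm').
  have -> : q (ratr r.1) x - q (ratr r.2) x =
    (l - q (ratr r.2) x) - (l - q (ratr r.1) x) by ring.
  apply: (le_trans (ler_normB _ _)).
  by move: H1 H2; set w := k.+1%:R^-1 => H1 H2; lra.
have cvq : cvg (q h x @[h --> 0^']) by exact/cauchy_cvgP/q_cauchy.
apply: (@cvg_comp _ _ _ (fun k : nat => k.+1%:R^-1) (fun h => q h x) _ (0^')); last exact: cvq.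
move=> A /nbhs_ballP[d/= d0 H].
rewrite near_simpl; near=> k; apply: H; last by rewrite invr_eq0 pnatr_eq0.
rewrite -ball_normE/= sub0r normrN ger0_norm//.
by near: k; exact: (near_infty_natSinv_lt (PosNum d0)).
Unshelve. all: by end_near. Qed.

End measurable_derive.

(** * A Poincare inequality on cubes *)

Section integral_monotone.
Local Open Scope ereal_scope.

(* Holds for nonmeasurable functions too: the integral is the supremum over the simple
   functions below the integrand. *)
Lemma ge0_le_integral_gen d (T : measurableType d) (R : realType)
    (mu : {measure set T -> \bar R}) (D : set T) (f g : T -> \bar R) :
  (forall x, D x -> 0 <= f x) -> (forall x, D x -> f x <= g x) ->
  \int[mu]_(x in D) f x <= \int[mu]_(x in D) g x.
Proof.
move=> f0 fg; rewrite integral_mkcond [leRHS]integral_mkcond.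
rewrite !ge0_integralTE; last 2 first.
- by move=> x; rewrite patchE; case: ifPn => //; rewrite inE => Dx; rewrite (le_trans (f0 _ Dx))// fg.
- by move=> x; rewrite patchE; case: ifPn => //; rewrite inE => /f0.
apply: ge_ereal_sup => _ [h hf <-]; apply: ereal_sup_ubound; exists h => // x.
apply: le_trans (hf x) _; rewrite !patchE; case: ifPn => //; rewrite inE => Dx.
exact: fg.
Qed.

End integral_monotone.

Section slices.
Variables (R : realType) (n : nat) (U : 'rV[R]_n.+1 -> R).

(** Both sides are limits of the same difference quotient, so the identity holds even where no
    derivative exists. *)
Lemma derive_cons_head t y :
  'D_1 (fun s => U (cons_rV (s, y)) : R^o) t =
  'D_(delta_mx ord0 ord0) (U : _ -> R^o) (cons_rV (t, y)).
Proof.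
rewrite /derive; set f := (fun h : R => _); set g := (fun h : R => _).
suff -> : f = g by [].
apply/funext => h; rewrite /f /g /=.
congr (_ *: (U _ - _)); apply/rowP => i; rewrite !mxE eqxx/=.
case: (unliftP ord0 i) => [j ->|->] /=.
  by rewrite mulr0 add0r.
by [].
Qed.

Lemma derive_cons_tail t y (i : 'I_n) :
  'D_(delta_mx 0 i) (fun z => U (cons_rV (t, z)) : R^o) y =
  'D_(delta_mx 0 (lift ord0 i)) (U : _ -> R^o) (cons_rV (t, y)).
Proof.
rewrite /derive; set f := (fun h : R => _); set g := (fun h : R => _).
suff -> : f = g by [].
apply/funext => h; rewrite /f /g /=.
congr (_ *: (U _ - _)); apply/rowP => j; rewrite !mxE eqxx/=.
case: (unliftP ord0 j) => [k ->|->] /=.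
  by rewrite !mxE (inj_eq lift_inj) eqxx.
by rewrite mulr0 add0r.
Qed.

End slices.

(** The l^1 norm of the gradient: it splits additively into first coordinate and tail ([gsum_cons]),
    which suits an induction on the dimension. *)
Definition gsum (R : realType) n (U : 'rV[R]_n -> R) (x : 'rV[R]_n) : R :=
  \sum_(i < n) `|'D_(delta_mx 0 i) (U : _ -> R^o) x|.

Lemma gsum_ge0 (R : realType) n (U : 'rV[R]_n -> R) x : 0 <= gsum U x.
Proof. exact: sumr_ge0. Qed.

Lemma measurable_gsum (R : realType) n L (U : 'rV[R]_n -> R) : lipf L U ->
  measurable_fun setT (gsum U).
Proof.
move=> lU; apply: measurable_sum => i; apply: measurableT_comp => //.
exact: measurable_derive lU.
Qed.

Lemma gsum_cons (R : realType) n (U : 'rV[R]_n.+1 -> R) t y :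
  gsum U (cons_rV (t, y)) =
  `|'D_1 (fun s => U (cons_rV (s, y)) : R^o) t| + gsum (fun z => U (cons_rV (t, z))) y.
Proof.
rewrite /gsum big_ord_recl derive_cons_head; congr (_ + _).
by apply: eq_bigr => i _; rewrite derive_cons_tail.
Qed.

Section double_poincare.
Local Open Scope ereal_scope.
Variable R : realType.

Lemma lipf_line n L (U : 'rV[R]_n.+1 -> R) (y : 'rV[R]_n) (a b s t : R) :
  (0 <= L)%R -> lipf L U ->
  (a <= s < b)%R -> (a <= t < b)%R ->
  `|U (cons_rV (t, y)) - U (cons_rV (s, y))|%:E <=
  \int[lebesgue_measure]_(x in `[a, b[)
    `|'D_(delta_mx ord0 ord0) (U : _ -> R^o) (cons_rV (x, y))|%:E.
Proof.
move=> L0 lU; wlog st : s t / (s <= t)%R.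
  move=> wh sI tI; have [st|/ltW ts] := leP s t; first exact: wh.
  by rewrite distrC; exact: wh.
move=> /andP[sa sb] /andP[ta tb].
(* [L] may be 0, whereas [lipschitz_ftc] asks for a positive constant. *)
have lf : forall x z, (`|U (cons_rV (x, y)) - U (cons_rV (z, y))| <= (L + 1) * `|x - z|)%R.
  move=> x z; apply: (le_trans (lipf_slice_head L0 lU _ _ _)).
  by rewrite ler_wpM2r// lerDl.
have L1 : (0 < L + 1)%R by rewrite ltr_wpDl.
have mD : measurable_fun setT (fun x => 'D_1 (fun z => U (cons_rV (z, y)) : R^o) x).
  under eq_fun do rewrite derive_cons_head.
  apply: (measurableT_comp (measurable_derive _ lU)).
  apply: (measurableT_comp (@measurable_cons_rV R n)).
  exact: measurable_fun_pair.
apply: (le_trans (lipschitz_ftc L1 lf st mD)).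
under eq_integral do rewrite derive_cons_head.
apply: ge0_subset_integral => //.
  apply/measurable_EFinP/measurableT_comp => //; apply: measurable_funTS.
  by under eq_fun do rewrite -derive_cons_head.
by move=> x /=; rewrite !in_itv/= => /andP[sx xt]; rewrite (le_trans sa)// (le_lt_trans xt).
Qed.

(* Induction on the dimension: join [x] to [y] by a segment in the first coordinate, where
   [lipf_line] applies, followed by a move in the remaining ones. *)
Lemma double_poincare n L (U : 'rV[R]_n -> R) (c : 'rV[R]_n) (r : R) :
  (0 <= L)%R -> lipf L U -> (0 < r)%R ->
  \int[lebesgue_rV]_(x in cube_set (c, r)) \int[lebesgue_rV]_(y in cube_set (c, r))
     `|U x - U y|%:E <=
  ((2 * r) ^+ n.+1)%:E * \int[lebesgue_rV]_(x in cube_set (c, r)) (gsum U x)%:E.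
Proof.
move=> + + r0; have l0 : (0 <= 2 * r)%R by lra.
have lX k : (0 <= (2 * r) ^+ k)%R by rewrite exprn_ge0.
elim: n => [|n IH] in U c * => L0 lU.
  rewrite integral0_eq ?mule_ge0 ?lee_fin ?expr1//.
    by apply: integral_ge0 => x _; rewrite lee_fin gsum_ge0.
  move=> x _; apply: integral0_eq => y _.
  by rewrite (thinmx0 x) (thinmx0 y) subrr normr0.
pose I : set R := `[(c ord0 ord0 - r)%R, (c ord0 ord0 + r)%R[%classic.
pose P := cube_set (tl_rV c, r).
have mI : measurable (I : set (measurableTypeR R)) by exact: measurable_itv.
have mP : measurable P by exact: measurable_cube_set.
have muI : lebesgue_measure I = (2 * r)%:E.
  rewrite lebesgue_measure_itv/= lte_fin ifT; last lra.
  by rewrite -EFinB; congr (_%:E); lra.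
have muP : lebesgue_rV P = ((2 * r) ^+ n)%:E by rewrite lebesgue_cube/= ?ltW.
have cstI (k : \bar R) : \int[lebesgue_measure]_(_ in I) k = (2 * r)%:E * k.
  by rewrite -muI muleC; exact: integral_cst.
have cstP (k : \bar R) : \int[lebesgue_rV]_(_ in P) k = ((2 * r) ^+ n)%:E * k.
  by rewrite -muP muleC; exact: integral_cst.
have mU : measurable_fun setT U by exact: lipf_measurable lU.
have mc := @measurable_cons_rV R n.
pose D0 (t : R) (y : 'rV[R]_n) : \bar R :=
  `|'D_(delta_mx ord0 ord0) (U : _ -> R^o) (cons_rV (t, y))|%:E.
pose H y := \int[lebesgue_measure]_(t in I) D0 t y.
pose B (s : R) (y z : 'rV[R]_n) : \bar R :=
  `|U (cons_rV (s, y)) - U (cons_rV (s, z))|%:E.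
pose K y := \int[lebesgue_measure]_(s in I) \int[lebesgue_rV]_(z in P) B s y z.
have mD0 : measurable_fun setT (fun z : measurableTypeR R * 'rV[R]_n => D0 z.1 z.2).
  apply/measurable_EFinP/measurableT_comp => //.
  rewrite (_ : (fun z => _) = (fun x => 'D_(delta_mx ord0 ord0) (U : _ -> R^o) x) \o @cons_rV R n).
    by apply: measurableT_comp => //; exact: measurable_derive lU.
  by apply/funext => -[].
have D00 t y : 0 <= D0 t y by rewrite lee_fin.
have mH : measurable_fun setT H.
  exact: (@ge0_measurable_fun_integral_fst _ _ _ _ _ lebesgue_measure I
    (fun z : measurableTypeR R * 'rV[R]_n => D0 z.1 z.2)).
have H0 y : 0 <= H y by apply: integral_ge0 => t _; exact: D00.
have mB3 : measurable_fun setT (fun w : (measurableTypeR R * 'rV[R]_n) * 'rV[R]_n =>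
    B w.1.1 w.1.2 w.2).
  apply/measurable_EFinP/measurableT_comp => //; apply: measurable_funB.
    apply: (measurableT_comp mU); apply: (measurableT_comp mc).
    rewrite (_ : (fun w => (w.1.1, w.1.2)) = fst); first exact: measurable_fst.
    by apply/funext => -[[]].
  apply: (measurableT_comp mU); apply: (measurableT_comp mc).
  apply: measurable_fun_pair; last exact: measurable_snd.
  by apply: (measurableT_comp measurable_fst); exact: measurable_fst.
have B0 s y z : 0 <= B s y z by rewrite lee_fin.
have mB2 : measurable_fun setT (fun w : measurableTypeR R * 'rV[R]_n =>
    \int[lebesgue_rV]_(z in P) B w.1 w.2 z).
  exact: (@ge0_measurable_fun_integral_snd _ _ _ _ _ lebesgue_rV P
    (fun w : (measurableTypeR R * 'rV[R]_n) * 'rV[R]_n => B w.1.1 w.1.2 w.2)).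
have B20 s y : 0 <= \int[lebesgue_rV]_(z in P) B s y z.
  by apply: integral_ge0 => z _; exact: B0.
have mK : measurable_fun setT K.
  exact: (@ge0_measurable_fun_integral_fst _ _ _ _ _ lebesgue_measure I
    (fun w : measurableTypeR R * 'rV[R]_n => \int[lebesgue_rV]_(z in P) B w.1 w.2 z)).
have K0 y : 0 <= K y by apply: integral_ge0 => s _; exact: B20.
have mBs y s : measurable_fun setT (B s y).
  pose p (z : 'rV[R]_n) : (measurableTypeR R * 'rV[R]_n) * 'rV[R]_n := ((s, y), z).
  have mp : measurable_fun setT p by exact: measurable_fun_pair.
  exact: (measurableT_comp mB3 mp).
have mBy y : measurable_fun setT (fun s => \int[lebesgue_rV]_(z in P) B s y z).
  pose p (s : R) : measurableTypeR R * 'rV[R]_n := (s, y).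
  have mp : measurable_fun (setT : set (measurableTypeR R)) p by exact: measurable_fun_pair.
  exact: (measurableT_comp mB2 mp).
(* Compare [(t, y)] with [x = (s, z)] through the corner [(s, y)]: the first leg is at most [H y]
   whatever [s] and [t], the second is [B s y z]. *)
have inner t y : I t -> P y -> \int[lebesgue_rV]_(x in cube_set (c, r))
    `|U (cons_rV (t, y)) - U x|%:E <= ((2 * r) ^+ n.+1)%:E * H y + K y.
  move=> It Py; rewrite ge0_integral_cube_cons; last 2 first.
  - apply/measurable_EFinP/measurableT_comp => //; exact: measurable_funB.
  - by move=> x; rewrite lee_fin.
  apply: (@le_trans _ _ (\int[lebesgue_measure]_(s in I)
      (((2 * r) ^+ n)%:E * H y + \int[lebesgue_rV]_(z in P) B s y z))).
    apply: ge0_le_integral_gen => s Is; first by apply: integral_ge0 => z _; rewrite lee_fin.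
    apply: (@le_trans _ _ (\int[lebesgue_rV]_(z in P) (H y + B s y z))).
      apply: ge0_le_integral_gen => z Pz; first by rewrite lee_fin.
      apply: (@le_trans _ _ (`|U (cons_rV (t, y)) - U (cons_rV (s, y))|%:E + B s y z)).
        rewrite -EFinD lee_fin (le_trans _ (ler_normD _ _))//.
        by rewrite addrA subrK.
      apply: leeD => //; apply: (lipf_line _ L0 lU).
        by move: Is; rewrite /I/= in_itv.
      by move: It; rewrite /I/= in_itv.
    rewrite ge0_integralD//; last exact: measurable_funTS.
    by rewrite cstP.
  rewrite ge0_integralD//; last 2 first.
  - by move=> s _; rewrite mule_ge0// lee_fin.
  - by apply: measurable_funTS; exact: mBy.
  by rewrite cstI muleA -EFinM -exprS.
rewrite ge0_integral_cube_cons; last 2 first.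
- apply: (@ge0_measurable_fun_integral_snd _ _ _ _ _ lebesgue_rV (cube_set (c, r))
      (fun w : 'rV[R]_n.+1 * 'rV[R]_n.+1 => `|U w.1 - U w.2|%:E));
    first exact: measurable_cube_set.
  + apply/measurable_EFinP/measurableT_comp => //; apply: measurable_funB.
      by apply: (measurableT_comp mU); exact: measurable_fst.
    by apply: (measurableT_comp mU); exact: measurable_snd.
  + by move=> z; rewrite lee_fin.
- by move=> x; apply: integral_ge0 => y _; rewrite lee_fin.
apply: (@le_trans _ _ (\int[lebesgue_measure]_(t in I) \int[lebesgue_rV]_(y in P)
    (((2 * r) ^+ n.+1)%:E * H y + K y))).
  apply: ge0_le_integral_gen => t It.
    by apply: integral_ge0 => y _; apply: integral_ge0 => z _; rewrite lee_fin.
  apply: ge0_le_integral_gen => y Py; last exact: inner.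
  by apply: integral_ge0 => z _; rewrite lee_fin.
rewrite cstI.
have -> : ((2 * r) ^+ n.+2)%:E = (2 * r)%:E * ((2 * r) ^+ n.+1)%:E :> \bar R.
  by rewrite -EFinM -exprS.
rewrite -[leRHS]muleA; apply: lee_wpmul2l; first by rewrite lee_fin.
rewrite ge0_integralD//; last 3 first.
- by move=> y _; rewrite mule_ge0// lee_fin.
- by apply: measurable_funTS; exact: measurable_funeM.
- exact: measurable_funTS.
rewrite ge0_integralZl//; [|exact: measurable_funTS|by rewrite lee_fin].
rewrite [in leRHS]ge0_integral_cube_cons; last 2 first.
- by apply/measurable_EFinP; exact: measurable_gsum lU.
- by move=> x; rewrite lee_fin gsum_ge0.
pose G t y := (gsum (fun z => U (cons_rV (t, z))) y)%:E : \bar R.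
have GE t y : G t y = (gsum U (cons_rV (t, y)) - `|'D_(delta_mx ord0 ord0) (U : _ -> R^o) (cons_rV (t, y))|)%:E.
  by rewrite /G gsum_cons derive_cons_head [X in (X - _)%R]addrC addrK.
have mG : measurable_fun setT (fun w : measurableTypeR R * 'rV[R]_n => G w.1 w.2).
  under eq_fun do rewrite GE.
  apply/measurable_EFinP; apply: measurable_funB; last exact/measurable_EFinP.
  rewrite (_ : (fun z => _) = gsum U \o @cons_rV R n).
    by apply: measurableT_comp => //; exact: measurable_gsum lU.
  by apply/funext => -[].
have G0 t y : 0 <= G t y by rewrite lee_fin gsum_ge0.
have -> : \int[lebesgue_measure]_(t in I) \int[lebesgue_rV]_(y in P) (gsum U (cons_rV (t, y)))%:E
   = \int[lebesgue_rV]_(y in P) H y +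
     \int[lebesgue_measure]_(t in I) \int[lebesgue_rV]_(y in P) G t y.
  rewrite /H -(@ge0_integral_swap _ _ _ _ _ lebesgue_measure lebesgue_rV I P
    (fun w : measurableTypeR R * 'rV[R]_n => D0 w.1 w.2))//.
  rewrite -ge0_integralD//; last 4 first.
  - by move=> t _; apply: integral_ge0 => y _; exact: D00.
  - apply: measurable_funTS; exact: (@ge0_measurable_fun_integral_snd _ _ _ _ _ lebesgue_rV P
      (fun w : measurableTypeR R * 'rV[R]_n => D0 w.1 w.2)).
  - by move=> t _; apply: integral_ge0 => y _; exact: G0.
  - apply: measurable_funTS; exact: (@ge0_measurable_fun_integral_snd _ _ _ _ _ lebesgue_rV P
      (fun w : measurableTypeR R * 'rV[R]_n => G w.1 w.2)).
  apply: eq_integral => t _; rewrite -ge0_integralD//.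
  - by apply: eq_integral => y _; rewrite gsum_cons derive_cons_head.
  - apply: measurable_funTS.
    pose p (z : 'rV[R]_n) : measurableTypeR R * 'rV[R]_n := (t, z).
    have mp : measurable_fun setT p by exact: measurable_fun_pair.
    exact: (measurableT_comp mD0 mp).
  - apply: measurable_funTS.
    pose p (z : 'rV[R]_n) : measurableTypeR R * 'rV[R]_n := (t, z).
    have mp : measurable_fun setT p by exact: measurable_fun_pair.
    exact: (measurableT_comp mG mp).
have iH0 : 0 <= \int[lebesgue_rV]_(y in P) H y.
  by apply: integral_ge0 => y _; exact: H0.
have iG0 : 0 <= \int[lebesgue_measure]_(t in I) \int[lebesgue_rV]_(y in P) G t y.
  by apply: integral_ge0 => t _; apply: integral_ge0 => y _; exact: G0.
rewrite [leRHS](ge0_muleDr _ iH0 iG0).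
(* Once the integrals are exchanged, the second summand is, for each value of the first coordinate,
   the double integral of a slice, to which [IH] applies. *)
apply: leeD => //; rewrite /K -(@ge0_integral_swap _ _ _ _ _ lebesgue_measure lebesgue_rV I P
  (fun w : measurableTypeR R * 'rV[R]_n => \int[lebesgue_rV]_(z in P) B w.1 w.2 z))//.
rewrite -ge0_integralZl//; last 3 first.
- apply: measurable_funTS; exact: (@ge0_measurable_fun_integral_snd _ _ _ _ _ lebesgue_rV P
      (fun w : measurableTypeR R * 'rV[R]_n => G w.1 w.2)).
- by move=> t _; apply: integral_ge0 => y _; exact: G0.
- by rewrite lee_fin.
apply: ge0_le_integral_gen => t It.
  by apply: integral_ge0 => y _; exact: B20.
exact: (IH _ _ L0 (lipf_slice_tail L0 lU t)).
Qed.

End double_poincare.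

(** * Inequalities for real powers *)

Section powR_inequalities.
Variable R : realType.
Implicit Types (x y z a b e p q r s : R).

Lemma ler_powR2 r x y : 0 <= r -> 0 <= x -> x <= y -> x `^ r <= y `^ r.
Proof.
by move=> r0 x0 xy; apply: ge0_ler_powR => //; rewrite nnegrE// (le_trans x0).
Qed.

Lemma ler_powR2_neg r x y : 0 <= r -> 0 < x -> x <= y -> y `^ (- r) <= x `^ (- r).
Proof.
move=> r0 x0 xy; rewrite !powRN lef_pV2 ?posrE ?powR_gt0 ?(lt_le_trans x0)//.
by apply: ler_powR2 => //; exact: ltW.
Qed.

Lemma powRVN x r : 0 <= x -> (x^-1) `^ r = x `^ (- r).
Proof. by move=> x0; rewrite -powR_inv1// -powRrM mulN1r. Qed.

Lemma powRrMe x r s e : r * s = e -> (x `^ r) `^ s = x `^ e.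
Proof. by move=> <-; rewrite powRrM. Qed.

Lemma powRDe x r s e : 0 < x -> r + s = e -> x `^ r * x `^ s = x `^ e.
Proof. by move=> x0 <-; rewrite powRD// (gt_eqF x0) implybT. Qed.

Lemma powR2N_lt1 r : 0 < r -> 2 `^ (- r) < 1.
Proof.
move=> r0; rewrite powRN invf_lt1 ?powR_gt0//.
have := @gt0_ltr_powR R r r0 1 2.
by rewrite !nnegrE ler01 ler0n ltr1n powR1; exact.
Qed.

(** On [[0, 1]] raising the exponent decreases the power, so the real [q] can be replaced by the
    integer [N], for which the bound is an induction. This is why [N] rather than [q] appears in the
    constants. *)
Lemma bernoulli_powR q (N : nat) x : 1 <= q -> q <= N%:R -> 0 <= x <= 1 ->
  1 - x `^ q <= N%:R * (1 - x).
Proof.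
move=> q1 qN /andP[]; rewrite le_eqVlt => /predU1P[<- _|x0 x1].
  rewrite powR0 ?gt_eqF ?(lt_le_trans _ q1)// !subr0 mulr1; exact: le_trans qN.
apply: (@le_trans _ _ (1 - x ^+ N)).
  by rewrite lerD2l lerN2 -(powR_mulrn _ (ltW x0)); apply: ger_powR => //; rewrite x0.
elim: N {qN} => [|N IH]; first by rewrite expr0 subrr mul0r.
rewrite exprS -natr1 mulrDl mul1r.
have xN : 0 <= x ^+ N <= 1 by rewrite exprn_ge0 ?(ltW x0)//= exprn_ile1 ?(ltW x0).
have : x * (1 - x ^+ N) <= 1 - x ^+ N by rewrite ler_piMl// subr_ge0; case/andP: xN.
by lra.
Qed.

Lemma powR_sub_le q (N : nat) x y : 1 <= q -> q <= N%:R -> 0 <= x <= y ->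
  y `^ q <= x `^ q + N%:R * (y - x) * y `^ (q - 1).
Proof.
move=> q1 qN /andP[x0]; rewrite le_eqVlt => /predU1P[->|xy].
  by rewrite subrr mulr0 mul0r addr0.
have y0 : 0 < y by rewrite (le_lt_trans x0).
have xy01 : 0 <= x / y <= 1.
  by rewrite divr_ge0 ?(ltW y0)//= ler_pdivrMr// mul1r ltW.
have := bernoulli_powR q1 qN xy01.
rewrite powRM ?invr_ge0 ?(ltW y0)// powRVN ?(ltW y0)// => H.
have {H} := ler_wpM2r (powR_ge0 y q) H.
rewrite mulrBl mul1r -(mulrA (x `^ q)) (powRDe y0 (addNr q)) powRr0 mulr1 -lerBlDl.
move=> /le_trans; apply; rewrite -[X in _ * X <= _](mulr_powRB1 (ltW y0)) ?(lt_le_trans _ q1)//.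
rewrite mulrA [leLHS](_ : _ = N%:R * (y - x) * y `^ (q - 1))//.
by field; rewrite gt_eqF.
Qed.

(** A discrete form of [(S ^ q)' = q S' S ^ (q - 1)]: telescope the powers of the partial sums and
    bound each increment by [powR_sub_le]. *)
Lemma sum_powR_le q (N m : nat) (a : nat -> R) : 1 <= q -> q <= N%:R ->
  (forall k, 0 <= a k) ->
  (\sum_(k < m) a k) `^ q <=
  N%:R * \sum_(k < m) a k * (\sum_(j < k.+1) a j) `^ (q - 1).
Proof.
move=> q1 qN a0; elim: m => [|m IH].
  by rewrite !big_ord0 powR0 ?mulr0// gt_eqF// (lt_le_trans _ q1).
rewrite big_ord_recr/= [X in _ <= _ * X]big_ord_recr/= mulrDr.
have S0 : 0 <= \sum_(k < m) a k by exact: sumr_ge0.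
have := @powR_sub_le q N (\sum_(k < m) a k) (\sum_(k < m) a k + a m) q1 qN.
rewrite S0 lerDl a0 => /(_ isT) /le_trans; apply.
rewrite [_ + a m - _]addrAC subrr add0r lerD// big_ord_recr/= mulrA.
exact: lexx.
Qed.

(** No convexity is involved: if [u <= e * b] the first term alone is large enough, and otherwise
    [b < u / e] and the second is. *)
Lemma young_eps p e u b : 1 <= p -> 0 < e -> 0 <= u -> 0 <= b ->
  u * b `^ (p - 1) <= e * b `^ p + e `^ (1 - p) * u `^ p.
Proof.
move=> p1 e0 u0 b0; have p0 : 0 < p by rewrite (lt_le_trans _ p1).
have [ueb|ebu] := leP u (e * b).
  rewrite -(mulr_powRB1 b0 p0) mulrA ler_wpDr ?mulr_ge0 ?powR_ge0//.
  by rewrite ler_wpM2r ?powR_ge0.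
have bu : b <= u / e by rewrite ler_pdivlMr// mulrC ltW.
rewrite ler_wpDl ?mulr_ge0 ?powR_ge0 ?(ltW e0)//.
apply: (@le_trans _ _ (u * (u / e) `^ (p - 1))).
  by rewrite ler_wpM2l// ler_powR2// subr_ge0.
rewrite powRM ?invr_ge0 ?(ltW e0)// powRVN ?(ltW e0)// opprB mulrA mulr_powRB1//.
by rewrite mulrC.
Qed.

Lemma powR_interp a b z x : 0 < a <= b -> 0 < x -> 0 <= z ->
  z `^ a <= x `^ a + x `^ (a - b) * z `^ b.
Proof.
move=> /andP[a0 ab] x0 z0; have [zx|xz] := leP z x.
  by rewrite ler_wpDr ?mulr_ge0 ?powR_ge0// ler_powR2// ltW.
rewrite ler_wpDl ?powR_ge0//.
have {}z0 : 0 < z by rewrite (lt_trans x0).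
rewrite -(powRDe z0 (_ : (a - b) + b = a)) ?subrK// ler_wpM2r ?powR_ge0//.
by rewrite -(opprB b a) ler_powR2_neg ?subr_ge0// ltW.
Qed.

Lemma geom_sum_small x (m : nat) y : 0 < x -> 0 <= y ->
  \sum_(k < m | x / 2 ^+ k <= y) (x / 2 ^+ k) <= 2 * y.
Proof.
move=> x0 y0; suff : \sum_(k < m | x / 2 ^+ k <= y) (x / 2 ^+ k) <= 2 * Num.min x y.
  by move=> /le_trans; apply; rewrite ler_wpM2l// ge_min lexx orbT.
elim: m x x0 => [|m IH] x x0.
  by rewrite big_ord0 mulr_ge0// le_min y0 ltW.
rewrite big_mkcond big_ord_recl/= expr0 divr1.
rewrite (eq_bigr (fun k : 'I_m => if x / 2 / 2 ^+ k <= y then x / 2 / 2 ^+ k else 0)).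
  rewrite -big_mkcond/=; have := IH (x / 2) (divr_gt0 x0 (ltr0n _ 2)).
  move: (\sum_(_ < m | _) _) => S.
  by case: (leP x y); case: (leP (x / 2) y); move: x0 y0; lra.
by move=> k _; rewrite /bump/= exprD expr1 invfM mulrA.
Qed.

Lemma geom_sum_large x (m : nat) y d : 0 < x -> 0 < y -> 0 < d ->
  \sum_(k < m | y < x / 2 ^+ k) (x / 2 ^+ k) `^ (- d) <=
  (1 - 2 `^ (- d))^-1 * y `^ (- d).
Proof.
move=> x0 y0 d0; set t := 2 `^ (- d); set K := (1 - t)^-1.
have t0 : 0 < t by rewrite powR_gt0.
have t1 : t < 1.
  exact: powR2N_lt1.
have K0 : 0 < K by rewrite invr_gt0 subr_gt0.
have Kt : K * t + 1 = K by rewrite /K; field; rewrite gt_eqF// subr_gt0.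
have lk0 k : 0 < x / 2 ^+ k by rewrite divr_gt0// exprn_gt0.
have step k : (x / 2 ^+ k) `^ (- d) = t * (x / 2 ^+ k.+1) `^ (- d).
  have -> : x / 2 ^+ k = 2 * (x / 2 ^+ k.+1).
    by rewrite exprS; field; rewrite expf_eq0 pnatr_eq0 andbF.
  by rewrite powRM// ltW.
(* The terms grow by the factor [1 / t], so a sum is governed by its last term, which is
   [t * (x / 2 ^+ m) ^ (- d)] when all [m] indices count. Keeping this inside the minimum makes the
   induction close, through [K * t + 1 = K]. *)
suff : \sum_(k < m | y < x / 2 ^+ k) (x / 2 ^+ k) `^ (- d) <=
    K * Num.min (t * (x / 2 ^+ m) `^ (- d)) (y `^ (- d)).
  by move=> /le_trans; apply; rewrite ler_pM2l// ge_min lexx orbT.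
elim: m => [|m IH].
  by rewrite big_ord0 mulr_ge0 ?ltW// lt_min mulr_gt0 ?powR_gt0.
rewrite big_mkcond big_ord_recr/= -big_mkcond/= -step.
move: IH; move: (\sum_(_ < m | _) _) => S.
set A := (x / 2 ^+ m) `^ (- d); set B := y `^ (- d).
have A0 : 0 < A by rewrite powR_gt0.
have tA : t * A <= A by rewrite ler_piMl// ltW.
case: ifPn => [yx|yx] IH.
  have AB : A <= B by rewrite ler_powR2_neg// ltW.
  rewrite (min_idPl AB) -Kt mulrDl mul1r lerD2r -mulrA.
  by apply: (le_trans IH); rewrite ler_pM2l// ge_min lexx.
rewrite addr0; apply: (le_trans IH); rewrite ler_pM2l//.
by rewrite le_min !ge_min tA lexx orbT.
Qed.

Lemma geom_sum_powR x (m : nat) d : 0 < x -> 0 < d ->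
  \sum_(k < m) (x / 2 ^+ k) `^ (- d) <= (1 - 2 `^ (- d))^-1 * (x / 2 ^+ m) `^ (- d).
Proof.
move=> x0 d0; have lk0 k : 0 < x / 2 ^+ k by rewrite divr_gt0// exprn_gt0.
apply: le_trans (geom_sum_large m x0 (lk0 m) d0).
rewrite [leRHS](eq_bigl xpredT)// => k; rewrite ltr_pM2l//.
by rewrite ltf_pV2 ?posrE ?exprn_gt0// ltr_eXn2l ?ltr1n// ltn_ord.
Qed.

(** Hedberg's splitting of scales: below a critical length use [X k <= Y], above it use the decay in
    [x / 2 ^+ k]. Both parts are geometric sums, the second because [1 - g * s < 0]. *)
Lemma scale_sum_le x (m : nat) (X : nat -> R) g s G Y :
  0 < x -> 0 < g -> 0 < s -> 1 < g * s -> 0 <= G ->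
  (forall k, (k < m)%N -> 0 <= X k <= Y /\ X k <= G * (x / 2 ^+ k) `^ (- g)) ->
  \sum_(k < m) (x / 2 ^+ k) * X k `^ s <=
  (2 + (1 - 2 `^ (1 - g * s))^-1) * (G `^ g^-1 * Y `^ (s - g^-1)).
Proof.
move=> x0 g0 s0 gs G0 XP; set d := g * s - 1; have d0 : 0 < d by rewrite subr_gt0.
have lk0 k : 0 < x / 2 ^+ k by rewrite divr_gt0// exprn_gt0.
have -> : 1 - g * s = - d by rewrite opprB.
have t1 : 0 < (1 - 2 `^ (- d))^-1.
  by rewrite invr_gt0 subr_gt0 powR2N_lt1.
have RHS0 : 0 <= (2 + (1 - 2 `^ (- d))^-1) * (G `^ g^-1 * Y `^ (s - g^-1)).
  by rewrite mulr_ge0 ?mulr_ge0 ?powR_ge0// ltW// addr_gt0.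
have zero : (forall k, (k < m)%N -> X k <= 0) ->
    \sum_(k < m) (x / 2 ^+ k) * X k `^ s <= (2 + (1 - 2 `^ (- d))^-1) * (G `^ g^-1 * Y `^ (s - g^-1)).
  move=> X0; rewrite big1// => k _.
  have [/andP[Xk0 _] _] := XP k (ltn_ord k).
  have -> : X k = 0 by apply/le_anti; rewrite X0.
  by rewrite powR0 ?gt_eqF// mulr0.
move: G0; rewrite le_eqVlt => /predU1P[G0|G0].
  by apply: zero => k km; have [_] := XP k km; rewrite -G0 mul0r.
have [Y0|Y0] := leP Y 0.
  by apply: zero => k km; have [/andP[_ h] _] := XP k km; rewrite (le_trans h).
(* The length at which the two bounds on [X k] coincide: [G * y ^ (- g) = Y]. The degenerate cases
   [G = 0] and [Y <= 0] were removed beforehand. *)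
pose y := (G / Y) `^ g^-1.
have y0 : 0 < y by rewrite powR_gt0// divr_gt0.
apply: (@le_trans _ _ (\sum_(k < m) ((if x / 2 ^+ k <= y then x / 2 ^+ k * Y `^ s else 0)
   + (if y < x / 2 ^+ k then (x / 2 ^+ k) `^ (- d) * G `^ s else 0)))).
  apply: ler_sum => k _; have [/andP[X0 XY] XG] := XP k (ltn_ord k).
  case: leP => _.
    by rewrite addr0 ler_wpM2l ?(ltW (lk0 _))// ler_powR2// ltW.
  rewrite add0r; apply: (@le_trans _ _ (x / 2 ^+ k * (G * (x / 2 ^+ k) `^ (- g)) `^ s)).
    by rewrite ler_wpM2l ?(ltW (lk0 _))// ler_powR2// ltW.
  rewrite (powRM s (ltW G0) (powR_ge0 _ _)) (powRrMe _ (mulNr g s)).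
  rewrite mulrCA [leRHS]mulrC ler_wpM2l ?powR_ge0//.
  rewrite -{1}(powRr1 (ltW (lk0 k))) (@powRDe _ _ _ (- d))// /d; lra.
rewrite big_split/= -!big_mkcond/= -!mulr_suml mulrDl lerD//.
  apply: (@le_trans _ _ (2 * y * Y `^ s)).
    by rewrite ler_wpM2r ?powR_ge0// geom_sum_small// ltW.
  rewrite -mulrA ler_wpM2l// /y powRM ?invr_ge0 ?(ltW Y0) ?(ltW G0)// powRVN ?(ltW Y0)// -mulrA.
  by rewrite (@powRDe _ _ _ (s - g^-1))// addrC.
apply: (@le_trans _ _ ((1 - 2 `^ (- d))^-1 * y `^ (- d) * G `^ s)).
  by rewrite ler_wpM2r ?powR_ge0// geom_sum_large.
rewrite -mulrA ler_wpM2l ?(ltW t1)// /y.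
have dE : g^-1 * - d = g^-1 - s by rewrite /d; field; rewrite gt_eqF.
rewrite (powRrMe _ dE) powRM ?invr_ge0 ?(ltW Y0) ?(ltW G0)// powRVN ?(ltW Y0)// opprB mulrAC.
by rewrite (@powRDe _ _ _ g^-1)// subrK.
Qed.

End powR_inequalities.

(** * Dyadic cells *)

Section dyadic_cells.
Variables (R : realType) (n : nat) (a : 'rV[R]_n) (l : R).
Hypothesis l0 : 0 < l.
Implicit Types (x y : 'rV[R]_n) (k : nat).

Definition dindex k x (i : 'I_n) : int := Num.floor ((x 0 i - a 0 i) / (l / 2 ^+ k)).

(** A subset of the product, so that its indicator is a jointly measurable kernel to which Tonelli
    applies. *)
Definition dsame k : set ('rV[R]_n * 'rV[R]_n) :=
  [set z | forall i, dindex k z.1 i = dindex k z.2 i].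

Definition dcell k x : cube R n :=
  (\row_i (a 0 i + (dindex k x i)%:~R * (l / 2 ^+ k) + l / 2 ^+ k / 2), l / 2 ^+ k / 2).

Let h0 k : 0 < l / 2 ^+ k. Proof. by rewrite divr_gt0// exprn_gt0. Qed.

Lemma dcellP k x y : cube_set (dcell k x) y <-> dsame k (x, y).
Proof.
suff H i : (dcell k x).1 0 i - (dcell k x).2 <= y 0 i < (dcell k x).1 0 i + (dcell k x).2
    = (dindex k x i == dindex k y i).
  split=> [h i|h i]; first by apply/eqP; rewrite -H; exact: h.
  by rewrite H; apply/eqP; exact: h.
rewrite mxE/= eq_sym floor_eq.
set m := dindex k x i; have h := h0 k.
rewrite ler_pdivlMr// ltr_pdivrMr// intrD.
congr (_ && _); apply/idP/idP; lra.
Qed.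

Lemma dsame_sym k x y : dsame k (x, y) -> dsame k (y, x).
Proof. by move=> H i; rewrite /= H. Qed.

Lemma dcell_self k x : cube_set (dcell k x) x.
Proof. exact/dcellP. Qed.

Lemma dcell_eq k x y : dsame k (x, y) -> dcell k x = dcell k y.
Proof. by move=> H; congr pair; apply/rowP => i; rewrite !mxE H. Qed.

(** Halving the mesh doubles the quotient inside [Num.floor], and the floor of [2 * u] determines
    that of [u]. *)
Lemma dsameS k x y : dsame k.+1 (x, y) -> dsame k (x, y).
Proof.
move=> H i /=; have /= := H i; rewrite /dindex.
have E z : z / (l / 2 ^+ k.+1) = 2 * (z / (l / 2 ^+ k)).
  have e0 : 2 ^+ k != 0 :> R by rewrite expf_eq0 pnatr_eq0 andbF.
  by rewrite exprS; field; rewrite ?e0 ?(gt_eqF l0).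
rewrite !E; set u := (x 0 i - _) / _; set v := (y 0 i - _) / _ => uv.
have [u1 u2] := (floor_le (2 * u), floorD1_gt (2 * u)).
have [v1 v2] := (floor_le (2 * v), floorD1_gt (2 * v)).
have [w1 w2] := (floor_le u, floorD1_gt u).
apply/esym/eqP; rewrite floor_eq.
rewrite -uv in v1 v2.
set m := Num.floor (2 * u) in u1 u2 v1 v2; set w := Num.floor u in w1 w2 *.
have A1 : 2 * w <= m.
  rewrite -ltzD1 -(ltr_int R) (le_lt_trans _ u2)// intrM; lra.
have A2 : m + 1 <= 2 * w + 2.
  rewrite lezD1 -(ltr_int R) (le_lt_trans u1)// intrD intrM; move: w2; rewrite intrD; lra.
move: A1 A2; rewrite -(ler_int R) -(ler_int R (m + 1)) !intrD !intrM => A1 A2.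
move: v2; rewrite intrD => v2; apply/andP; split; lra.
Qed.

Lemma dsame_le k j x y : (j <= k)%N -> dsame k (x, y) -> dsame j (x, y).
Proof.
elim: k => [|k IH]; first by rewrite leqn0 => /eqP ->.
rewrite leq_eqVlt => /predU1P[->//|]; rewrite ltnS => jk /dsameS; exact: IH.
Qed.

Lemma measurable_dindex k i :
  measurable_fun setT (fun x => (dindex k x i)%:~R : R).
Proof.
have mfl : measurable_fun setT (fun t : R => (Num.floor t)%:~R : R).
  apply: nondecreasing_measurable => // s t st.
  by rewrite ler_int; exact: le_floor.
apply: (measurableT_comp mfl); apply: measurable_funM => //.
by apply: measurable_funB => //; exact: measurable_rV_coord.
Qed.

Lemma measurable_dsame k : measurable (dsame k).
Proof.
pose e i (z : 'rV[R]_n * 'rV[R]_n) := (dindex k z.1 i)%:~R == (dindex k z.2 i)%:~R :> R.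
have me i : measurable [set z | e i z].
  have m1 : measurable_fun setT (fun z : 'rV[R]_n * 'rV[R]_n => (dindex k z.1 i)%:~R : R).
    exact: (measurableT_comp (measurable_dindex k i) measurable_fst).
  have m2 : measurable_fun setT (fun z : 'rV[R]_n * 'rV[R]_n => (dindex k z.2 i)%:~R : R).
    exact: (measurableT_comp (measurable_dindex k i) measurable_snd).
  have := @measurable_fun_eqr _ _ _ setT _ _ m1 m2 measurableT [set true] I.
  by rewrite setTI; congr measurable; apply/seteqP; split => z.
rewrite (_ : dsame k = \big[setI/setT]_(i < n) [set z | e i z]).
  by apply: bigsetI_measurable => i _.
rewrite -bigcap_seq; apply/seteqP; split => z /= H.
  by move=> i _ /=; rewrite /e H.
move=> i; have := H i (mem_index_enum _); rewrite /= /e => /eqP/intr_inj//.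
Qed.

Lemma side_dcell k x : side (dcell k x) = l / 2 ^+ k.
Proof. by rewrite /side/=; field; rewrite expf_eq0 pnatr_eq0 andbF. Qed.

End dyadic_cells.

Lemma dcell0 (R : realType) n (c : 'rV[R]_n) (r : R) x : 0 < r ->
  cube_set (c, r) x -> dcell (\row_i (c 0 i - r)) (2 * r) 0 x = (c, r).
Proof.
move=> r0 Px; rewrite /dcell expr0 divr1; congr pair; last by field.
apply/rowP => i; rewrite !mxE.
suff -> : dindex (\row_i (c 0 i - r)) (2 * r) 0 x i = 0 by rewrite mul0r; field.
apply/eqP; rewrite floor_eq mxE expr0 divr1 add0r.
have /= /andP[x1 x2] := Px i; rewrite divr_ge0/=; [|lra|lra].
by rewrite ltr_pdivrMr; lra.
Qed.

(** * Representative values on cubes and power means *)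

Section pick_point.
Local Open Scope ereal_scope.
Variable R : realType.

(** [double_poincare] bounds the average over [y] of the left-hand side, and some point of the cube
    does not exceed the average. *)
Lemma poincare_pt n L (U : 'rV[R]_n -> R) (c : 'rV[R]_n) (r : R) :
  (0 <= L)%R -> lipf L U -> (0 < r)%R ->
  exists2 y, cube_set (c, r) y &
  \int[lebesgue_rV]_(x in cube_set (c, r)) `|U x - U y|%:E <=
  (2 * r)%:E * \int[lebesgue_rV]_(x in cube_set (c, r)) (gsum U x)%:E.
Proof.
move=> L0 lU r0; set P := cube_set (c, r).
have mP : measurable P by exact: measurable_cube_set.
have lP : lebesgue_rV P = ((2 * r) ^+ n)%:E by rewrite lebesgue_cube/= ?ltW.
have Pc : P c by move=> i /=; apply/andP; split; lra.
have mU : measurable_fun setT U by exact: lipf_measurable lU.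
have I0 : 0 <= \int[lebesgue_rV]_(x in P) (gsum U x)%:E.
  by apply: integral_ge0 => x _; rewrite lee_fin gsum_ge0.
set B := _ * _.
have B0 : 0 <= B by rewrite mule_ge0// lee_fin; lra.
apply: contrapT => H.
pose g y := \int[lebesgue_rV]_(x in P) `|U y - U x|%:E.
have gB y : P y -> B < g y.
  move=> Py; rewrite ltNge; apply/negP => gy; apply: H; exists y => //.
  by under eq_integral do rewrite distrC.
(* Finiteness of [B] comes from the assumption to be refuted, which puts [B] strictly below [g c].
   Then [g - B] is positive on [P] with integral 0, although [P] has positive measure. *)
have Bfin : B \is a fin_num.
  by rewrite ge0_fin_numE// (lt_le_trans (gB c Pc))// leey.
have mg : measurable_fun setT g.
  apply: (@ge0_measurable_fun_integral_snd _ _ _ _ _ lebesgue_rV P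
      (fun w : 'rV[R]_n * 'rV[R]_n => `|U w.1 - U w.2|%:E)) => //.
  apply/measurable_EFinP/measurableT_comp => //; apply: measurable_funB.
    by apply: (measurableT_comp mU); exact: measurable_fst.
  by apply: (measurableT_comp mU); exact: measurable_snd.
have le1 : \int[lebesgue_rV]_(y in P) g y <= ((2 * r) ^+ n)%:E * B.
  apply: (le_trans (double_poincare c L0 lU r0)).
  by rewrite exprSr EFinM muleA.
pose h y := g y - B.
have h0 y : P y -> 0 <= h y by move=> Py; rewrite sube_ge0 ?Bfin//; apply/ltW/gB.
have mh : measurable_fun P h.
  by apply: emeasurable_funB => //; exact: measurable_funTS.
have gE : \int[lebesgue_rV]_(y in P) g y = \int[lebesgue_rV]_(y in P) h y + ((2 * r) ^+ n)%:E * B.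
  rewrite (_ : ((2 * r) ^+ n)%:E * B = \int[lebesgue_rV]_(y in P) (cst B y)); last first.
    by rewrite -lP muleC; apply/esym; exact: integral_cst.
  rewrite -ge0_integralD//.
  by apply: eq_integral => y _; rewrite /h subeK.
have h00 : \int[lebesgue_rV]_(y in P) h y = 0.
  apply/eqP; rewrite eq_le integral_ge0// andbT.
  move: le1; rewrite gE; have fB : ((2 * r) ^+ n)%:E * B \is a fin_num by rewrite fin_numM.
  by rewrite -[leRHS]add0e leeD2rE.
have : \int[lebesgue_rV]_(y in P) `|h y| = 0.
  by rewrite -h00; apply: eq_integral => y /[!inE] Py; rewrite gee0_abs// h0.
move=> /ae_eq_integral_abs -/(_ mP mh)[N [mN N0 PN]].
have : lebesgue_rV P = 0.
  apply: (subset_measure0 mP mN _ N0) => y Py; apply: PN => /= /(_ Py) hy.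
  by have := gB y Py; rewrite -sube_gt0// -/(h y) hy ltxx.
rewrite lP => -[] /eqP; rewrite expf_eq0 => /andP[_ /eqP]; lra.
Qed.

(** Hoelder's inequality up to the factor 2: integrate [powR_interp] and take the threshold
    [x = F * v ^ (- 1 / b)], at which its two terms contribute equally. *)
Lemma power_mean d (T : measurableType d) (mu : {measure set T -> \bar R})
    (D : set T) (h : T -> R) (a b F v : R) :
  measurable D -> measurable_fun D h -> (forall x, D x -> 0 <= h x)%R ->
  mu D = v%:E -> (0 < v)%R -> (0 < a <= b)%R -> (0 <= F)%R ->
  \int[mu]_(x in D) (h x `^ b)%:E <= (F `^ b)%:E ->
  \int[mu]_(x in D) (h x `^ a)%:E <= (2 * F `^ a * v `^ (1 - a / b))%:E.
Proof.
move=> mD mh h0 muD v0 /[dup] ab /andP[a0 ab'] F0 Hb.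
have b0 : (0 < b)%R by rewrite (lt_le_trans a0).
have mpow e : measurable_fun D (fun x => (h x `^ e)%:E).
  by apply/measurable_EFinP; exact: (measurableT_comp (measurable_powR _) mh).
have main x : (0 < x)%R -> \int[mu]_(y in D) (h y `^ a)%:E <= (x `^ a * v + x `^ (a - b) * F `^ b)%:E.
  move=> x0; apply: (@le_trans _ _ (\int[mu]_(y in D) ((x `^ a)%:E + (x `^ (a - b))%:E * (h y `^ b)%:E))).
    apply: ge0_le_integral_gen => y Dy; first by rewrite lee_fin powR_ge0.
    by rewrite -EFinM -EFinD lee_fin powR_interp// h0.
  have c0 y : D y -> 0 <= (x `^ (a - b))%:E * (h y `^ b)%:E.
    by move=> _; rewrite -EFinM lee_fin mulr_ge0 ?powR_ge0.
  have mc : measurable_fun D (fun y => (x `^ (a - b))%:E * (h y `^ b)%:E).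
    exact: measurable_funeM.
  have c1 y : D y -> 0 <= (x `^ a)%:E by rewrite lee_fin powR_ge0.
  rewrite ge0_integralD//.
  rewrite (integral_cst mu mD (x `^ a)%:E) [X in _ * X + _]muD.
  rewrite ge0_integralZl//; last 2 first.
  - by move=> y _; rewrite lee_fin powR_ge0.
  - by rewrite lee_fin powR_ge0.
  rewrite EFinD !EFinM leeD2l// lee_wpmul2l// lee_fin powR_ge0//.
(* For [F = 0] the optimal threshold degenerates to 0; thresholds with [x ^ a * v = e] are used
   instead, for every [e > 0]. *)
move: F0; rewrite le_eqVlt => /predU1P[F0|F0].
  rewrite -F0 (powR0 (lt0r_neq0 a0)) mulr0 mul0r.
  apply/lee_addgt0Pr => e e0; rewrite add0e.
  have x0 : (0 < (e / v) `^ a^-1)%R by rewrite powR_gt0// divr_gt0.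
  apply: (le_trans (main _ x0)); rewrite -F0 (powR0 (lt0r_neq0 b0)) mulr0 addr0.
  rewrite -powRrM mulVf ?gt_eqF// powRr1 ?divfK ?gt_eqF// divr_ge0// ltW//.
have x0 : (0 < F * v `^ (- b^-1))%R by rewrite mulr_gt0 ?powR_gt0.
apply: (le_trans (main _ x0)); rewrite lee_fin.
rewrite !powRM ?(ltW F0) ?powR_ge0//.
rewrite (@powRrMe _ v _ a (- (a / b))) 1?mulrC ?mulrN ?mulNr//.
rewrite (@powRrMe _ v _ (a - b) (1 - a / b)); last by field; rewrite gt_eqF.
have -> : (F `^ (a - b) * v `^ (1 - a / b) * F `^ b = F `^ a * v `^ (1 - a / b))%R.
  by rewrite mulrAC (@powRDe _ _ _ _ a)// subrK.
have E1 : (v * v `^ (- (a / b)) = v `^ (1 - a / b))%R.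
  by rewrite -{1}(powRr1 (ltW v0)) (@powRDe _ v _ _ (1 - a / b)).
by rewrite mulrCA E1 -mulrA mulr2n mulrDl !mul1r.
Qed.

End pick_point.

(** * The Sobolev inequality on cubes *)

(** Integrate the constant [|m1 - m2|] over the common subcube [Q], where it is at most the sum of
    the two deviations of [U]. *)
Lemma value_jump (R : realType) n (U : 'rV[R]_n -> R) (Q Q1 Q2 : cube R n)
    (m1 m2 B1 B2 : R) :
  measurable_fun (cube_set Q1) U -> measurable_fun (cube_set Q2) U -> 0 <= Q.2 ->
  cube_set Q `<=` cube_set Q1 -> cube_set Q `<=` cube_set Q2 ->
  (\int[lebesgue_rV]_(x in cube_set Q1) `|U x - m1|%:E <= B1%:E)%E ->
  (\int[lebesgue_rV]_(x in cube_set Q2) `|U x - m2|%:E <= B2%:E)%E ->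
  side Q ^+ n * `|m1 - m2| <= B1 + B2.
Proof.
move=> mU1 mU2 Q0 QQ1 QQ2 H1 H2.
have mQ (Q' : cube R n) : measurable (cube_set Q') by exact: measurable_cube_set.
have md (A : set 'rV[R]_n) m : measurable_fun A U -> measurable_fun A (fun x => `|U x - m|%:E).
  by move=> mU; apply/measurable_EFinP/measurableT_comp => //; exact: measurable_funB.
have d0 (m : R) x : (0 <= `|U x - m|%:E)%E by rewrite lee_fin.
rewrite -lee_fin [leRHS]EFinD.
apply: le_trans (leeD (le_trans _ H1) (le_trans _ H2)); last 2 first.
- by apply: ge0_subset_integral QQ1 => //; exact: md.
- by apply: ge0_subset_integral QQ2 => //; exact: md.
rewrite -ge0_integralD//; [|exact: md (measurable_funS (mQ _) QQ1 mU1)|exact: md (measurable_funS (mQ _) QQ2 mU2)].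
rewrite EFinM -lebesgue_cube// muleC -(integral_cst (@lebesgue_rV R n))//.
apply: ge0_le_integral_gen => x _ /=; first by rewrite lee_fin.
rewrite -EFinD lee_fin (_ : m1 - m2 = (U x - m2) - (U x - m1)); last by ring.
by apply: (le_trans (ler_normB _ _)); rewrite addrC.
Qed.

Lemma cube_norm_le (R : realType) n (Q : cube R n) x y :
  0 <= Q.2 -> cube_set Q x -> cube_set Q y -> `|x - y| <= side Q.
Proof.
move=> Q0 Qx Qy; apply/ler_mx_norm_rV; first by rewrite /side mulr_ge0.
move=> i; rewrite !mxE /side; have /andP[x1 x2] := Qx i; have /andP[y1 y2] := Qy i.
by rewrite ler_norml; apply/andP; split; lra.
Qed.

(* With [D k x] the dyadic subcube of generation [k] and side [lk k] containing [x],
   [T m x = \sum_(k < m) a k x] bounds the oscillation of [U] along the cells shrinking to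
   [x].  Fubini gives [\int a k * g = A0 * lk k * \int f * g] when [g] is constant on the cells
   of generation [k], hence [\int T^q <= C * \int f * \sum_k lk k * (T k.+1)^(q-1)].  The
   inner sum is at most [C * F^(1/gam) * T^(q/p')], and Young's inequality absorbs [\int T^q]. *)
Section sobolev.
Variables (R : realType) (n : nat) (p : R).
Hypotheses (p1 : 1 < p) (pn : p < n%:R).

Let p0 : 0 < p. Proof. exact: lt_trans p1. Qed.
Let n0 : 0 < n%:R :> R. Proof. exact: lt_trans pn. Qed.

(* [q] is the Sobolev exponent np/(n-p), and [gam = n/q]. *)
Let gam : R := n%:R / p - 1.
Let q : R := n%:R / gam.

Let gam0 : 0 < gam.
Proof. by rewrite subr_gt0 ltr_pdivlMr// mul1r. Qed.

Let q0 : 0 < q. Proof. exact: divr_gt0. Qed.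

Let qp : p <= q.
Proof.
rewrite ler_pdivlMr// /gam mulrBr mulr1 mulrC divfK ?gt_eqF//.
by rewrite lerBlDr lerDl ltW.
Qed.

Let q1 : 1 < q. Proof. exact: lt_le_trans qp. Qed.

Let N : nat := Num.bound q.
Let qN : q <= N%:R.
Proof. by apply/ltW/archi_boundP/ltW. Qed.

(** [A0]: comparing picked values on a child cell costs [2 * lk k] divided by the child's volume
    [(lk k / 2) ^+ n]. [G0]: the factor 2 of [power_mean], a geometric sum, and [2 ^ gam] because
    that sum ends one generation beyond [k]. [Cs] comes from [scale_sum_le] with [s = q - 1], and
    [CT] from Young's inequality with [e = 1/2], whose absorption gives the leading 2. *)
Let A0 : R := 2 ^+ n.+1.
Let G0 : R := 2 * A0 * ((1 - 2 `^ (- gam))^-1 * 2 `^ gam).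
Let Cs : R := 2 + (1 - 2 `^ (1 - gam * (q - 1)))^-1.
Let A1 : R := N%:R * A0 * Cs * G0 `^ gam^-1.
Let CT : R := 2 * ((2^-1) `^ (1 - p) * A1 `^ p).

(** The convergence condition of [scale_sum_le]: the left product is [n - gam = 1 + n (1 - 1/p)],
    which exceeds 1 because [p > 1]. *)
Let gs : 1 < gam * (q - 1).
Proof.
have -> : gam * (q - 1) = n%:R - gam by rewrite /q; field; rewrite gt_eqF.
have : n%:R / p < n%:R by rewrite ltr_pdivrMr// ltr_pMr.
rewrite /gam; set w := n%:R / p; lra.
Qed.

Section cube.
Variables (L : R) (U : 'rV[R]_n -> R) (c : 'rV[R]_n) (r : R) (f : 'rV[R]_n -> R) (F : R).
Variable pick : cube R n -> 'rV[R]_n.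
Hypotheses (L0 : 0 <= L) (lU : lipf L U) (r0 : 0 < r).
Hypotheses (mf : measurable_fun setT f) (f0 : forall x, 0 <= f x).
Let P := cube_set (c, r).
Hypotheses (F0 : 0 <= F)
  (fF : (\int[lebesgue_rV]_(x in P) (f x `^ p)%:E <= (F `^ p)%:E)%E).
Hypothesis pickP : forall Q : cube R n, 0 < Q.2 -> cube_set Q (pick Q) /\
  (\int[lebesgue_rV]_(x in cube_set Q) `|U x - U (pick Q)|%:E <=
   (side Q)%:E * \int[lebesgue_rV]_(x in cube_set Q) (f x)%:E)%E.

Let l := 2 * r.
Let l0 : 0 < l. Proof. by rewrite mulr_gt0. Qed.
Let lk k := l / 2 ^+ k.
Let lk0 k : 0 < lk k. Proof. by rewrite divr_gt0// exprn_gt0. Qed.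
Let a0 : 'rV[R]_n := \row_i (c 0 i - r).
Let D := dcell a0 l.
Let sm := dsame a0 l.

Let D20 k x : 0 < (D k x).2. Proof. by rewrite /D/= divr_gt0//; exact: lk0. Qed.

Let mP : measurable P. Proof. exact: measurable_cube_set. Qed.
Let mD k x : measurable (cube_set (D k x)). Proof. exact: measurable_cube_set. Qed.
Let lebD k x : lebesgue_rV (cube_set (D k x)) = (lk k ^+ n)%:E.
Proof. by rewrite lebesgue_cube ?(ltW (D20 k x))// side_dcell. Qed.
Let lebP : lebesgue_rV P = (l ^+ n)%:E.
Proof. by rewrite lebesgue_cube//= ltW. Qed.

Let DP k x : P x -> cube_set (D k x) `<=` P.
Proof.
move=> Px y /(iffLR (@dcellP R n a0 l l0 k x y)) sy.
rewrite /P -(dcell0 r0 Px); apply: (iffRL (@dcellP R n a0 l l0 0 x y)).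
exact: dsame_le sy.
Qed.

Let ind k (x y : 'rV[R]_n) : R := \1_(sm k) (x, y).

Let indE k x y : ind k x y = \1_(cube_set (D k x)) y.
Proof.
rewrite /ind !indicE.
suff -> : ((x, y) \in sm k) = (y \in cube_set (D k x)) by [].
by apply/idP/idP; rewrite !inE => /(@dcellP R n a0 l l0 k x y).
Qed.

Let indC k x y : ind k x y = ind k y x.
Proof.
rewrite /ind !indicE; suff -> : ((x, y) \in sm k) = ((y, x) \in sm k) by [].
by apply/idP/idP; rewrite !inE => /dsame_sym.
Qed.

Let ind0 k x y : 0 <= ind k x y. Proof. by rewrite /ind indicE. Qed.

Let mind k : measurable_fun setT (fun z : 'rV[R]_n * 'rV[R]_n => ind k z.1 z.2).
Proof.
rewrite (_ : (fun z => _) = \1_(sm k)); last by apply/funext => -[].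
exact: measurable_indic (measurable_dsame _ _ _).
Qed.

Let mind1 k x : measurable_fun setT (ind k x).
Proof.
rewrite (_ : ind k x = \1_(cube_set (D k x))); first exact: measurable_indic.
by apply/funext => y; rewrite indE.
Qed.

(** An integral over the fixed set [P] against a kernel, so that it is measurable in [x]; [JE]
    identifies it with the integral of [f] over the cell of [x]. *)
Let J k x : \bar R := (\int[lebesgue_rV]_(y in P) (f y * ind k x y)%:E)%E.

Let J0 k x : (0 <= J k x)%E.
Proof. by apply: integral_ge0 => y _; rewrite lee_fin mulr_ge0. Qed.

Let JE k x : P x -> J k x = (\int[lebesgue_rV]_(y in cube_set (D k x)) (f y)%:E)%E.
Proof.
move=> Px; rewrite /J integral_mkcond [RHS]integral_mkcond.
apply: eq_integral => y _; rewrite !patchE indE indicE.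
case: ifPn => yP; case: ifPn => yD; rewrite ?mulr1 ?mulr0//.
by move: yP; rewrite notin_setE => -[]; apply: (DP Px (k := k)); rewrite -inE.
Qed.

Let JF k x : P x -> (J k x <= (2 * F * (lk k ^+ n) `^ (1 - p^-1))%:E)%E.
Proof.
move=> Px; rewrite JE//.
have := @power_mean _ _ _ (@lebesgue_rV R n) (cube_set (D k x)) f 1 p F (lk k ^+ n)
  (mD k x) (measurable_funTS mf) (fun x _ => f0 x) (lebD k x).
rewrite exprn_gt0// ltr01 (ltW p1) powRr1// div1r => /(_ isT isT F0).
move=> H; rewrite (eq_integral (fun y => (f y `^ 1)%:E)); last first.
  by move=> y _; rewrite powRr1.
apply: H; apply: le_trans fF; apply: ge0_subset_integral => //.
- apply/measurable_EFinP/measurable_funTS.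
  exact: (measurableT_comp (measurable_powR _) mf).
- by move=> y _; rewrite lee_fin powR_ge0.
- exact: DP.
Qed.

Let Jfin k x : P x -> J k x \is a fin_num.
Proof. by move=> Px; rewrite ge0_fin_numE// (le_lt_trans (JF k Px))// ltry. Qed.

Let a k x := A0 * (lk k / lk k ^+ n) * fine (J k x).

Let cA0 k : 0 <= A0 * (lk k / lk k ^+ n).
Proof.
by rewrite mulr_ge0 ?exprn_ge0// divr_ge0 ?exprn_ge0// ltW.
Qed.

Let a_ge0 k x : 0 <= a k x.
Proof. by rewrite /a mulr_ge0 ?fine_ge0. Qed.

Let T m x := \sum_(k < m) a k x.

Let T0 m x : 0 <= T m x. Proof. exact: sumr_ge0. Qed.

Let T_nd m k x : (k <= m)%N -> T k x <= T m x.
Proof.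
move=> km; rewrite /T -(subnK km) addnC big_split_ord/= lerDl.
exact: sumr_ge0.
Qed.

Let ma k : measurable_fun setT (a k).
Proof.
apply: measurable_funM => //; apply: (measurableT_comp (fine_measurable measurableT)).
apply: (@ge0_measurable_fun_integral_snd _ _ _ _ _ lebesgue_rV P
  (fun z : 'rV[R]_n * 'rV[R]_n => (f z.2 * ind k z.1 z.2)%:E)) => //.
- apply/measurable_EFinP; apply: measurable_funM => //.
  by apply: (measurableT_comp mf); exact: measurable_snd.
- by move=> z; rewrite lee_fin mulr_ge0.
Qed.

Let mT m : measurable_fun setT (T m).
Proof. exact: measurable_sum. Qed.

Let aF k x : P x -> a k x <= 2 * A0 * F * lk k `^ (- gam).
Proof.
move=> Px; rewrite /a.
have : fine (J k x) <= 2 * F * (lk k ^+ n) `^ (1 - p^-1).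
  by rewrite -lee_fin fineK ?Jfin// JF.
move=> /(ler_wpM2l (cA0 k)) /le_trans; apply.
rewrite [leLHS](_ : _ = 2 * A0 * F * (lk k / lk k ^+ n * (lk k ^+ n) `^ (1 - p^-1))); last by ring.
rewrite ler_wpM2l ?mulr_ge0 ?exprn_ge0//.
rewrite -powR_mulrn ?(ltW (lk0 k))// -powRrM -powRN -{1}(powRr1 (ltW (lk0 k))).
rewrite (powRDe (e := 1 - n%:R))// (powRDe (e := - gam))//.
by rewrite /gam; field; rewrite gt_eqF.
Qed.

Let Tgam k x : P x -> T k.+1 x <= G0 * F * lk k `^ (- gam).
Proof.
move=> Px; apply: (@le_trans _ _ (\sum_(j < k.+1) 2 * A0 * F * lk j `^ (- gam))).
  by apply: ler_sum => j _; exact: aF.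
rewrite -mulr_sumr.
have := geom_sum_powR k.+1 l0 gam0.
have -> : l / 2 ^+ k.+1 = lk k * 2^-1.
  by rewrite /lk exprS; field; rewrite expf_eq0 pnatr_eq0 andbF.
rewrite powRM ?invr_ge0 ?(ltW (lk0 k))// powRVN// opprK.
have c0 : 0 <= 2 * A0 * F by rewrite mulr_ge0 ?mulr_ge0 ?exprn_ge0.
move=> /(ler_wpM2l c0) /le_trans; apply.
by rewrite /G0 le_eqVlt; apply/orP; left; apply/eqP; ring.
Qed.

(** [T k.+1] involves generations 0 to [k] only, whose cells are all determined by the one of
    generation [k]. This makes the partial sums in [sum_powR_le] admissible as [g] in [swap]. *)
Let Tinv k x y : sm k (x, y) -> T k.+1 x = T k.+1 y.
Proof.
move=> sxy; apply: eq_bigr => j _; rewrite /a; congr (_ * fine _).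
apply: eq_integral => z _; rewrite !indE (_ : D j x = D j y)//.
by apply/dcell_eq/(dsame_le l0 _ sxy); rewrite -ltnS.
Qed.

Local Open Scope ereal_scope.

Let swap k (g : 'rV[R]_n -> R) : measurable_fun setT g -> (forall x, (0 <= g x)%R) ->
  (forall x y, sm k (x, y) -> g x = g y) ->
  \int[lebesgue_rV]_(x in P) (a k x * g x)%:E =
  (A0 * lk k)%:E * \int[lebesgue_rV]_(x in P) (f x * g x)%:E.
Proof.
move=> mg g0 gi; pose A := (A0 * (lk k / lk k ^+ n))%R.
pose K (z : 'rV[R]_n * 'rV[R]_n) := (A * (f z.2 * ind k z.1 z.2) * g z.1)%:E : \bar R.
have mK : measurable_fun setT K.
  apply/measurable_EFinP; apply: measurable_funM; last first.
    by apply: (measurableT_comp mg); exact: measurable_fst.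
  apply: measurable_funM => //; apply: measurable_funM => //.
  by apply: (measurableT_comp mf); exact: measurable_snd.
have Aa0 : (0 <= A)%R := cA0 k.
have K0 z : 0 <= K z by rewrite lee_fin mulr_ge0// mulr_ge0// mulr_ge0.
transitivity (\int[lebesgue_rV]_(x in P) \int[lebesgue_rV]_(y in P) K (x, y)).
  apply: eq_integral => x; rewrite inE => Px.
  rewrite /a -/A (EFinM (A * _)%R) (EFinM A) fineK ?Jfin//.
  have mfi : measurable_fun P (fun y => (f y * ind k x y)%:E).
    by apply/measurable_funTS/measurable_EFinP; exact: measurable_funM.
  have fi0 y : P y -> 0 <= (f y * ind k x y)%:E by rewrite lee_fin mulr_ge0.
  have Afi0 y : P y -> 0 <= A%:E * (f y * ind k x y)%:E.
    by move=> _; rewrite -EFinM lee_fin mulr_ge0// mulr_ge0.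
  have mAfi : measurable_fun P (fun y => A%:E * (f y * ind k x y)%:E).
    exact: measurable_funeM.
  have gx0 : 0 <= (g x)%:E by rewrite lee_fin.
  by rewrite /J -ge0_integralZl// -ge0_integralZr//.
rewrite ge0_integral_swap// -ge0_integralZl//; last 3 first.
- by apply/measurable_funTS/measurable_EFinP/measurable_funM.
- by move=> y _; rewrite lee_fin mulr_ge0.
- by rewrite lee_fin mulr_ge0 ?exprn_ge0// ltW.
apply: eq_integral => y; rewrite inE => Py.
(* On the support of the kernel [g x = g y]; what remains of the integral in [x] is the volume of
   the cell, which cancels [lk k ^+ n]. *)
transitivity (\int[lebesgue_rV]_(x in P) ((A * f y * g y)%:E * (\1_(cube_set (D k y)) x)%:E)).
  apply: eq_integral => x _; rewrite /K/= -EFinM; congr (_%:E).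
  rewrite -indE indC; have [sxy|nsxy] := pselect (sm k (x, y)).
    by rewrite (gi _ _ sxy); ring.
  by rewrite indC /ind indicE memNset// !mulr0 mul0r.
rewrite ge0_integralZl//; last 2 first.
- by apply/measurable_EFinP; exact: measurable_indic.
- by rewrite lee_fin mulr_ge0// mulr_ge0.
rewrite integral_indic// setIidl; last exact: DP.
rewrite [X in _ * X](lebD k y) -!EFinM; congr (_%:E); rewrite /A; field.
by rewrite expf_eq0 gt_eqF ?lk0// andbF.
Qed.

Let mTp m e : measurable_fun setT (fun x => T m x `^ e)%R.
Proof. exact: (measurableT_comp (measurable_powR _) (mT m)). Qed.

Let mfp e : measurable_fun setT (fun x => f x `^ e)%R.
Proof. exact: (measurableT_comp (measurable_powR _) mf). Qed.

Let X m : \bar R := \int[lebesgue_rV]_(x in P) (T m x `^ q)%:E.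

(** Truncating at [m] bounds [T m] on [P]; finiteness of [X m] is what permits the absorption in
    [X_le], whose bound no longer depends on [m]. *)
Let X_fin m : X m \is a fin_num.
Proof.
rewrite ge0_fin_numE; last by apply: integral_ge0 => x _; rewrite lee_fin powR_ge0.
pose M := (\sum_(k < m) 2 * A0 * F * lk k `^ (- gam))%R.
apply: (@le_lt_trans _ _ (\int[lebesgue_rV]_(x in P) (cst (M `^ q)%:E x))).
  apply: ge0_le_integral_gen => x Px; first by rewrite lee_fin powR_ge0.
  rewrite lee_fin ler_powR2 ?(ltW q0)//.
  by apply: ler_sum => k _; exact: aF.
by rewrite (integral_cst (@lebesgue_rV R n))//= lebP -EFinM ltry.
Qed.

Let A : R := (A1 * F `^ gam^-1)%R.

Let Cs0 : (0 < Cs)%R.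
Proof.
rewrite addr_gt0// invr_gt0 subr_gt0.
have -> : (1 - gam * (q - 1) = - (gam * (q - 1) - 1))%R by rewrite opprB.
by rewrite powR2N_lt1// subr_gt0.
Qed.

Let G00 : (0 <= G0)%R.
Proof.
have := powR2N_lt1 gam0; rewrite -subr_gt0 => g1.
by rewrite mulr_ge0 ?mulr_ge0 ?exprn_ge0 ?powR_ge0// invr_ge0 ltW.
Qed.

Let A1_ge0 : (0 <= A1)%R.
Proof. by rewrite mulr_ge0 ?powR_ge0// mulr_ge0 ?(ltW Cs0)// mulr_ge0// exprn_ge0. Qed.

Let A_ge0 : (0 <= A)%R.
Proof. by rewrite mulr_ge0 ?powR_ge0. Qed.

(** [scale_sum_le] with [Y = T m x] yields the exponent [q - 1 - 1/gam], which equals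
    [(q / p) (p - 1)]: the form that Young's inequality needs to return [T m x ^ q]. *)
Let pointwise m x : P x ->
  (\sum_(k < m) N%:R * (A0 * lk k) * (f x * T k.+1 x `^ (q - 1)) <=
   A * f x * (T m x `^ (q / p)) `^ (p - 1))%R.
Proof.
move=> Px; have -> : (\sum_(k < m) N%:R * (A0 * lk k) * (f x * T k.+1 x `^ (q - 1)) =
    N%:R * A0 * f x * \sum_(k < m) (l / 2 ^+ k) * T k.+1 x `^ (q - 1))%R.
  by rewrite mulr_sumr; apply: eq_bigr => k _; rewrite /lk; ring.
have := @scale_sum_le R l m (fun k => T k.+1 x) gam (q - 1)%R (G0 * F)%R (T m x) l0 gam0.
rewrite subr_gt0 q1 gs mulr_ge0// => /(_ isT isT isT).
have H k : (k < m)%N -> (0 <= T k.+1 x <= T m x)%R /\ (T k.+1 x <= G0 * F * (l / 2 ^+ k) `^ (- gam))%R.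
  by move=> km; rewrite T0 T_nd//; split => //; exact: Tgam.
move=> /(_ H) {}H.
have c0 : (0 <= N%:R * A0 * f x)%R by rewrite mulr_ge0// mulr_ge0// exprn_ge0.
have := ler_wpM2l c0 H => /le_trans; apply.
have -> : (q - 1 - gam^-1 = q / p * (p - 1))%R.
  have pg : (p * gam = n%:R - p)%R by rewrite /gam; field; rewrite gt_eqF.
  have ne : (gam != 0)%R by rewrite gt_eqF.
  have pne : (p != 0)%R by rewrite gt_eqF.
  have -> : (q = p * (gam + 1) / gam)%R.
    by rewrite /q mulrDr mulr1 pg subrK.
  by field; rewrite ne pne.
rewrite powRM// -powRrM -/Cs le_eqVlt; apply/orP; left; apply/eqP.
by rewrite /A /A1; ring.
Qed.

Let X_le1 m : X m <= \int[lebesgue_rV]_(x in P) (A * f x * (T m x `^ (q / p)) `^ (p - 1))%:E.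
Proof.
have t0 (k : nat) x : (0 <= a k x * T k.+1 x `^ (q - 1))%R by rewrite mulr_ge0 ?powR_ge0.
have ft0 (k : nat) x : (0 <= f x * T k.+1 x `^ (q - 1))%R by rewrite mulr_ge0 ?powR_ge0.
apply: (@le_trans _ _ (\int[lebesgue_rV]_(x in P)
    \sum_(k < m) (N%:R * (a k x * T k.+1 x `^ (q - 1)))%:E)).
  apply: ge0_le_integral_gen => x _; first by rewrite lee_fin powR_ge0.
  rewrite sumEFin lee_fin -mulr_sumr.
  exact: (@sum_powR_le _ q N m (fun k => a k x) (ltW q1) qN (fun k => a_ge0 k x)).
rewrite ge0_integral_sum//; last 2 first.
- move=> k; apply/measurable_funTS/measurable_EFinP/measurable_funM => //.
  exact: measurable_funM.
- by move=> k x _; rewrite lee_fin mulr_ge0.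
apply: (@le_trans _ _ (\int[lebesgue_rV]_(x in P)
    \sum_(k < m) (N%:R * (A0 * lk k) * (f x * T k.+1 x `^ (q - 1)))%:E)); last first.
  apply: ge0_le_integral_gen => x Px; last by rewrite sumEFin lee_fin pointwise.
  apply: sume_ge0 => k _; rewrite lee_fin mulr_ge0// mulr_ge0// mulr_ge0 ?exprn_ge0//.
  by rewrite ltW.
rewrite ge0_integral_sum//; last 2 first.
- move=> k; apply/measurable_funTS/measurable_EFinP/measurable_funM => //.
  exact: measurable_funM.
- move=> k x _; rewrite lee_fin mulr_ge0// mulr_ge0// mulr_ge0 ?exprn_ge0//.
  by rewrite ltW.
apply: lee_sum => k _.
have mt : measurable_fun P (fun x => (a k x * T k.+1 x `^ (q - 1))%:E).
  by apply/measurable_funTS/measurable_EFinP; exact: measurable_funM.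
have mft : measurable_fun P (fun x => (f x * T k.+1 x `^ (q - 1))%:E).
  by apply/measurable_funTS/measurable_EFinP; exact: measurable_funM.
under eq_integral do rewrite EFinM.
rewrite ge0_integralZl ?lee_fin//; last by move=> x _; rewrite lee_fin.
have Ti x y : sm k (x, y) -> (T k.+1 x `^ (q - 1) = T k.+1 y `^ (q - 1))%R.
  by move=> sxy; rewrite (Tinv sxy).
rewrite (swap (mTp k.+1 (q - 1)) (fun x => powR_ge0 _ _) Ti).
have NA0 : (0 <= N%:R * (A0 * lk k))%R by rewrite mulr_ge0// mulr_ge0 ?exprn_ge0// ltW.
under [leRHS]eq_integral do rewrite EFinM.
rewrite [leRHS]ge0_integralZl ?lee_fin//; last by move=> x _; rewrite lee_fin.
by rewrite (EFinM N%:R) muleA.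
Qed.

Let X_le m : X m <= (CT * F `^ q)%:E.
Proof.
pose W := ((2^-1) `^ (1 - p) * (A `^ p * F `^ p))%R.
have hX : X m <= (2^-1)%:E * X m + W%:E.
  apply: (le_trans (X_le1 m)).
  apply: (@le_trans _ _ (\int[lebesgue_rV]_(x in P) ((2^-1)%:E * (T m x `^ q)%:E +
     ((2^-1) `^ (1 - p) * A `^ p)%:E * (f x `^ p)%:E))).
    apply: ge0_le_integral_gen => x Px.
      by rewrite lee_fin mulr_ge0 ?powR_ge0// mulr_ge0.
    rewrite -!EFinM -EFinD lee_fin.
    have := @young_eps R p 2^-1%R (A * f x)%R (T m x `^ (q / p))%R (ltW p1).
    rewrite invr_gt0 ltr0n mulr_ge0// powR_ge0 => /(_ isT isT isT) /le_trans; apply.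
    by rewrite -powRrM divfK ?gt_eqF// powRM// mulrA.
  have i1 x : P x -> 0 <= (2^-1)%:E * (T m x `^ q)%:E.
    by move=> _; rewrite -EFinM lee_fin mulr_ge0 ?powR_ge0.
  have i2 x : P x -> 0 <= ((2^-1) `^ (1 - p) * A `^ p)%:E * (f x `^ p)%:E.
    by move=> _; rewrite -EFinM lee_fin mulr_ge0 ?powR_ge0// mulr_ge0 ?powR_ge0.
  have m1 : measurable_fun P (fun x => (T m x `^ q)%:E).
    exact/measurable_funTS/measurable_EFinP.
  have m2 : measurable_fun P (fun x => (f x `^ p)%:E).
    exact/measurable_funTS/measurable_EFinP.
  rewrite ge0_integralD//; last 2 first.
  - exact: measurable_funeM.
  - exact: measurable_funeM.
  rewrite ge0_integralZl//; last by move=> x _; rewrite lee_fin powR_ge0.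
  rewrite ge0_integralZl//; last 2 first.
  - by move=> x _; rewrite lee_fin powR_ge0.
  - by rewrite lee_fin mulr_ge0 ?powR_ge0.
  rewrite leeD2l// /W mulrA [leRHS]EFinM lee_wpmul2l//.
  by rewrite lee_fin mulr_ge0 ?powR_ge0.
have X2 : X m <= (2 * W)%:E.
  move: hX; rewrite -(fineK (X_fin m)) -EFinM -EFinD !lee_fin; lra.
apply: (le_trans X2); rewrite lee_fin le_eqVlt; apply/orP; left; apply/eqP.
rewrite /W /CT /A powRM ?powR_ge0// -powRrM.
(* [A ^ p] carries [F ^ (p / gam)]; with the further [F ^ p] the total is [F ^ q] since
   [p * gam = n - p]. *)
have -> : (q = gam^-1 * p + p)%R.
  have pg : (p * gam = n%:R - p)%R by rewrite /gam; field; rewrite gt_eqF.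
  rewrite /q -(subrK p n%:R) -pg; field; rewrite gt_eqF//.
rewrite (@powRD _ F); first by ring.
apply/implyP => /eqP pp; exfalso; have : (0 < gam^-1 * p + p)%R.
  by rewrite addr_gt0// mulr_gt0// invr_gt0.
by rewrite pp ltxx.
Qed.

Let lkS k : lk k.+1 = (lk k / 2)%R.
Proof. by rewrite /lk exprS; field; rewrite expf_eq0 pnatr_eq0 andbF. Qed.

(** Telescope the picked values along the cells containing [x], from [P] down to generation [m]. The
    Lipschitz constant enters only the last comparison, inside a cell of side [lk m], and so
    disappears in the limit. *)
Let osc m x : P x -> (`|U x - U (pick (c, r))| <= T m x + L * lk m)%R.
Proof.
move=> Px; have [Dx Hx] := pickP (D20 m x).
have h1 : (`|U x - U (pick (D m x))| <= L * lk m)%R.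
  apply: (le_trans (lU _ _)); rewrite ler_wpM2l//.
  rewrite (_ : lk m = side (D m x)); last by rewrite side_dcell.
  apply: cube_norm_le => //; first exact: ltW (D20 m x).
  exact: (dcell_self a0 l0).
suff h2 : (`|U (pick (D m x)) - U (pick (c, r))| <= T m x)%R.
  by rewrite (le_trans (ler_distD (U (pick (D m x))) _ _))// [leRHS]addrC lerD.
elim: m {Dx Hx h1} => [|m IH].
  by rewrite /D (dcell0 r0 Px) subrr normr0 T0.
rewrite (le_trans (ler_distD (U (pick (D m x))) _ _))// /T big_ord_recr/= [leRHS]addrC lerD//.
have [_ H1] := pickP (D20 m.+1 x); have [_ H2] := pickP (D20 m x).
have JSm : J m.+1 x <= J m x.
  rewrite !JE//; apply: ge0_subset_integral => //.
  - exact/measurable_EFinP/measurable_funTS.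
  - by move=> y _; rewrite lee_fin.
  - move=> y /(@dcellP R n a0 l l0 m.+1 x y)/dsameS sy.
    by apply: (iffRL (@dcellP R n a0 l l0 m x y)); exact: sy.
have DD : cube_set (D m.+1 x) `<=` cube_set (D m x).
  move=> y /(@dcellP R n a0 l l0 m.+1 x y)/dsameS sy.
  by apply: (iffRL (@dcellP R n a0 l l0 m x y)); exact: sy.
have := @value_jump R n U (D m.+1 x) (D m.+1 x) (D m x) (U (pick (D m.+1 x)))
  (U (pick (D m x))) (lk m * fine (J m x)) (lk m * fine (J m x))
  (measurable_funTS (lipf_measurable lU)) (measurable_funTS (lipf_measurable lU))
  (ltW (D20 m.+1 x)) (fun _ h => h) DD.
move=> /(_ _ _) H.
have {}H : (side (D m.+1 x) ^+ n * `|U (pick (D m.+1 x)) - U (pick (D m x))| <=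
    lk m * fine (J m x) + lk m * fine (J m x))%R.
  apply: H.
    apply: (le_trans H1); rewrite (EFinM (lk m)) fineK ?Jfin// -JE// side_dcell.
    apply: lee_pmul => //; first by rewrite lee_fin; exact: ltW (lk0 _).
    by rewrite lee_fin -/(lk _) lkS ler_pdivrMr// ler_peMr ?ltW// ltr1n.
  by apply: (le_trans H2); rewrite (EFinM (lk m)) fineK ?Jfin// -JE// side_dcell.
have s0 : (0 < side (D m.+1 x) ^+ n)%R by rewrite side_dcell exprn_gt0//; exact: lk0.
move: H; rewrite -ler_pdivlMl// => /le_trans; apply.
rewrite side_dcell -/(lk _) lkS /a /A0 expr_div_n exprS le_eqVlt; apply/orP; left; apply/eqP.
by field; rewrite !expf_eq0 pnatr_eq0 (gt_eqF (lk0 m)) !andbF.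
Qed.

Lemma sobolev_cube_pick : \int[lebesgue_rV]_(x in P) (`|U x - U (pick (c, r))| `^ q)%:E <=
  (2 `^ q * CT * F `^ q)%:E.
Proof.
have v0 : (0 < l ^+ n)%R by rewrite exprn_gt0.
apply/lee_addgt0Pr => e e0.
(* Chosen so that [(2 * eta) ^ q] times the volume of [P] is exactly [e]. *)
pose eta := ((e / (2 `^ q * l ^+ n)) `^ q^-1)%R.
have eta0 : (0 < eta)%R by rewrite powR_gt0// divr_gt0// mulr_gt0// powR_gt0.
have [m Lm] : exists m, (L * lk m <= eta)%R.
  have Ll : (0 < L * l + 1)%R by rewrite ltr_wpDl// mulr_ge0// ltW.
  have [m hm] := natSinv_lt (divr_gt0 eta0 Ll); exists m.
  rewrite /lk mulrA; apply: (@le_trans _ _ ((L * l + 1) * m.+1%:R^-1)%R).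
    apply: ler_pM => //; first by rewrite mulr_ge0// ltW.
      by rewrite lerDl.
    by rewrite lef_pV2 ?posrE ?exprn_gt0// -natrX ler_nat ltn_expl.
  by rewrite mulrC -ler_pdivlMr// ltW.
apply: (@le_trans _ _ (\int[lebesgue_rV]_(x in P)
   ((2 `^ q)%:E * (T m x `^ q)%:E + (2 `^ q * eta `^ q)%:E))).
  apply: ge0_le_integral_gen => x Px; first by rewrite lee_fin powR_ge0.
  rewrite -EFinM -EFinD lee_fin.
  apply: (@le_trans _ _ ((T m x + eta) `^ q)%R).
    by rewrite ler_powR2 ?(ltW q0)// (le_trans (osc m Px))// lerD2l.
  have q0' := ltW q0; have eta0' := ltW eta0.
  have [Te|eT] := leP (T m x) eta.
    rewrite ler_wpDl ?mulr_ge0 ?powR_ge0// -powRM// ler_powR2 ?addr_ge0//; lra.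
  rewrite ler_wpDr ?mulr_ge0 ?powR_ge0// -powRM// ler_powR2 ?addr_ge0//; lra.
have m1 : measurable_fun P (fun x => (T m x `^ q)%:E).
  exact/measurable_funTS/measurable_EFinP.
have i1 x : P x -> 0 <= (2 `^ q)%:E * (T m x `^ q)%:E.
  by move=> _; rewrite -EFinM lee_fin mulr_ge0 ?powR_ge0.
have i2 x : P x -> 0 <= (2 `^ q * eta `^ q)%:E.
  by move=> _; rewrite lee_fin mulr_ge0 ?powR_ge0.
have i3 x : P x -> 0 <= (T m x `^ q)%:E by rewrite lee_fin powR_ge0.
rewrite ge0_integralD//; last exact: measurable_funeM.
rewrite ge0_integralZl ?lee_fin ?powR_ge0//.
rewrite (integral_cst (@lebesgue_rV R n) mP (2 `^ q * eta `^ q)%:E)/=.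
apply: leeD.
  by rewrite -mulrA EFinM lee_wpmul2l ?lee_fin ?powR_ge0//; exact: X_le.
rewrite [X in _ * X]lebP -EFinM lee_fin /eta -powRrM mulVf ?gt_eqF// powRr1; last first.
  by rewrite divr_ge0 ?(ltW e0)// mulr_ge0 ?powR_ge0 ?(ltW v0).
rewrite le_eqVlt; apply/orP; left; apply/eqP; field.
by rewrite !gt_eqF ?powR_gt0 ?exprn_gt0.
Qed.

End cube.

(** One [m] serves both estimates: the first one compares neighbouring cubes along a chain, the
    second controls [U] on the cube itself. The constant does not depend on [L]. *)
Lemma sobolev_cube : exists2 C : R, 0 < C &
  forall (L : R) (U : 'rV[R]_n -> R) (c : 'rV[R]_n) (r F : R),
    0 <= L -> lipf L U -> 0 < r -> 0 <= F ->
    (\int[lebesgue_rV]_(x in cube_set (c, r)) (gsum U x `^ p)%:E <= (F `^ p)%:E)%E ->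
    exists m : R,
    (\int[lebesgue_rV]_(x in cube_set (c, r)) `|U x - m|%:E <=
     (2 * r)%:E * \int[lebesgue_rV]_(x in cube_set (c, r)) (gsum U x)%:E)%E /\
    (\int[lebesgue_rV]_(x in cube_set (c, r)) (`|U x - m| `^ (n%:R * p / (n%:R - p)))%:E <=
     (C * F `^ (n%:R * p / (n%:R - p)))%:E)%E.
Proof.
exists (2 `^ q * `|CT| + 1); first by rewrite ltr_wpDl// mulr_ge0 ?powR_ge0.
move=> L U c r F L0 lU r0 F0 HF.
have /choice[pick pickP] : forall Q : cube R n, exists y, 0 < Q.2 -> cube_set Q y /\
    (\int[lebesgue_rV]_(x in cube_set Q) `|U x - U y|%:E <=
     (side Q)%:E * \int[lebesgue_rV]_(x in cube_set Q) (gsum U x)%:E)%E.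
  move=> [c' r'] /=; have [r'0|] := ltP 0 r'; last by exists 0.
  by have [y Py Hy] := poincare_pt c' L0 lU r'0; exists y.
exists (U (pick (c, r))); split; first by have [] := pickP (c, r) r0.
have -> : n%:R * p / (n%:R - p) = q.
  have pg : p * gam = n%:R - p by rewrite /gam; field; rewrite gt_eqF.
  by rewrite -pg /q; field; rewrite (gt_eqF p0) (gt_eqF gam0).
apply: le_trans (@sobolev_cube_pick L U c r (gsum U) F pick L0 lU r0
  (measurable_gsum lU) (gsum_ge0 U) F0 HF pickP) _.
rewrite lee_fin ler_wpM2r ?powR_ge0// ler_wpDr// ler_wpM2l ?powR_ge0//.
exact: ler_norm.
Qed.

End sobolev.

(** * Bojarski's lemma *)

Lemma le_of_halving (R : realType) (b M W : R) :
  (forall k, b <= M / 2 ^+ k + W) -> b <= W.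
Proof.
move=> H; rewrite leNgt; apply/negP => Wb.
have M0 : 0 < `|M| + 1 by rewrite ltr_wpDl.
have d0 : 0 < (b - W) / (`|M| + 1) by rewrite divr_gt0// subr_gt0.
have [k hk] := natSinv_lt d0.
have := H k; apply/negP; rewrite -ltNge -ltrBrDr.
apply: (@le_lt_trans _ _ ((`|M| + 1) * k.+1%:R^-1)).
  apply: (@le_trans _ _ (`|M| / 2 ^+ k)).
    by rewrite ler_wpM2r ?invr_ge0 ?exprn_ge0// ler_norm.
  apply: ler_pM => //; first by rewrite lerDl.
  by rewrite lef_pV2 ?posrE ?exprn_gt0// -natrX ler_nat ltn_expl.
by rewrite mulrC -ltr_pdivlMr.
Qed.

(* Bojarski's lemma.  For [a] sorted by decreasing size, expanding the power of the
   inner sum produces the same inner sum for the next relation, so that the left-hand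
   sides [b j] satisfy [b j <= e * b j.+1 + C * E' ^+ j]; as [b] is bounded and [e * E' = 1/2],
   iterating bounds [b 0]. *)
Lemma bojarski_sum (R : realType) (q K E : R) : 1 < q -> 0 <= K -> 1 <= E ->
  exists2 C : R, 0 < C & forall (m : nat) (a w : nat -> R) (rho : nat -> nat -> nat -> bool),
    (forall i, 0 <= a i) -> (forall i, 0 <= w i) ->
    (forall j i, (i < m)%N -> \sum_(k < m | rho j i k) w k <= K * E ^+ j * w i) ->
    (forall j i i' k, (i < m)%N -> (i' <= i)%N -> (k < m)%N -> rho j i k -> rho j i' k ->
      rho j.+1 i' i) ->
    \sum_(k < m) w k * (\sum_(i < m | rho 0%N i k) a i) `^ q <=
      C * \sum_(i < m) w i * a i `^ q.
Proof.
move=> q1 K0 E1; have q0 : 0 < q by rewrite (lt_trans ltr01).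
have [N qN] : exists N : nat, q <= N%:R.
  by exists (Num.bound q); apply/ltW/archi_boundP/ltW.
have E0 : 0 < E by rewrite (lt_le_trans ltr01).
pose E' := E `^ q.
have E'1 : 1 <= E'.
  by rewrite -(powRr0 E) ler_powR// ltW.
have E'0 : 0 < E' by rewrite (lt_le_trans ltr01).
pose e := (2 * E')^-1.
have e0 : 0 < e by rewrite invr_gt0 mulr_gt0.
have eE : e * E' = 2^-1 by rewrite /e; field; rewrite gt_eqF.
have e2 : e <= 2^-1 by rewrite -eE ler_peMr// ltW.
(* The second term of [young_eps] with [u = N * K * E ^+ j * a i], apart from [E' ^+ j] and
   [a i ^ q]. *)
pose W := e `^ (1 - q) * (N%:R * K) `^ q.
have W0 : 0 <= W by rewrite mulr_ge0 ?powR_ge0.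
exists (2 * W + 1); first by rewrite ltr_wpDl// mulr_ge0.
move=> m a w rho a0 w0 H1 H2.
(* In the application index 0 is a largest cube, and [rho j i k] says that cube [k] lies in the
   dilate of cube [i] of level [j]. *)
pose T j k := \sum_(i < m | rho j i k) a i.
have T0 j k : 0 <= T j k by exact: sumr_ge0.
pose b j := \sum_(k < m) w k * T j k `^ q.
pose al := \sum_(i < m) w i * a i `^ q.
have al0 : 0 <= al by apply: sumr_ge0 => i _; rewrite mulr_ge0 ?powR_ge0.
pose M := \sum_(k < m) w k * (\sum_(i < m) a i) `^ q.
have M0 : 0 <= M by apply: sumr_ge0 => i _; rewrite mulr_ge0 ?powR_ge0.
have bM j : b j <= M.
  apply: ler_sum => k _; rewrite ler_wpM2l// ler_powR2 ?(ltW q0)//.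
  by rewrite /T big_mkcond; apply: ler_sum => i _; case: ifP.
have step j : b j <= e * b j.+1 + W * al * E' ^+ j.
  have h1 : b j <= \sum_(i < m) w i * (N%:R * K * E ^+ j * a i * T j.+1 i `^ (q - 1)).
    apply: (@le_trans _ _ (\sum_(k < m) \sum_(i < m | rho j i k)
        N%:R * w k * (a i * T j.+1 i `^ (q - 1)))).
      apply: ler_sum => k _; pose ak i := if rho j i k then a i else 0.
      have ak0 i : 0 <= ak i by rewrite /ak; case: ifP.
      have := @sum_powR_le R q N m ak (ltW q1) qN ak0.
      rewrite {1}/ak -big_mkcond/= -/(T j k) => /(ler_wpM2l (w0 k)) /le_trans; apply.
      rewrite mulrCA mulr_sumr mulr_sumr [leRHS]big_mkcond; apply: ler_sum => i _.
      rewrite {1}/ak; case: ifP => [rik|_]; last by rewrite mul0r !mulr0.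
      rewrite -!mulrA; apply: ler_wpM2l => //; apply: ler_wpM2l => //; apply: ler_wpM2l => //.
      (* The partial sum runs over [t <= i] related to [k]. As [i] is related to [k] too, [H2]
         relates each such [t] to [i] one level up, and [k] disappears from the bound. *)
      rewrite ler_powR2 ?subr_ge0 ?(ltW q1)//; first exact: sumr_ge0.
      rewrite /T [leRHS]big_mkcond/= [leRHS](_ : _ = \sum_(0 <= t < m) if rho j.+1 t i then a t else 0); last by rewrite big_mkord.
      rewrite (@big_cat_nat _ _ _ i.+1 0%N m)//= big_mkord ler_wpDr//.
        by apply: sumr_ge0 => t _; case: ifP.
      apply: ler_sum => t _; rewrite /ak; case: ifP => [rtk|_]; last by case: ifP.
      by rewrite (H2 j i t k)// -ltnS.
    rewrite (exchange_big_dep xpredT)//=; apply: ler_sum => i _.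
    rewrite -mulr_suml -mulr_sumr.
    have := H1 j i (ltn_ord i) => /(ler_wpM2l (ler0n R N)) hh.
    have p0 : 0 <= a i * T j.+1 i `^ (q - 1) by rewrite mulr_ge0 ?powR_ge0.
    apply: (le_trans (ler_wpM2r p0 hh)).
    by rewrite le_eqVlt; apply/orP; left; apply/eqP; ring.
  apply: (le_trans h1); rewrite /b /al mulr_sumr mulr_sumr mulr_suml -big_split/=.
  apply: ler_sum => i _.
  have c0 : 0 <= N%:R * K * E ^+ j * a i by rewrite mulr_ge0// mulr_ge0 ?exprn_ge0 ?(ltW E0)// mulr_ge0.
  have := young_eps (ltW q1) e0 c0 (T0 j.+1 i) => /(ler_wpM2l (w0 i)) /le_trans; apply.
  rewrite (powRM _ (_ : 0 <= N%:R * K * E ^+ j))//; last first.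
    by rewrite mulr_ge0 ?exprn_ge0 ?(ltW E0)// mulr_ge0.
  rewrite (powRM _ (_ : 0 <= N%:R * K)) ?exprn_ge0 ?(ltW E0)//; last by rewrite mulr_ge0.
  have -> : (E ^+ j) `^ q = E' ^+ j.
    by rewrite -powR_mulrn ?(ltW E0)// -powRrM mulrC powRrM powR_mulrn ?powR_ge0.
  by rewrite le_eqVlt; apply/orP; left; apply/eqP; rewrite /W; ring.
(* The coefficient [2 * W] is reproduced by [step]: [e * E' = 1/2] turns the bound for [j.+1] into
   [W * al * E' ^+ j], and [step] adds the same amount. *)
have main k : forall j, b j <= M / 2 ^+ k + 2 * W * al * E' ^+ j.
  elim: k => [|k IH] j.
    rewrite expr0 divr1 (le_trans (bM j))// lerDl mulr_ge0 ?exprn_ge0 ?(ltW E'0)//.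
    by rewrite mulr_ge0// mulr_ge0.
  apply: (le_trans (step j)).
  have := ler_wpM2l (ltW e0) (IH j.+1).
  rewrite mulrDr exprS.
  have -> : e * (2 * W * al * (E' * E' ^+ j)) = (e * E') * (2 * W * al * E' ^+ j) by ring.
  rewrite eE => h.
  have h2 : e * (M / 2 ^+ k) <= M / 2 ^+ k.+1.
    have -> : M / 2 ^+ k.+1 = 2^-1 * (M / 2 ^+ k).
      by rewrite exprS; field; rewrite expf_eq0 pnatr_eq0 andbF.
    by rewrite ler_wpM2r// divr_ge0// exprn_ge0.
  move: h h2; set x := M / _; set y := M / _; set z := E' ^+ j; lra.
have := @le_of_halving R (b 0%N) M (2 * W * al) => /(_ _)/le_trans; apply.
  by move=> k; have := main k 0%N; rewrite expr0 mulr1.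
by rewrite ler_wpM2r// lerDl.
Qed.

Lemma sum_powR_superadd (R : realType) (I : Type) (s : seq I) (x : I -> R) (t : R) :
  1 <= t -> (forall i, 0 <= x i) ->
  \sum_(i <- s) x i `^ t <= (\sum_(i <- s) x i) `^ t.
Proof.
move=> t1 x0; have t0 : 0 < t by rewrite (lt_le_trans ltr01).
elim: s => [|i s IH]; first by rewrite !big_nil powR0// gt_eqF.
rewrite !big_cons; set S := \sum_(j <- s) x j in IH *.
have S0 : 0 <= S by exact: sumr_ge0.
rewrite (le_trans (lerD (lexx _) IH))// -(mulr_powRB1 (addr_ge0 (x0 i) S0) t0) mulrDl.
rewrite -(mulr_powRB1 (x0 i) t0) -(mulr_powRB1 S0 t0).
by apply: lerD; rewrite ler_wpM2l// ler_powR2 ?subr_ge0// ?addr_ge0// ?lerDl ?lerDr.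
Qed.

(** * Geometry of Whitney cubes *)

Lemma ler_norm_enorm (R : realType) n (x : 'rV[R]_n) : `|x| <= enorm x.
Proof.
apply/ler_mx_norm_rV => [|i]; first exact: sqrtr_ge0.
rewrite -sqrtr_sqr; apply: ler_wsqrtr.
by rewrite (bigD1 i)//= lerDl sumr_ge0// => j _; rewrite sqr_ge0.
Qed.

Lemma enorm_le_norm (R : realType) n (x : 'rV[R]_n) : enorm x <= Num.sqrt n%:R * `|x|.
Proof.
rewrite -[X in _ * X]ger0_norm// -sqrtr_sqr -sqrtrM//; apply: ler_wsqrtr.
rewrite (_ : n%:R * _ = \sum_(i < n) `|x| ^+ 2); last first.
  by rewrite sumr_const card_ord mulr_natl.
apply: ler_sum => i _; rewrite -[leLHS]real_normK ?num_real// ler_sqr ?nnegrE//.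
exact: (iffLR (@ler_mx_norm_rV _ _ x _ (normr_ge0 x))).
Qed.

Lemma enorm_ge0 (R : realType) n (x : 'rV[R]_n) : 0 <= enorm x.
Proof. exact: sqrtr_ge0. Qed.

Section cube_ball.
Variables (R : realType) (n : nat).
Implicit Types (Q : cube R n) (x y : 'rV[R]_n).

Lemma cube_set_ball Q x : `|x - Q.1| < Q.2 -> cube_set Q x.
Proof.
move=> h i; have := iffLR (@ler_mx_norm_rV _ _ (x - Q.1) _ (normr_ge0 _)) (lexx _) i.
by rewrite !mxE => /le_lt_trans-/(_ _ h); rewrite ltr_norml => /andP[]; lra.
Qed.

Lemma cube_set_norm Q x : 0 <= Q.2 -> cube_set Q x -> `|x - Q.1| <= Q.2.
Proof.
move=> Q0 Qx; apply/ler_mx_norm_rV => // i; have := Qx i.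
by rewrite !mxE ler_norml; lra.
Qed.

Lemma cube_set_dilate (s t : R) Q : 0 <= Q.2 -> s <= t ->
  cube_set (dilate s Q) `<=` cube_set (dilate t Q).
Proof.
move=> Q0 st x Qx i; have := Qx i; rewrite /dilate/=.
have := ler_wpM2r Q0 st; lra.
Qed.

Lemma cube_set_star Q : 0 <= Q.2 -> cube_set Q `<=` cube_set (star Q).
Proof. by move=> Q0 x Qx i; have := Qx i; rewrite /star/=; lra. Qed.

(** The triangle inequality through the center of [P] gives distance at most [3 * t * Q'.2]. The
    factor 4 provides the strict inequality that half-open cubes need, and is a power of 2 as the
    iteration of doubling requires. *)
Lemma cube_set_nested (t : R) (P Q Q' : cube R n) : 1 <= t -> 0 < P.2 -> 0 < Q.2 -> Q.2 <= Q'.2 ->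
  cube_set P `<=` cube_set (dilate t Q) -> cube_set P `<=` cube_set (dilate t Q') ->
  cube_set Q `<=` cube_set (dilate (4 * t) Q').
Proof.
move=> t1 P0 Q0 QQ' PQ PQ' x Qx.
have t0 : 0 < t by rewrite (lt_le_trans ltr01).
have Q'0 := lt_le_trans Q0 QQ'.
have Pc : cube_set P P.1 by apply: cube_set_ball; rewrite subrr normr0.
have h1 := cube_set_norm (ltW Q0) Qx.
have := cube_set_norm _ (PQ _ Pc); rewrite /= mulr_ge0 ?(ltW t0) ?(ltW Q0)// => /(_ isT) h2.
have := cube_set_norm _ (PQ' _ Pc); rewrite /= mulr_ge0 ?(ltW t0) ?(ltW Q'0)// => /(_ isT) h3.
apply: cube_set_ball => /=.
have -> : x - Q'.1 = (x - Q.1) - (P.1 - Q.1) + (P.1 - Q'.1).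
  by rewrite opprB addrA addrA subrK subrK.
have h4 : t * Q.2 <= t * Q'.2 by rewrite ler_wpM2l// ltW.
have h5 : Q'.2 <= t * Q'.2 by rewrite ler_peMl// ltW.
apply: (le_lt_trans (ler_normD _ _)); have := ler_normB (x - Q.1) (P.1 - Q.1).
set a := `| _ - _ - _|; have : 0 < t * Q'.2 by rewrite mulr_gt0.
move: h1 h2 h3 h4 h5 QQ'; set b := `|_|; set d := `|_|; set f := `|_|; set tq := t * Q.2; set tq' := t * Q'.2.
by rewrite -mulrA -/tq'; lra.
Qed.

End cube_ball.

Section whitney_geometry.
Variables (R : realType) (n : nat) (Omega : set 'rV[R]_n) (W : set (cube R n)).
Hypotheses (n0 : (0 < n)%N) (HW : whitney Omega W).
Implicit Types (Q : cube R n) (x y : 'rV[R]_n).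

Let sn : R := Num.sqrt n%:R.

Let sn1 : 1 <= sn.
Proof. by rewrite /sn -[leLHS]sqrtr1; apply: ler_wsqrtr; rewrite ler1n. Qed.

Let sn0 : 0 < sn. Proof. exact: lt_le_trans sn1. Qed.

Lemma whitney_gt0 Q : W Q -> 0 < Q.2.
Proof.
move=> /(whitney_dyadic HW)[k [m [sQ _]]].
by have : 0 < side Q; [rewrite sQ exprz_gt0|rewrite /side; lra].
Qed.

Lemma whitney_sub Q : W Q -> cube_set Q `<=` Omega.
Proof. by move=> WQ x Qx; rewrite -(whitney_cover HW); exists Q. Qed.

Lemma whitney_center Q : W Q -> cube_set Q Q.1.
Proof. by move=> WQ; apply: cube_set_ball; rewrite subrr normr0 whitney_gt0. Qed.

Let dist_lb Q : has_lbound [set enorm (x - y) | x in cube_set Q & y in ~` Omega].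
Proof. by exists 0 => _ [x _ [y _ <-]]; exact: enorm_ge0. Qed.

Lemma whitney_enorm Q x y : W Q -> cube_set Q x -> ~ Omega y -> sn * side Q <= enorm (x - y).
Proof.
move=> WQ Qx Oy; have /andP[h _] := whitney_dist HW WQ.
by apply: (le_trans h); apply: ge_inf => //; exists x => //; exists y.
Qed.

Lemma whitney_gap Q x y : W Q -> cube_set Q x -> ~ Omega y -> side Q <= `|x - y|.
Proof.
move=> WQ Qx Oy; have := le_trans (whitney_enorm WQ Qx Oy) (enorm_le_norm _).
by rewrite ler_pM2l.
Qed.

(* Otherwise shrinking [y] towards the center by a factor 3 lands in [Q], too close to [y]. *)
Lemma whitney_ball Q y : W Q -> `|y - Q.1| < 3 * Q.2 -> Omega y.
Proof.
move=> WQ yQ; apply: contrapT => Oy.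
pose x := Q.1 + 3^-1 *: (y - Q.1).
have Qx : cube_set Q x.
  by apply: cube_set_ball; rewrite /x addrC addKr normrZ ger0_norm//; lra.
have := whitney_gap WQ Qx Oy; rewrite /side /x.
have -> : Q.1 + 3^-1 *: (y - Q.1) - y = (- (2 / 3)) *: (y - Q.1).
  by apply/rowP => i; rewrite !mxE; field.
by rewrite normrZ normrN ger0_norm ?divr_ge0//; lra.
Qed.

(** A pair of points within [sn * side Q] of the infimum is at distance at most
    [5 * sn * side Q = 10 * sn * Q.2]; the remaining [Q.2] reaches the center. *)
Lemma whitney_far Q : W Q -> exists2 y, ~ Omega y & `|y - Q.1| <= (1 + 10 * sn) * Q.2.
Proof.
move=> WQ; have r0 := whitney_gt0 WQ.
have [z Oz] : exists z, ~ Omega z.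
  apply: contrapT => H; apply: (whitney_proper HW); apply/seteqP; split => // x _.
  by apply: contrapT => Ox; apply: H; exists x.
have hi : has_inf [set enorm (x - y) | x in cube_set Q & y in ~` Omega].
  split; last exact: dist_lb.
  by exists (enorm (Q.1 - z)); exists Q.1; [exact: whitney_center|exists z].
have s0 : 0 < sn * side Q by rewrite mulr_gt0// /side mulr_gt0.
have [_ [x Qx [y Oy <-]] h] := inf_adherent s0 hi.
exists y => //; have /andP[_ h2] := whitney_dist HW WQ.
have h3 := ler_norm_enorm (x - y).
have -> : y - Q.1 = (x - Q.1) - (x - y) by rewrite opprB [RHS]addrC addrA subrK.
have := ler_normB (x - Q.1) (x - y); have := cube_set_norm (ltW r0) Qx.
move: h h2 h3; rewrite /set_dist -/sn /side.
set a := inf _; set b := enorm _; set d := `|x - y|; set e := `|x - Q.1|.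
have -> : (1 + 10 * sn) * Q.2 = Q.2 + 10 * (sn * Q.2) by ring.
have -> : sn * (2 * Q.2) = 2 * (sn * Q.2) by ring.
have -> : 4 * sn * (2 * Q.2) = 8 * (sn * Q.2) by ring.
set z1 := sn * Q.2; lra.
Qed.

Let B : R := 10 * sn + 4.

(** A point [y] outside [Omega] close to [Q'] stays at least [3 * Q.2] away from the center of [Q]
    by [whitney_ball], while the common point [z] bounds that distance by multiples of [Q'.2] plus
    [9 / 8 * Q.2]. *)
Lemma whitney_comparable Q Q' z : W Q -> W Q' ->
  cube_set (star Q) z -> cube_set (star Q') z -> Q.2 <= B * Q'.2.
Proof.
move=> WQ WQ' Qz Q'z; have r0 := whitney_gt0 WQ; have r0' := whitney_gt0 WQ'.
have [y Oy hy] := whitney_far WQ'.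
have h1 : 3 * Q.2 <= `|y - Q.1|.
  by rewrite leNgt; apply/negP => h; exact/Oy/(whitney_ball WQ).
have h2 : `|z - Q.1| <= 9 / 8 * Q.2.
  by apply: (@cube_set_norm _ _ (star Q)) => //=; rewrite mulr_ge0// ltW.
have h3 : `|z - Q'.1| <= 9 / 8 * Q'.2.
  by apply: (@cube_set_norm _ _ (star Q')) => //=; rewrite mulr_ge0// ltW.
have h4 : `|y - Q.1| <= `|y - Q'.1| + `|z - Q'.1| + `|z - Q.1|.
  rewrite (le_trans (ler_distD Q'.1 _ _))// -addrA lerD2l.
  by rewrite (le_trans (ler_distD z _ _))// [X in X + _]distrC.
move: h1 h2 h3 h4 hy; rewrite /B.
have -> : (1 + 10 * sn) * Q'.2 = Q'.2 + 10 * (sn * Q'.2) by ring.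
have -> : (10 * sn + 4) * Q'.2 = 4 * Q'.2 + 10 * (sn * Q'.2) by ring.
have : 0 <= sn * Q'.2 by rewrite mulr_ge0// ltW.
set z1 := sn * Q'.2; set a := `|_|; set b := `|_|; set d := `|_|; set e := `|_|; lra.
Qed.

Lemma whitney_integral_sum (A : set 'rV[R]_n) (h : 'rV[R]_n -> \bar R) (F : seq (cube R n)) :
  measurable A -> measurable_fun A h -> (forall x, A x -> 0 <= h x)%E -> uniq F ->
  (forall Q, Q \in F -> W Q) -> (forall Q, Q \in F -> cube_set Q `<=` A) ->
  (\sum_(Q <- F) \int[lebesgue_rV]_(x in cube_set Q) h x <= \int[lebesgue_rV]_(x in A) h x)%E.
Proof.
move=> mA mh h0 uF FW FA.
have UA : \big[setU/set0]_(Q <- F) cube_set Q `<=` A.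
  by rewrite -bigcup_seq => x [Q /= QF Qx]; exact: FA QF _ Qx.
have mU : measurable (\big[setU/set0]_(Q <- F) cube_set Q).
  by apply: bigsetU_measurable => Q _; exact: measurable_cube_set.
rewrite -ge0_integral_bigsetU//.
- exact: ge0_subset_integral.
- by move=> Q; exact: measurable_cube_set.
- by move=> Q Q' QF Q'F; apply: (whitney_disjoint HW); exact: FW.
- exact: measurable_funS mh.
- by move=> x /UA; exact: h0.
Qed.

(* The cubes involved have comparable sizes, so comparing volumes bounds their number. *)
Lemma whitney_overlap z (F : seq (cube R n)) : uniq F ->
  (forall Q, Q \in F -> W Q /\ cube_set (star Q) z) -> (size F)%:R <= (3 * B ^+ 2) ^+ n.
Proof.
move=> uF HF; have B0 : 0 < B by rewrite /B addr_gt0// mulr_gt0.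
case: F uF HF => [|Q0 F0]; first by rewrite exprn_ge0// mulr_ge0// exprn_ge0// ltW.
set F := Q0 :: F0 => uF HF.
have [WQ0 Q0z] : W Q0 /\ cube_set (star Q0) z by apply: HF; rewrite mem_head.
have r0 := whitney_gt0 WQ0.
(* All half-sides in [F] lie between [Q0.2 / B] and [B * Q0.2], so [A] contains every cube of [F];
   the ratio of the side of [A] to the least possible side is [3 * B ^+ 2]. *)
pose A : cube R n := (z, 3 * B * Q0.2).
have FA Q : Q \in F -> cube_set Q `<=` cube_set A.
  move=> QF x Qx; have [WQ Qz] := HF _ QF; have rQ := whitney_gt0 WQ.
  apply: cube_set_ball => /=.
  have h2 : `|z - Q.1| <= 9 / 8 * Q.2.
    by apply: (@cube_set_norm _ _ (star Q)) => //=; rewrite mulr_ge0// ltW.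
  have h3 := cube_set_norm (ltW rQ) Qx.
  have h4 := whitney_comparable WQ WQ0 Qz Q0z.
  apply: (le_lt_trans (ler_distD Q.1 _ _)); rewrite [X in _ + X]distrC -mulrA.
  have : 0 < B * Q0.2 by rewrite mulr_gt0.
  by move: h2 h3 h4; set a := `|_|; set b := `|_|; set d := B * _; lra.
have := @whitney_integral_sum (cube_set A) (cst 1%E) F (@measurable_cube_set _ _ _).
move=> /(_ (measurable_cst _) (fun _ _ => lee01) uF (fun Q QF => proj1 (HF Q QF)) FA).
have m1 Q : (\int[lebesgue_rV]_(x in cube_set Q) cst 1 x)%E = lebesgue_rV (cube_set Q).
  by rewrite (integral_cst (@lebesgue_rV R n)) ?mul1e//; exact: measurable_cube_set.
rewrite m1 lebesgue_cube//=; last by rewrite mulr_ge0 ?(ltW r0)// mulr_ge0// ltW.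
move=> H; have {}H : (size F)%:R * (2 * (Q0.2 / B)) ^+ n <= (side A) ^+ n.
  rewrite -lee_fin; apply: le_trans H.
  have -> : (size F)%:R * (2 * (Q0.2 / B)) ^+ n = \sum_(Q <- F) (2 * (Q0.2 / B)) ^+ n.
    by rewrite big_const_seq count_predT iter_addr_0 mulr_natl.
  rewrite -sumEFin big_seq [leRHS]big_seq; apply: lee_sum => Q QF.
  have [WQ Qz] := HF _ QF; have rQ := whitney_gt0 WQ.
  rewrite m1 lebesgue_cube ?(ltW rQ)// lee_fin; apply: lerXn2r.
  - by rewrite nnegrE mulr_ge0// divr_ge0 ?ltW.
  - by rewrite nnegrE /side mulr_ge0// ltW.
  - by rewrite /side ler_pM2l// ler_pdivrMr// mulrC (whitney_comparable WQ0 WQ Q0z Qz).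
have v0 : 0 < (2 * (Q0.2 / B)) ^+ n by rewrite exprn_gt0// mulr_gt0// divr_gt0.
move: H; rewrite -ler_pdivlMr// => /le_trans; apply.
rewrite -expr_div_n /side/= le_eqVlt; apply/orP; left; apply/eqP; congr (_ ^+ _).
by field; rewrite !gt_eqF.
Qed.

Lemma whitney_star_sub Q : W Q -> cube_set (star Q) `<=` Omega.
Proof.
move=> WQ x Qx; have r0 := whitney_gt0 WQ; apply: (whitney_ball WQ).
have : `|x - (star Q).1| <= (star Q).2.
  by apply: cube_set_norm => //=; rewrite mulr_ge0// ltW.
by move=> /le_lt_trans; apply; rewrite /star/=; lra.
Qed.

Lemma whitney_overlap_integral (h : 'rV[R]_n -> \bar R) (F : seq (cube R n)) :
  measurable_fun Omega h -> (forall x, Omega x -> 0 <= h x)%E -> uniq F ->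
  (forall Q, Q \in F -> W Q) ->
  (\sum_(Q <- F) \int[lebesgue_rV]_(x in cube_set (star Q)) h x <=
   ((3 * B ^+ 2) ^+ n)%:E * \int[lebesgue_rV]_(x in Omega) h x)%E.
Proof.
move=> mh h0 uF FW; have mO := open_measurable_rV (whitney_open HW).
have M0 : 0 <= (3 * B ^+ 2) ^+ n by rewrite exprn_ge0// mulr_ge0// sqr_ge0.
have mS (Q : cube R n) : measurable (cube_set (star Q)) by exact: measurable_cube_set.
pose hi (Q : cube R n) := (h \_ (cube_set (star Q)))%E.
have hi0 Q x : Omega x -> (0 <= hi Q x)%E by move=> Ox; rewrite /hi patchE; case: ifP => // _; exact: h0.
have mhi Q : measurable_fun Omega (hi Q).
  rewrite /hi; apply/measurable_restrict => //.
  by apply: measurable_funS mh => //; exact: subIsetl.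
rewrite big_seq (eq_bigr (fun Q => \int[lebesgue_rV]_(x in Omega) hi Q x)%E); last first.
  move=> Q QF; rewrite /hi -integral_mkcondr setIC; congr integral; apply/esym/setIidPl.
  exact/whitney_star_sub/FW.
rewrite -big_seq -ge0_integral_sum// -ge0_integralZl ?lee_fin//.
apply: ge0_le_integral_gen => x Ox; first by apply: sume_ge0 => Q _; exact: hi0.
rewrite (eq_bigr (fun Q => if x \in cube_set (star Q) then h x else 0%E)); last first.
  by move=> Q _; rewrite /hi patchE.
rewrite -big_mkcond/= -big_filter big_const_seq count_predT.
set G := [seq i <- F | x \in cube_set (star i)].
have GM : (size G)%:R <= (3 * B ^+ 2) ^+ n.
  apply: (@whitney_overlap x); first exact: filter_uniq.
  by move=> Q; rewrite mem_filter => /andP[/set_mem Qx /FW].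
have -> : iter (size G) (+%E (h x)) 0%E = ((size G)%:R%:E * h x)%E.
  elim: (size G) => [|k IH] /=; first by rewrite mul0e.
  rewrite IH -natr1 EFinD ge0_muleDl ?lee_fin// mul1e addeC//.
by apply: lee_wpmul2r; [exact: h0|rewrite lee_fin].
Qed.

(** A dyadic cube is determined by its integer data, so countability comes from [pickle]; the finite
    families are the cubes of [W] among the first [k] codes. *)
Lemma whitney_exhaustion : exists F : nat -> seq (cube R n),
  [/\ forall k, uniq (F k), forall k Q, Q \in F k -> W Q,
      forall k k', (k <= k')%N -> {subset F k <= F k'} &
      forall Q, W Q -> exists k, Q \in F k].
Proof.
pose cub (t : int * {ffun 'I_n -> int}) : cube R n :=
  (\row_i ((t.2 i)%:~R * 2 ^ t.1 + 2 ^ t.1 / 2), 2 ^ t.1 / 2).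
pose e k := omap cub (unpickle k).
exists (fun k => undup [seq Q <- pmap e (iota 0 k) | `[<W Q>]]).
have memF k Q : Q \in undup [seq Q <- pmap e (iota 0 k) | `[<W Q>]] <->
    W Q /\ exists2 j, (j < k)%N & e j = Some Q.
  rewrite mem_undup mem_filter mem_pmap; split.
    by move=> /andP[/asboolP WQ /mapP[j]]; rewrite mem_iota => jk ->; split => //; exists j.
  move=> [WQ [j jk ej]]; apply/andP; split; first exact/asboolP.
  by apply/mapP; exists j; rewrite ?mem_iota.
split.
- by move=> k; exact: undup_uniq.
- by move=> k Q /memF[].
- move=> k k' kk' Q /memF[WQ [j jk ej]]; apply/memF; split => //; exists j => //.
  exact: leq_trans kk'.
move=> Q WQ; have [k [m [sQ Qm]]] := whitney_dyadic HW WQ.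
exists (pickle (k, [ffun i => m i])).+1; apply/memF; split => //.
exists (pickle (k, [ffun i => m i])) => //; rewrite /e pickleK/=; congr Some.
have Q2 : Q.2 = 2 ^ k / 2 by rewrite -sQ /side mulrC mulKf.
rewrite /cub/= -Q2 [RHS]surjective_pairing; congr pair; apply/rowP => i.
by rewrite !mxE ffunE -Qm subrK.
Qed.

Lemma whitney_measurable d (T : measurableType d) (f : 'rV[R]_n -> T) :
  (forall Q, W Q -> measurable_fun (cube_set Q) f) -> measurable_fun Omega f.
Proof.
move=> mf; have [F [_ FW _ WF]] := whitney_exhaustion.
pose A k := \bigcup_(Q in [set` F k]) cube_set Q.
have mA k : measurable (A k).
  by rewrite /A bigcup_seq; apply: bigsetU_measurable => Q _; exact: measurable_cube_set.
have -> : Omega = \bigcup_k A k.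
  rewrite -(whitney_cover HW); apply/seteqP; split => x.
    by move=> [Q WQ Qx]; have [k Qk] := WF Q WQ; exists k => //; exists Q.
  by move=> [k _ [Q QF Qx]]; exists Q => //; exact: FW QF.
apply/measurable_fun_bigcup => // k; rewrite /A.
elim: (F k) (FW k) => [|Q s IH] Fk; first by rewrite set_nil bigcup_set0; exact: measurable_fun_set0.
rewrite bigcup_seq big_cons -bigcup_seq; apply/measurable_funU; first exact: measurable_cube_set.
  by rewrite bigcup_seq; apply: bigsetU_measurable => P _; exact: measurable_cube_set.
split; first by apply: mf; apply: Fk; rewrite inE eqxx.
by apply: IH => P Ps; apply: Fk; rewrite in_cons Ps orbT.
Qed.

(** Monotone convergence along [whitney_exhaustion]; thanks to it, infinite sums over [W] never
    appear. *)
Lemma whitney_integral_le (g : 'rV[R]_n -> \bar R) (b : \bar R) :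
  measurable_fun Omega g -> (forall x, Omega x -> 0 <= g x)%E ->
  (forall F, uniq F -> (forall Q, Q \in F -> W Q) ->
    \sum_(Q <- F) \int[lebesgue_rV]_(x in cube_set Q) g x <= b)%E ->
  (\int[lebesgue_rV]_(x in Omega) g x <= b)%E.
Proof.
move=> mg g0 H; have [F [uF FW Fmono WF]] := whitney_exhaustion.
pose A k := \big[setU/set0]_(Q <- F k) cube_set Q.
have mA k : measurable (A k) by apply: bigsetU_measurable => Q _; exact: measurable_cube_set.
have OA : Omega = \bigcup_k A k.
  rewrite -(whitney_cover HW); apply/seteqP; split => x.
    move=> [Q WQ Qx]; have [k Qk] := WF Q WQ; exists k => //.
    by rewrite /A -bigcup_seq; exists Q.
  by move=> [k _]; rewrite /A -bigcup_seq => -[Q QF Qx]; exists Q => //; exact: FW QF.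
have AO k : A k `<=` Omega by rewrite OA => x Akx; exists k.
have ndA : {homo A : k m / (k <= m)%N >-> (k <= m)%O}.
  move=> k m km; apply/subsetPset; rewrite /A -!bigcup_seq => x [Q QF Qx].
  by exists Q => //; exact: Fmono km _ QF.
have mgA k : measurable_fun (A k) g by exact: measurable_funS (open_measurable_rV (whitney_open HW)) (AO k) mg.
have cv := @ge0_nondecreasing_set_cvg_integral _ _ _ A g (@lebesgue_rV R n) ndA mA mgA
  (fun k x Ax => g0 x (AO k x Ax)).
rewrite OA -(cvg_lim _ cv)//; apply: lime_le; first by apply/cvg_ex; exists (\int[lebesgue_rV]_(x in \bigcup_i A i) g x)%E.
apply: nearW => k; rewrite /A ge0_integral_bigsetU//.
- by apply: H; [exact: uF|exact: FW].
- by move=> Q; exact: measurable_cube_set.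
- by move=> Q Q' QF Q'F; apply: (whitney_disjoint HW); exact: (FW k).
- exact: mgA.
- by move=> x /(AO k); exact: g0.
Qed.

End whitney_geometry.

(** * Lipschitz extension, weight and doubling on Whitney cubes *)

Lemma gsum_le_enorm (R : realType) n (U : 'rV[R]_n -> R) x :
  gsum U x <= n%:R * enorm (grad U x).
Proof.
rewrite /gsum (_ : n%:R * _ = \sum_(i < n) enorm (grad U x)); last first.
  by rewrite sumr_const card_ord mulr_natl.
apply: ler_sum => i _; apply: le_trans (ler_norm_enorm _).
have := iffLR (@ler_mx_norm_rV _ _ (grad U x) _ (normr_ge0 _)) (lexx _) i.
by rewrite /grad mxE.
Qed.

(** Compose [u] with the coordinatewise clamp [cl] onto the closed cube of radius [s], a 1-Lipschitz
    retraction in the sup norm. The gap [r < s] leaves a neighbourhood on which the clamp is the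
    identity, so that gradients agree as well. *)
Lemma lip_loc_extension (R : realType) n (Omega : set 'rV[R]_n) (u : 'rV[R]_n -> R)
    (c : 'rV[R]_n) (r s : R) :
  lip_loc Omega u -> 0 < r -> r < s -> (forall x, `|x - c| <= s -> Omega x) ->
  exists L U, [/\ 0 <= L, lipf L U &
    forall x, `|x - c| <= r -> U x = u x /\ grad U x = grad u x].
Proof.
move=> lu r0 rs sO; have s0 := lt_trans r0 rs.
pose K := [set x : 'rV[R]_n | forall i, `[c 0 i - s, c 0 i + s]%classic (x ord0 i)].
have KE x : `|x - c| <= s <-> K x.
  split => [/(ler_mx_norm_rV _ (ltW s0)) h i|h].
    by have := h i; rewrite !mxE /= in_itv/= ler_norml; lra.
  by apply/(ler_mx_norm_rV _ (ltW s0)) => i; have := h i; rewrite !mxE /= in_itv/= ler_norml; lra.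
have cK : compact K by apply: (@rV_compact R n (fun i => `[c 0 i - s, c 0 i + s]%classic)) => i; exact: segment_compact.
have [L hL] := lu K cK (fun x Kx => sO x (iffRL (KE x) Kx)).
pose cl (x : 'rV[R]_n) : 'rV[R]_n := \row_i Num.max (c 0 i - s) (Num.min (c 0 i + s) (x 0 i)).
have clK x : K (cl x).
  by move=> i; rewrite /cl mxE /= in_itv/= le_max lexx/= ge_max ge_min lexx; lra.
have Kcl x : K x -> cl x = x.
  move=> Kx; apply/rowP => i; rewrite mxE; have := Kx i; rewrite /= in_itv/= => /andP[h1 h2].
  by rewrite min_r// max_r.
have cl1 x y : `|cl x - cl y| <= `|x - y|.
  apply/ler_mx_norm_rV => // i; apply: (@le_trans _ _ `|x 0 i - y 0 i|); last first.
    have := iffLR (@ler_mx_norm_rV _ _ (x - y) _ (normr_ge0 _)) (lexx _) i.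
    by rewrite !mxE.
  rewrite !mxE; set a := c 0 i; set s1 := x 0 i; set t1 := y 0 i.
  have ss : `|s1 - t1| >= s1 - t1 /\ `|s1 - t1| >= t1 - s1.
    by rewrite ler_norm -normrN opprB ler_norm.
  rewrite ler_norml; move: ss; set d := `|_| => -[d1 d2].
  by rewrite /Order.max /Order.min; do ?case: ifPn; rewrite -?leNgt => *; apply/andP; split; lra.
pose sn := Num.sqrt (n%:R : R).
exists (`|L| * sn), (u \o cl); split.
- by rewrite mulr_ge0 ?sqrtr_ge0.
- move=> x y /=; apply: (le_trans (hL _ _ (clK x) (clK y))).
  apply: (@le_trans _ _ (`|L| * (sn * `|cl x - cl y|))).
    apply: (@le_trans _ _ (`|L| * enorm (cl x - cl y))).
      by rewrite ler_wpM2r ?ler_norm// enorm_ge0.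
    by rewrite ler_wpM2l// enorm_le_norm.
  by rewrite mulrA ler_wpM2l// mulr_ge0 ?sqrtr_ge0.
move=> x xr; split; first by rewrite /= Kcl//; apply/KE; lra.
apply/rowP => i; rewrite !mxE; apply: near_eq_derive.
have d0 : 0 < s - r by rewrite subr_gt0.
apply: filterS (nbhsx_ballx x _ d0) => y; rewrite -ball_normE/= => xy.
rewrite Kcl//; apply/KE; rewrite (le_trans (ler_distD x _ _))//.
by rewrite [X in X + _]distrC; lra.
Qed.

Section whitney_weight.
Variables (R : realType) (n : nat) (Omega : set 'rV[R]_n) (W : set (cube R n)).
Hypotheses (n0 : (0 < n)%N) (HW : whitney Omega W).
Implicit Types (Q : cube R n) (x y : 'rV[R]_n).

Lemma whitney_extension u Q : lip_loc Omega u -> W Q ->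
  exists L U, [/\ 0 <= L, lipf L U &
    forall x, cube_set (star Q) x -> U x = u x /\ grad U x = grad u x].
Proof.
move=> lu WQ; have r0 := whitney_gt0 HW WQ.
have r1 : 0 < 9 / 8 * Q.2 by rewrite mulr_gt0.
(* A radius strictly between that of [star Q] and the [3 * Q.2] of [whitney_ball]. *)
have r2 : 9 / 8 * Q.2 < 5 / 4 * Q.2 by lra.
have [|L [U [L0 lU UE]]] := @lip_loc_extension _ _ _ u Q.1 _ _ lu r1 r2.
  by move=> x h; apply: (whitney_ball n0 HW WQ); lra.
exists L, U; split => // x Qx; apply: UE.
exact: (@cube_set_norm _ _ (star Q) x (ltW r1) Qx).
Qed.

(** The hypothesis on [pt_dist] rules out an empty boundary, for which [inf set0 = 0]. Boundary
    points of an open set lie outside it, so the Whitney distance condition applies to them. *)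
Lemma whitney_bdry_dist Q x : W Q -> cube_set Q x -> pt_dist x (bdry Omega) != 0 ->
  side Q <= pt_dist x (bdry Omega).
Proof.
move=> WQ Qx d0; rewrite /pt_dist; apply: lb_le_inf.
  apply/set0P/eqP => E; move: d0; rewrite /pt_dist E inf0 eqxx//.
move=> _ [y [_ By] <-]; have Oy : ~ Omega y.
  by move=> Oy; apply: By; rewrite /interior; exact: (open_nbhs_nbhs (conj (whitney_open HW) Oy)).
apply: le_trans (whitney_enorm HW WQ Qx Oy); apply: ler_peMl.
  by rewrite /side mulr_ge0// ltW// (whitney_gt0 HW).
by rewrite -[leLHS]sqrtr1; apply: ler_wsqrtr; rewrite ler1n.
Qed.

Lemma whitney_weight_le (b : R) Q x : 0 <= b -> W Q -> cube_set Q x ->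
  pt_dist x (bdry Omega) `^ (- b) <= side Q `^ (- b).
Proof.
move=> b0 WQ Qx; have s0 : 0 < side Q by rewrite /side mulr_gt0// (whitney_gt0 HW).
(* At distance 0 the negative power takes its default value 0, or 1 when [b = 0]; both respect the
   bound. *)
have [d0|d0] := eqVneq (pt_dist x (bdry Omega)) 0.
  rewrite d0; have [->|bn] := eqVneq b 0; first by rewrite oppr0 !powRr0.
  by rewrite powR0 ?powR_ge0// oppr_eq0.
apply: ler_powR2_neg => //.
exact: whitney_bdry_dist.
Qed.

Lemma whitney_wmeas_le (b : R) Q : 0 <= b -> W Q ->
  (wmeas (fun x => (pt_dist x (bdry Omega) `^ (- b))%R) (cube_set Q) <=
   (side Q `^ (n%:R - b))%:E)%E.
Proof.
move=> b0 WQ; have s0 : 0 < side Q by rewrite /side mulr_gt0// (whitney_gt0 HW).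
apply: (@le_trans _ _ (\int[lebesgue_rV]_(x in cube_set Q) (cst (side Q `^ (- b))%:E x))%E).
  apply: ge0_le_integral_gen => x Qx; first by rewrite lee_fin powR_ge0.
  by rewrite lee_fin; exact: whitney_weight_le.
rewrite (integral_cst (@lebesgue_rV R n))//; last exact: measurable_cube_set.
rewrite [X in (_ * X)%E]lebesgue_cube ?(ltW (whitney_gt0 HW WQ))// -EFinM lee_fin.
by rewrite -powR_mulrn ?(ltW s0)// (powRDe (e := n%:R - b)) 1?addrC.
Qed.

(** The maximum with 1 makes the constant nonnegative whatever the sign of [D], so that the bounds
    can be multiplied. *)
Lemma doubling_iter (w : 'rV[R]_n -> R) (D : R) x r k : (forall y, 0 <= w y) ->
  doubling Omega w D -> Omega x -> 0 < r ->
  (wmeas w (Omega `&` cube_set (x, (2 ^+ k * r)%R)) <=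
   (Num.max D 1 ^+ k)%:E * wmeas w (Omega `&` cube_set (x, r)))%E.
Proof.
move=> w0 [_ dD] Ox r0; elim: k => [|k IH]; first by rewrite !expr0 !mul1r mul1e.
rewrite exprS -mulrA; apply: (le_trans (dD x _ Ox _)); first by rewrite mulr_gt0// exprn_gt0.
apply: (@le_trans _ _ ((Num.max D 1)%:E * wmeas w (Omega `&` cube_set (x, (2 ^+ k * r)%R)))%E).
  apply: lee_wpmul2r; last by rewrite lee_fin le_max lexx.
  by apply: integral_ge0 => y _; rewrite lee_fin.
rewrite exprS EFinM -muleA lee_wpmul2l// lee_fin le_max ler01 orbT//.
Qed.

End whitney_weight.

(** * Estimates on Whitney cubes and chains *)

Section cube_estimate.
Variables (R : realType) (n : nat) (p q : R).
Hypotheses (p1 : 1 < p) (pq : p <= q) (qs : q <= n%:R * p / (n%:R - p)) (pn : p < n%:R).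

Let beta : R := n%:R - q / p * (n%:R - p).

Let p0 : 0 < p. Proof. exact: lt_trans p1. Qed.
Let q0 : 0 < q. Proof. exact: lt_le_trans pq. Qed.
Let n0 : 0 < n%:R :> R. Proof. exact: lt_trans pn. Qed.
Let np0 : 0 < n%:R - p. Proof. by rewrite subr_gt0. Qed.

Lemma whitney_exponent_ge0 : 0 <= beta.
Proof.
move: qs; rewrite ler_pdivlMr// => h.
by rewrite /beta mulrAC subr_ge0 ler_pdivrMr.
Qed.

Let s : R := n%:R * p / (n%:R - p).
Let s0 : 0 < s. Proof. by rewrite divr_gt0// mulr_gt0. Qed.

(** The Sobolev inequality at the critical exponent [s] on the enlarged cube, lowered to [q] by
    [power_mean]: the volume factor is [l ^ beta], which cancels the bound [l ^ (- beta)] of the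
    weight. *)
Lemma whitney_cube_estimate : exists2 C : R, 0 < C &
  forall (Omega : set 'rV[R]_n) (W : set (cube R n)) (u : 'rV[R]_n -> R) (Q : cube R n) (F : R),
  whitney Omega W -> lip_loc Omega u -> W Q -> 0 <= F ->
  (\int[lebesgue_rV]_(x in cube_set (star Q)) ((n%:R * enorm (grad u x)) `^ p)%:E <= (F `^ p)%:E)%E ->
  exists m : R,
   (\int[lebesgue_rV]_(x in cube_set (star Q)) `|u x - m|%:E <=
     (2 * F * side (star Q) `^ (1 - n%:R / p) * side (star Q) ^+ n)%:E)%E /\
   (\int[lebesgue_rV]_(x in cube_set Q) (`|u x - m| `^ q * pt_dist x (bdry Omega) `^ (- beta))%:E <=
     (C * F `^ q)%:E)%E.
Proof.
have [C C0 HC] := @sobolev_cube R n p p1 pn.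
(* The 2 is that of [power_mean], [C ^ (1/s)] puts the Sobolev constant inside the power [s], and
   [(9 / 8) ^ beta] compares the sides of [star Q] and [Q]. *)
exists (2 * (C `^ s^-1) `^ q * (9 / 8) `^ beta).
  by rewrite mulr_gt0// ?powR_gt0// mulr_gt0// powR_gt0 ?powR_gt0.
have nn : (0 < n)%N by rewrite -(ltr0n R).
move=> Omega W u Q F HW lu WQ F0 HF; have r0 := whitney_gt0 HW WQ.
have r1 : 0 < 9 / 8 * Q.2 by rewrite mulr_gt0.
have [L [U [L0 lU UE]]] := whitney_extension nn HW lu WQ.
pose P := cube_set (star Q); pose l := side (star Q).
have l0 : 0 < l by rewrite /l /side mulr_gt0.
have mP : measurable P by exact: measurable_cube_set.
have lebP : lebesgue_rV P = (l ^+ n)%:E by rewrite lebesgue_cube//= ltW.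
have v0 : 0 < l ^+ n by rewrite exprn_gt0.
have mU := lipf_measurable lU.
have mg := measurable_gsum lU.
have gF : (\int[lebesgue_rV]_(x in P) (gsum U x `^ p)%:E <= (F `^ p)%:E)%E.
  apply: le_trans HF; apply: ge0_le_integral_gen => x Px; first by rewrite lee_fin powR_ge0.
  rewrite lee_fin; apply: ler_powR2; [exact: ltW|exact: gsum_ge0|].
  by rewrite (le_trans (gsum_le_enorm U x))// (UE x Px).2.
have [m [H1 H2]] := HC L U Q.1 (9 / 8 * Q.2) F L0 lU r1 F0 gF.
have mh : measurable_fun P (fun x => `|U x - m|).
  by apply/measurable_funTS/measurableT_comp => //; exact: measurable_funB.
have uU (f : R -> R) : (\int[lebesgue_rV]_(x in P) (f (`|u x - m|))%:E =
   \int[lebesgue_rV]_(x in P) (f (`|U x - m|))%:E)%E.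
  by apply: eq_integral => x; rewrite inE => Px; rewrite (UE x Px).1.
have vE e : (l ^+ n) `^ e = l `^ (n%:R * e).
  by rewrite -powR_mulrn ?(ltW l0)// -powRrM.
exists m; split.
  rewrite -/P (uU id); apply: (le_trans H1).
  have := @power_mean _ _ _ (@lebesgue_rV R n) P (gsum U) 1 p F (l ^+ n)
    mP (measurable_funTS mg) (fun x _ => gsum_ge0 U x) lebP v0.
  rewrite ltr01 (ltW p1) => /(_ isT F0 gF).
  rewrite (eq_integral (fun x => (gsum U x)%:E)); last first.
    by move=> x _; rewrite powRr1// gsum_ge0.
  have l0' : (0 <= l%:E)%E by rewrite lee_fin ltW.
  move=> /(lee_wpmul2l l0') /le_trans; apply.
  have E : l * l `^ (n%:R * (1 - p^-1)) = l `^ (1 - n%:R / p) * l ^+ n.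
    rewrite -powR_mulrn ?(ltW l0)// -[X in X * _ = _](powRr1 (ltW l0)) !(powRDe l0 erefl).
    by congr (_ `^ _); ring.
  rewrite -EFinM lee_fin powRr1// -/l vE div1r -(mulrA (2 * F)) -E.
  by rewrite le_eqVlt; apply/orP; left; apply/eqP; ring.
have H2' : (\int[lebesgue_rV]_(x in P) (`|U x - m| `^ s)%:E <= ((C `^ s^-1 * F) `^ s)%:E)%E.
  by rewrite powRM ?powR_ge0// -powRrM mulVf ?gt_eqF// powRr1// ltW.
have := @power_mean _ _ _ (@lebesgue_rV R n) P (fun x => `|U x - m|) q s (C `^ s^-1 * F) (l ^+ n)
  mP mh (fun x _ => normr_ge0 _) lebP v0.
rewrite q0 qs mulr_ge0 ?powR_ge0// => /(_ isT isT H2').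
have -> : (l ^+ n) `^ (1 - q / s) = l `^ beta.
  rewrite vE; congr (_ `^ _); rewrite /beta /s; field.
  by rewrite (gt_eqF p0) (gt_eqF n0) (gt_eqF np0).
rewrite -(uU (fun t => t `^ q)) => H3.
have sQ0 : 0 < side Q by rewrite /side mulr_gt0.
have QP : cube_set Q `<=` P by exact/cube_set_star/ltW.
have mQ : measurable (cube_set Q) by exact: measurable_cube_set.
have muP : measurable_fun P (fun x => (`|u x - m| `^ q)%:E).
  apply: (@eq_measurable_fun _ _ _ _ _ (fun x => (`|U x - m| `^ q)%:E)).
    by move=> x; rewrite inE => Px; rewrite (UE x Px).1.
  apply/measurable_EFinP; exact: (measurableT_comp (measurable_powR _) mh).
apply: (@le_trans _ _ (\int[lebesgue_rV]_(x in cube_set Q)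
    ((side Q `^ (- beta))%:E * (`|u x - m| `^ q)%:E))%E).
  apply: ge0_le_integral_gen => x Qx; first by rewrite lee_fin mulr_ge0 ?powR_ge0.
  rewrite -EFinM lee_fin mulrC ler_wpM2r ?powR_ge0//.
  exact: (whitney_weight_le nn HW whitney_exponent_ge0 WQ Qx).
have muQ := measurable_funS mP QP muP.
have u0 x : cube_set Q x -> (0 <= (`|u x - m| `^ q)%:E)%E by rewrite lee_fin powR_ge0.
rewrite ge0_integralZl ?lee_fin ?powR_ge0//.
apply: (@le_trans _ _ ((side Q `^ (- beta))%:E * \int[lebesgue_rV]_(x in P) (`|u x - m| `^ q)%:E)%E).
  apply: lee_wpmul2l; first by rewrite lee_fin powR_ge0.
  by apply: ge0_subset_integral => // x _; rewrite lee_fin powR_ge0.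
have b0 : (0 <= (side Q `^ (- beta))%:E)%E by rewrite lee_fin powR_ge0.
apply: (le_trans (lee_wpmul2l b0 H3)); rewrite -EFinM lee_fin.
have -> : l = 9 / 8 * side Q by rewrite /l /side /=; ring.
have h98 : 0 <= 9 / 8 :> R by rewrite divr_ge0.
rewrite (powRM q (powR_ge0 _ _) F0) (powRM beta h98 (ltW sQ0)) powRN le_eqVlt; apply/orP; left; apply/eqP.
by field; rewrite gt_eqF// powR_gt0.
Qed.

(* [F ^ q] is the scale-invariant quantity: the weight of a Whitney cube of side [l] is at
   most [l ^ (n - beta)], with [n - beta = q (n / p - 1)]. *)
Lemma whitney_mass_estimate (Omega : set 'rV[R]_n) (W : set (cube R n)) (Q : cube R n) (F : R) :
  whitney Omega W -> W Q -> 0 <= F ->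
  (2 * F * side (star Q) `^ (1 - n%:R / p)) `^ q *
    fine (wmeas (fun x => pt_dist x (bdry Omega) `^ (- beta)) (cube_set Q)) <= 2 `^ q * F `^ q.
Proof.
move=> HW WQ F0; have r0 := whitney_gt0 HW WQ.
have nn : (0 < n)%N by rewrite -(ltr0n R).
have sQ0 : 0 < side Q by rewrite /side mulr_gt0.
have := whitney_wmeas_le nn HW whitney_exponent_ge0 WQ.
have := @integral_ge0 _ _ _ (@lebesgue_rV R n) (cube_set Q)
  (fun x => (pt_dist x (bdry Omega) `^ (- beta))%:E) (fun x _ => powR_ge0 _ _).
rewrite -/(wmeas _ _); case: (wmeas _ _) => [x| |]//; rewrite !lee_fin => x0 xs /=.
have l0 : 0 < side (star Q) by rewrite /side mulr_gt0//= mulr_gt0.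
rewrite (powRM q (_ : 0 <= 2 * F)) ?powR_ge0//; last exact: mulr_ge0.
rewrite (powRM q (_ : 0 <= 2))// -mulrA ler_piMr//; first by rewrite mulr_ge0 ?powR_ge0.
apply: (@le_trans _ _ ((side (star Q) `^ (1 - n%:R / p)) `^ q * side Q `^ (n%:R - beta))).
  by rewrite ler_wpM2l ?powR_ge0.
have np1 : 0 < n%:R / p - 1 by rewrite subr_gt0 ltr_pdivlMr// mul1r.
have e1 : n%:R - beta = (n%:R / p - 1) * q by rewrite /beta; field; rewrite gt_eqF.
have e2 : 1 - n%:R / p = - (n%:R / p - 1) by rewrite opprB.
rewrite e1 e2 powRN powRrM -powRM ?invr_ge0 ?powR_ge0//.
apply: (@le_trans _ _ (1 `^ q)); last by rewrite powR1.
rewrite ler_powR2 ?(ltW q0) ?mulr_ge0 ?invr_ge0 ?powR_ge0//.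
rewrite mulrC ler_pdivrMr ?powR_gt0// mul1r ler_powR2 ?(ltW np1) ?(ltW sQ0)//.
by rewrite /side /=; lra.
Qed.

End cube_estimate.

(** * Oscillation along chains *)

Section chain_oscillation.
Variables (R : realType) (n : nat) (c : R) (u : 'rV[R]_n -> R) (m a : cube R n -> R).
Hypothesis c0 : 0 < c.

Definition mean_oscillation (Q : cube R n) : Prop :=
  [/\ 0 < Q.2, 0 <= a Q, measurable_fun (cube_set (star Q)) u &
    (\int[lebesgue_rV]_(x in cube_set (star Q)) `|u x - m Q|%:E <=
     (a Q * side (star Q) ^+ n)%:E)%E].

(** [value_jump] on the linking cube, whose volume is at least [c ^+ n] times that of the larger
    star. *)
Lemma linked_oscillation Q Q' : mean_oscillation Q -> mean_oscillation Q' -> linked c Q Q' ->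
  `|m Q - m Q'| <= (c ^+ n)^-1 * (a Q + a Q').
Proof.
move=> [r0 a0 mQ HQ] [r0' a0' mQ' HQ'] [P [PQ sP]].
have l0 : 0 < side (star Q) by rewrite /side mulr_gt0//= mulr_gt0.
have l0' : 0 < side (star Q') by rewrite /side mulr_gt0//= mulr_gt0.
set M := Num.max _ _ in sP.
have M0 : 0 < M by rewrite lt_max l0.
have sP0 : 0 < side P by rewrite (lt_le_trans _ sP)// mulr_gt0.
have P0 : 0 < P.2 by move: sP0; rewrite /side pmulr_rgt0.
have := @value_jump R n u P (star Q) (star Q') (m Q) (m Q') _ _ mQ mQ' (ltW P0)
  (fun x Px => proj1 (PQ x Px)) (fun x Px => proj2 (PQ x Px)) HQ HQ'.
have Mn : a Q * side (star Q) ^+ n + a Q' * side (star Q') ^+ n <= (a Q + a Q') * M ^+ n.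
  by rewrite mulrDl lerD// ler_wpM2l// lerXn2r ?nnegrE ?(ltW l0) ?(ltW l0') ?(ltW M0)// le_max lexx ?orbT.
have Pn : c ^+ n * M ^+ n <= side P ^+ n.
  by rewrite -exprMn lerXn2r ?nnegrE ?(ltW sP0)// mulr_ge0// ltW.
move=> /le_trans/(_ Mn) H; rewrite ler_pdivlMl ?exprn_gt0//.
rewrite -(ler_pM2r (exprn_gt0 n M0)); apply: le_trans H.
by rewrite mulrAC ler_wpM2r.
Qed.

Lemma chain_oscillation Q0 s : (forall Q, Q \in Q0 :: s -> mean_oscillation Q) ->
  (forall j, (j < size s)%N -> linked c (nth Q0 (Q0 :: s) j.+1) (nth Q0 (Q0 :: s) j)) ->
  `|m (last Q0 s) - m Q0| <= 2 * (c ^+ n)^-1 * \sum_(Q <- Q0 :: s) a Q.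
Proof.
move=> H1 H2; pose k := (c ^+ n)^-1; have k0 : 0 <= k by rewrite invr_ge0 exprn_ge0// ltW.
(* Each cube takes part in at most two links and the head in only one; counting the head once makes
   the induction close. *)
suff : `|m (last Q0 s) - m Q0| <= k * (a Q0 + 2 * \sum_(Q <- s) a Q).
  move=> /le_trans; apply; rewrite big_cons -/k.
  have [_ a0 _ _] := H1 Q0 (mem_head _ _).
  set S := \sum_(_ <- _) _; rewrite [2 * k]mulrC -mulrA ler_wpM2l//.
  by rewrite mulrDr lerD2r ler_peMl// ler1n.
elim: s Q0 H1 H2 => [|Q s IH] Q0 H1 H2 /=.
  rewrite subrr normr0 big_nil mulr0 addr0 mulr_ge0//.
  by have [] := H1 Q0 (mem_head _ _).
have hQ : mean_oscillation Q by apply: H1; rewrite !inE eqxx orbT.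
have hQ0 : mean_oscillation Q0 by apply: H1; rewrite !inE eqxx.
have h1 := linked_oscillation hQ hQ0 (H2 0%N isT).
have h2 : `|m (last Q s) - m Q| <= k * (a Q + 2 * \sum_(Q <- s) a Q).
  apply: IH => [Q' Q's|j js]; first by apply: H1; rewrite inE Q's orbT.
  have := H2 j.+1; rewrite /= ltnS => /(_ js).
  by rewrite !(set_nth_default Q) //= ltnS ltnW.
rewrite (le_trans (ler_distD (m Q) _ _))// big_cons (le_trans (lerD h2 h1))// -/k.
by rewrite le_eqVlt; apply/orP; left; apply/eqP; ring.
Qed.

End chain_oscillation.

(** * Bojarski's lemma for Whitney cubes *)

Lemma sum_subseq_uniq (R : realType) (T : eqType) (s t : seq T) (f : T -> R) :
  uniq s -> uniq t -> {subset s <= t} ->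
  \sum_(x <- s) f x = \sum_(x <- t | x \in s) f x.
Proof.
move=> us ut st; rewrite -[RHS]big_filter; apply: perm_big; apply: uniq_perm => //.
  exact: filter_uniq.
move=> x; rewrite mem_filter; apply/idP/andP => [xs|[]//].
by split => //; exact: st.
Qed.

Lemma ler_sum_uniq (R : realType) (T : eqType) (s t : seq T) (f : T -> R) :
  (forall x, 0 <= f x) -> uniq s -> uniq t -> {subset s <= t} ->
  \sum_(x <- s) f x <= \sum_(x <- t) f x.
Proof.
move=> f0 us ut st; rewrite (sum_subseq_uniq _ us ut st) big_mkcond.
by apply: ler_sum => x _; case: ifP.
Qed.

Lemma powR_add_le (R : realType) (x y q : R) : 0 <= x -> 0 <= y -> 0 <= q ->
  (x + y) `^ q <= 2 `^ q * (x `^ q + y `^ q).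
Proof.
move=> x0 y0 q0; rewrite mulrDr -!powRM//; have [xy|yx] := leP x y.
  rewrite ler_wpDl ?powR_ge0// ler_powR2 ?addr_ge0//; lra.
rewrite ler_wpDr ?powR_ge0// ler_powR2 ?addr_ge0//; lra.
Qed.

Lemma measurable_enorm_grad (R : realType) n (L : R) (U : 'rV[R]_n -> R) :
  lipf L U -> measurable_fun setT (fun x => enorm (grad U x)).
Proof.
move=> lU; rewrite /enorm /grad.
apply: (@measurableT_comp _ _ _ _ _ _ (Num.sqrt : R -> R)).
  by apply: continuous_measurable_fun; exact: sqrt_continuous.
apply: measurable_sum => i.
under eq_fun do rewrite mxE.
exact: measurable_funX (measurable_derive _ lU).
Qed.

Section whitney_bojarski.
Variables (R : realType) (n : nat) (q D N : R).
Hypotheses (q1 : 1 < q).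

(** [bojarski_sum] for the cubes of [S] sorted by decreasing size, level [j] standing for dilation
    by [2 ^+ (k0 + 2 * j)]. Disjointness and iterated doubling bound the mass inside such a dilate,
    giving [K = D' ^+ k0] and [E = D' ^+ 2]. *)
Lemma whitney_bojarski : exists2 C : R, 0 < C &
  forall (Omega : set 'rV[R]_n) (W : set (cube R n)) (w : 'rV[R]_n -> R) (a : cube R n -> R)
    (ch : cube R n -> seq (cube R n)) (T S : seq (cube R n)),
  whitney Omega W -> doubling Omega w D -> (forall x, 0 <= w x) ->
  (forall Q, W Q -> wmeas w (cube_set Q) \is a fin_num) ->
  (forall Q, 0 <= a Q) -> uniq T -> uniq S -> {subset T <= S} -> (forall Q, Q \in S -> W Q) ->
  (forall Q, Q \in T -> uniq (ch Q) /\ {subset ch Q <= S}) ->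
  (forall Q P, Q \in T -> P \in ch Q -> cube_set Q `<=` cube_set (dilate N P)) ->
  \sum_(Q <- T) fine (wmeas w (cube_set Q)) * (\sum_(P <- ch Q) a P) `^ q <=
  C * \sum_(Q <- S) fine (wmeas w (cube_set Q)) * a Q `^ q.
Proof.
have q0 : 0 <= q by rewrite (le_trans ler01)// ltW.
have [k0 Nk0] : exists k0, N <= 2 ^+ k0.
  exists (Num.bound `|N|); rewrite (le_trans (ler_norm _))//.
  by rewrite (le_trans (ltW (archi_boundP (normr_ge0 _))))// -natrX ler_nat ltnW// ltn_expl.
pose D' := Num.max D 1; have D'1 : 1 <= D' by rewrite le_max lexx orbT.
have D'0 : 0 <= D' by rewrite (le_trans ler01).
have E1 : 1 <= D' ^+ 2 by rewrite expr_ge1.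
have K0 : 0 <= D' ^+ k0 by rewrite exprn_ge0.
have [C C0 HC] := bojarski_sum q1 K0 E1; exists C => //.
move=> Omega W w a ch T S HW dw w0 wfin a0 uT uS TS SW chS chN.
pose ge (P Q : cube R n) := Q.2 <= P.2.
have ge_tot : total ge by move=> P Q; rewrite /ge; case: (leP Q.2 P.2) => // /ltW.
have ge_tr : transitive ge by move=> P Q Q' h1 h2; exact: le_trans h2 h1.
pose S' := sort ge S.
have pS : perm_eq S' S by rewrite perm_sort.
have uS' : uniq S' by rewrite sort_uniq.
have S'W Q : Q \in S' -> W Q by rewrite mem_sort; exact: SW.
have TS' : {subset T <= S'} by move=> Q QT; rewrite mem_sort; exact: TS.
rewrite -[in leRHS](perm_big _ pS)/=.
pose x0 : cube R n := (0, 0); pose e i := nth x0 S' i.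
pose m := size S'.
have eS i : (i < m)%N -> e i \in S' by move=> im; exact: mem_nth.
pose W1 i := fine (wmeas w (cube_set (e i))).
pose rho j i k := `[< cube_set (e k) `<=` cube_set (dilate (2 ^+ (k0 + 2 * j)) (e i)) >].
have W10 i : 0 <= W1 i.
  by apply: fine_ge0; apply: integral_ge0 => x _; rewrite lee_fin.
have seqE (P : pred (cube R n)) (f : cube R n -> R) :
    \sum_(Q <- S' | P Q) f Q = \sum_(i < m | P (e i)) f (e i).
  by rewrite (big_nth x0) big_mkord.
have := HC m (a \o e) W1 rho (fun i => a0 _) W10.
have h1 j i : (i < m)%N -> \sum_(k < m | rho j i k) W1 k <= D' ^+ k0 * (D' ^+ 2) ^+ j * W1 i.
  move=> im; have Wi := S'W _ (eS _ im); have ri := whitney_gt0 HW Wi.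
  pose A := Omega `&` cube_set ((e i).1, 2 ^+ (k0 + 2 * j) * (e i).2).
  rewrite -(seqE (fun Q => `[< cube_set Q `<=` cube_set (dilate (2 ^+ (k0 + 2 * j)) (e i)) >])
    (fun Q => fine (wmeas w (cube_set Q)))).
  rewrite -big_filter -lee_fin -sumEFin big_seq.
  have FP Q : Q \in [seq Q <- S' | `[< cube_set Q `<=` cube_set (dilate (2 ^+ (k0 + 2 * j)) (e i)) >]] ->
      W Q /\ cube_set Q `<=` A.
    rewrite mem_filter => /andP[/asboolP QA /S'W WQ]; split => // x Qx.
    by split; [exact: (whitney_sub HW WQ)|exact: QA].
  rewrite (eq_bigr (fun Q => wmeas w (cube_set Q))); last first.
    by move=> Q /FP[WQ _]; rewrite fineK// wfin.
  have [[mw _ _] _] := dw; have mO := open_measurable_rV (whitney_open HW).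
  have mA : measurable A by apply: measurableI => //; exact: measurable_cube_set.
  rewrite -big_seq; apply: (@le_trans _ _ (wmeas w A)).
    apply: (whitney_integral_sum HW) => //.
    - by apply/measurable_EFinP; apply: measurable_funS mw => // x [].
    - by move=> x _; rewrite lee_fin.
    - exact: filter_uniq.
    - by move=> Q /FP[].
    - by move=> Q /FP[].
  have Oc : Omega (e i).1 := whitney_sub HW Wi (whitney_center HW Wi).
  apply: (le_trans (doubling_iter (k0 + 2 * j) w0 dw Oc ri)).
  rewrite (_ : Omega `&` _ = cube_set (e i)); last first.
    by apply: (@setIidr _ Omega (cube_set (e i))); exact: (whitney_sub HW Wi).
  by rewrite exprD exprM (EFinM _ (W1 i)) /W1 fineK// wfin.
(* The sorting gives [i'] the larger cube, and the factor 4 of [cube_set_nested] raises the level by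
   exactly one. *)
have h2 j i i' k : (i < m)%N -> (i' <= i)%N -> (k < m)%N -> rho j i k -> rho j i' k ->
    rho j.+1 i' i.
  move=> im i'i km /asboolP r1 /asboolP r2; apply/asboolP.
  have i'm := leq_ltn_trans i'i im.
  rewrite mulnS addnCA exprD (_ : 2 ^+ 2 = 4 :> R); last by rewrite expr2 -natrM.
  apply: (@cube_set_nested _ _ _ (e k) (e i) (e i')) => //.
  - by rewrite exprn_ege1// ler1n.
  - exact/(whitney_gt0 HW)/S'W/eS.
  - exact/(whitney_gt0 HW)/S'W/eS.
  - have := @sorted_leq_nth _ ge ge_tr (fun Q => lexx _) x0 S' (sort_sorted ge_tot S).
    by apply => //; rewrite inE.
move=> /(_ h1 h2); rewrite seqE => H; apply: le_trans H.
rewrite (sum_subseq_uniq _ uT uS' TS') big_mkcond seqE; apply: ler_sum => k _.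
case: ifPn => [eT|_]; last exact: mulr_ge0 (W10 k) (powR_ge0 _ _).
have [uch chS1] := chS _ eT.
have chS' : {subset ch (e k) <= S'} by move=> Q /chS1; rewrite mem_sort.
apply: ler_wpM2l; first exact: (W10 k).
rewrite ler_powR2//; first exact: sumr_ge0.
rewrite (sum_subseq_uniq _ uch uS' chS') seqE big_mkcond [leRHS]big_mkcond.
apply: ler_sum => i _; case: ifP => [ich|_] /=; last by case: ifP.
rewrite ifT//; apply/asboolP; rewrite muln0 addn0.
apply: subset_trans (chN _ _ eT ich) _; apply: cube_set_dilate => //.
exact/ltW/(whitney_gt0 HW)/S'W/eS.
Qed.

End whitney_bojarski.

(** * The Sobolev-Poincare inequality on Boman domains *)

Lemma boman_sobolev_poincare (R : realType) (n : nat) (c p q D N : R) :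
  0 < c -> 1 < p -> p <= q -> q <= n%:R * p / (n%:R - p) -> p < n%:R ->
  exists2 C : R, 0 < C &
    forall (Omega : set 'rV[R]_n) (W : set (cube R n)) (u : 'rV[R]_n -> R) (I : R),
      let w x := pt_dist x (bdry Omega) `^ (- (n%:R - q / p * (n%:R - p))) in
      whitney Omega W -> boman c W N Omega -> doubling Omega w D -> lip_loc Omega u ->
      (\int[lebesgue_rV]_(x in Omega) (enorm (grad u x) `^ p)%:E = I%:E)%E ->
      exists k : R,
        (\int[lebesgue_rV]_(x in Omega) (`|u x - k| `^ q * w x)%:E <= (C * I `^ (q / p))%:E)%E.
Proof.
move=> c0 p1 pq qs pn.
have p0 : 0 < p := lt_trans ltr01 p1.
have q1 : 1 < q := lt_le_trans p1 pq.
have q0 : 0 < q := lt_trans ltr01 q1.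
have nn : (0 < n)%N by rewrite -(ltr0n R) (lt_trans p0).
have [C1 C10 H1] := whitney_cube_estimate p1 pq qs pn.
have [C2 C20 H2] := @whitney_bojarski R n q D N q1.
pose M : R := (3 * (10 * Num.sqrt n%:R + 4) ^+ 2) ^+ n.
have M0 : 0 < M by rewrite exprn_gt0// mulr_gt0// exprn_gt0// ltr_wpDl// mulr_ge0// sqrtr_ge0.
pose kap : R := 2 * (c ^+ n)^-1.
have kap0 : 0 <= kap by rewrite mulr_ge0// invr_ge0 exprn_ge0// ltW.
(* The outer [2 ^ q] splits [|u - m Q0|] through [m Q]; [kap] comes from [chain_oscillation], [C2]
   from [whitney_bojarski], and the inner [2 ^ q] from [whitney_mass_estimate]. *)
pose C3 := 2 `^ q * (C1 + kap `^ q * (C2 * 2 `^ q)).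
have C30 : 0 < C3.
  by rewrite mulr_gt0 ?powR_gt0// ltr_wpDr// mulr_ge0 ?powR_ge0// mulr_ge0 ?powR_ge0// ltW.
have n0 : 0 < n%:R :> R by rewrite ltr0n.
exists (C3 * (M * n%:R `^ p) `^ (q / p)).
  by rewrite mulr_gt0// powR_gt0// mulr_gt0// powR_gt0.
move=> Omega W u I w HW [_ _ [Ch [Q0 WQ0 HCh] Hsh]] dw lu HI.
have mO := open_measurable_rV (whitney_open HW).
pose g x := enorm (grad u x).
have g0 x : 0 <= g x by exact: enorm_ge0.
have w0 x : 0 <= w x by exact: powR_ge0.
have mcube (Q : cube R n) : measurable (cube_set Q) by exact: measurable_cube_set.
have starW Q : W Q -> cube_set Q `<=` cube_set (star Q).
  by move=> WQ; exact/cube_set_star/ltW/(whitney_gt0 HW).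
have mus Q : W Q -> measurable_fun (cube_set (star Q)) u.
  move=> WQ; have [L [U [_ lU UE]]] := whitney_extension nn HW lu WQ.
  apply: (@eq_measurable_fun _ _ _ _ _ U); last exact: measurable_funTS (lipf_measurable lU).
  by move=> x; rewrite inE => /UE[].
have mgs Q : W Q -> measurable_fun (cube_set (star Q)) g.
  move=> WQ; have [L [U [_ lU UE]]] := whitney_extension nn HW lu WQ.
  apply: (@eq_measurable_fun _ _ _ _ _ (fun x => enorm (grad U x))).
    by move=> x; rewrite inE => /UE[_]; rewrite /g => ->.
  exact: measurable_funTS (measurable_enorm_grad lU).
have mu : measurable_fun Omega u.
  by apply: (whitney_measurable HW) => Q WQ; exact: measurable_funS (mcube _) (starW _ WQ) (mus _ WQ).
have mg : measurable_fun Omega g.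
  by apply: (whitney_measurable HW) => Q WQ; exact: measurable_funS (mcube _) (starW _ WQ) (mgs _ WQ).
have [[mw _ _] _] := dw.
(* The factor [n] is the price of bounding the l^1 norm of the gradient by the Euclidean one
   ([gsum_le_enorm]). *)
pose h x := ((n%:R * g x) `^ p)%:E.
have h0 x : (0 <= h x)%E by rewrite lee_fin powR_ge0.
have mh : measurable_fun Omega h.
  apply/measurable_EFinP; apply: (measurableT_comp (measurable_powR _)).
  exact: measurable_funM.
have hI : (\int[lebesgue_rV]_(x in Omega) h x = (n%:R `^ p * I)%:E)%E.
  rewrite EFinM -HI -ge0_integralZl//.
  - by apply: eq_integral => x _; rewrite /h powRM// EFinM.
  - by apply/measurable_EFinP; exact: (measurableT_comp (measurable_powR _) mg).
  - by move=> x _; rewrite lee_fin powR_ge0.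
have I0 : 0 <= I.
  by rewrite -lee_fin -HI; apply: integral_ge0 => x _; rewrite lee_fin powR_ge0.
pose G Q := (\int[lebesgue_rV]_(x in cube_set (star Q)) h x)%E.
have Gfin Q : W Q -> G Q \is a fin_num.
  move=> WQ; rewrite ge0_fin_numE; last by apply: integral_ge0.
  apply: (@le_lt_trans _ _ (\int[lebesgue_rV]_(x in Omega) h x)%E); last by rewrite hI ltry.
  by apply: ge0_subset_integral => //; exact: (whitney_star_sub nn HW WQ).
pose F Q := fine (G Q) `^ p^-1.
have F0 Q : 0 <= F Q by exact: powR_ge0.
have Fp Q : F Q `^ p = fine (G Q).
  rewrite /F -powRrM mulVf ?gt_eqF// powRr1//; apply: fine_ge0; exact: integral_ge0.
have /choice[m mP] : forall Q, exists m : R, W Q ->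
   (\int[lebesgue_rV]_(x in cube_set (star Q)) `|u x - m|%:E <=
     (2 * F Q * side (star Q) `^ (1 - n%:R / p) * side (star Q) ^+ n)%:E)%E /\
   (\int[lebesgue_rV]_(x in cube_set Q) (`|u x - m| `^ q * w x)%:E <=
     (C1 * F Q `^ q)%:E)%E.
  move=> Q; have [WQ|nWQ] := pselect (W Q); last by exists 0.
  have [|m mP] := H1 Omega W u Q (F Q) HW lu WQ (F0 Q); last by exists m.
  by rewrite Fp fineK//; exact: Gfin.
pose a Q := 2 * F Q * side (star Q) `^ (1 - n%:R / p).
have a0 Q : 0 <= a Q by rewrite mulr_ge0 ?powR_ge0// mulr_ge0.
have osc Q : W Q -> mean_oscillation u m a Q.
  by move=> WQ; split; [exact: (whitney_gt0 HW WQ)|exact: a0|exact: mus|exact: (mP Q WQ).1].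
have wfin Q : W Q -> wmeas w (cube_set Q) \is a fin_num.
  move=> WQ; rewrite ge0_fin_numE; last by apply: integral_ge0 => x _; rewrite lee_fin.
  apply: le_lt_trans (ltry _); apply: (whitney_wmeas_le nn HW _ WQ).
  exact: whitney_exponent_ge0.
exists (m Q0); apply: (whitney_integral_le HW) => [|x _|T uT TW].
- apply/measurable_EFinP; apply: measurable_funM => //.
  apply: (measurableT_comp (measurable_powR _)); apply: measurableT_comp => //.
  exact: measurable_funB.
- by rewrite lee_fin mulr_ge0 ?powR_ge0.
(* All cubes met by the chains ending in [T]: still a finite family, and it contains [T] because
   each chain ends at its own cube. *)
pose S := undup (flatten [seq Ch Q | Q <- T]).
have uS : uniq S by exact: undup_uniq.
have ChS Q : Q \in T -> {subset Ch Q <= S}.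
  move=> QT P PQ; rewrite mem_undup; apply/flattenP; exists (Ch Q) => //.
  exact: map_f.
have TS : {subset T <= S}.
  move=> Q QT; apply: (ChS _ QT); have [s -> [_ <- _ _]] := HCh Q (TW Q QT).
  exact: mem_last.
have SW Q : Q \in S -> W Q.
  rewrite mem_undup => /flattenP[_ /mapP[P PT ->]].
  by have [s -> [sW _ _ _]] := HCh P (TW P PT); exact: sW.
pose wQ Q := fine (wmeas w (cube_set Q)).
have wQ0 Q : 0 <= wQ Q by apply: fine_ge0; apply: integral_ge0 => x _; rewrite lee_fin.
have perQ Q : Q \in T -> (\int[lebesgue_rV]_(x in cube_set Q) (`|u x - m Q0| `^ q * w x)%:E <=
    (2 `^ q * (C1 * F Q `^ q + kap `^ q * (wQ Q * (\sum_(P <- Ch Q) a P) `^ q)))%:E)%E.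
  move=> QT; have WQ := TW Q QT; set d := `|m Q - m Q0|.
  have QO := whitney_sub HW WQ.
  have mwQ : measurable_fun (cube_set Q) w by exact: measurable_funS mO QO mw.
  have muQ : measurable_fun (cube_set Q) u by exact: measurable_funS mO QO mu.
  apply: (@le_trans _ _ (\int[lebesgue_rV]_(x in cube_set Q)
      ((2 `^ q)%:E * ((`|u x - m Q| `^ q * w x)%:E + (d `^ q)%:E * (w x)%:E)))%E).
    apply: ge0_le_integral_gen => x Qx; first by rewrite lee_fin mulr_ge0 ?powR_ge0.
    rewrite -(EFinM (d `^ q)) -EFinD -EFinM lee_fin -mulrDl mulrA ler_wpM2r//.
    apply: le_trans (powR_add_le (normr_ge0 _) (normr_ge0 _) (ltW q0)).
    by rewrite ler_powR2 ?(ltW q0)// ler_distD.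
  have i1 x : cube_set Q x -> (0 <= (`|u x - m Q| `^ q * w x)%:E)%E.
    by rewrite lee_fin mulr_ge0 ?powR_ge0.
  have i2 x : cube_set Q x -> (0 <= (d `^ q)%:E * (w x)%:E)%E.
    by rewrite -EFinM lee_fin mulr_ge0 ?powR_ge0.
  have m1 : measurable_fun (cube_set Q) (fun x => (`|u x - m Q| `^ q * w x)%:E).
    apply/measurable_EFinP; apply: measurable_funM => //.
    apply: (measurableT_comp (measurable_powR _)); apply: measurableT_comp => //.
    exact: measurable_funB.
  have m2 : measurable_fun (cube_set Q) (fun x => (w x)%:E) by exact/measurable_EFinP.
  have m3 : measurable_fun (cube_set Q) (fun x => (d `^ q)%:E * (w x)%:E)%E.
    exact: measurable_funeM.
  have i3 x : cube_set Q x -> (0 <= (w x)%:E)%E by rewrite lee_fin.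
  have i4 x : cube_set Q x -> (0 <= (`|u x - m Q| `^ q * w x)%:E + (d `^ q)%:E * (w x)%:E)%E.
    by move=> Qx; rewrite adde_ge0 ?i1 ?i2.
  rewrite ge0_integralZl ?lee_fin ?powR_ge0//; last exact: emeasurable_funD.
  rewrite ge0_integralD// ge0_integralZl ?lee_fin ?powR_ge0//.
  rewrite (EFinM (2 `^ q)) lee_wpmul2l ?lee_fin ?powR_ge0// EFinD leeD//; first exact: (mP Q WQ).2.
  rewrite -/(wmeas w (cube_set Q)) -(fineK (wfin Q WQ)) -/(wQ Q) -EFinM lee_fin.
  rewrite mulrCA mulrC ler_wpM2l// -powRM//; last exact: sumr_ge0.
  rewrite ler_powR2 ?(ltW q0) ?normr_ge0//; rewrite /d /kap.
  have [s -> [sW sQ us sl]] := HCh Q WQ; rewrite -[in leLHS]sQ.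
  apply: chain_oscillation => // P Ps; exact/osc/sW.
rewrite big_seq; apply: (le_trans (lee_sum _ perQ)).
rewrite -big_seq sumEFin lee_fin -mulr_sumr big_split/= -!mulr_sumr.
have B1 : \sum_(Q <- T) F Q `^ q <= \sum_(Q <- S) F Q `^ q.
  by apply: ler_sum_uniq => // Q; exact: powR_ge0.
have B2 : \sum_(Q <- T) wQ Q * (\sum_(P <- Ch Q) a P) `^ q <= C2 * \sum_(Q <- S) wQ Q * a Q `^ q.
  apply: (H2 Omega W w a Ch T S HW dw w0 wfin a0 uT uS TS SW) => [Q QT|Q P QT PQ].
    split; last exact: ChS.
    by have [s -> [_ _ us _]] := HCh Q (TW Q QT).
  move=> x Qx; apply: (Hsh P).
    by apply: SW; exact: ChS PQ.
  by exists Q => //; split => //; exact: TW.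
have B3 : \sum_(Q <- S) wQ Q * a Q `^ q <= 2 `^ q * \sum_(Q <- S) F Q `^ q.
  rewrite mulr_sumr !big_seq; apply: ler_sum => Q /SW WQ; rewrite mulrC.
  exact: (whitney_mass_estimate p1 pq qs pn HW WQ (F0 Q)).
(* Since [q / p >= 1], the sum of the powers [(F Q ^ p) ^ (q / p)] is at most the power of the sum,
   and bounded overlap compares that sum with the integral over [Omega]. *)
have B4 : \sum_(Q <- S) F Q `^ q <= (M * n%:R `^ p) `^ (q / p) * I `^ (q / p).
  have qp1 : 1 <= q / p by rewrite ler_pdivlMr// mul1r.
  rewrite -powRM ?powR_ge0 ?mulr_ge0 ?powR_ge0 ?(ltW M0)//.
  rewrite (eq_bigr (fun Q => (F Q `^ p) `^ (q / p))); last first.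
    by move=> Q _; rewrite -powRrM mulrC divfK ?gt_eqF.
  apply: le_trans (sum_powR_superadd _ qp1 (fun Q => powR_ge0 _ _)) _.
  rewrite ler_powR2 ?(le_trans ler01 qp1)//; first by apply: sumr_ge0 => Q _; exact: powR_ge0.
  rewrite -lee_fin -sumEFin big_seq (eq_bigr G); last first.
    by move=> Q /SW WQ; rewrite Fp fineK// Gfin.
  rewrite -big_seq; apply: le_trans (whitney_overlap_integral nn HW mh (fun x _ => h0 x) uS SW) _.
  by rewrite hI -EFinM mulrA.
have B5 : C1 * \sum_(Q <- T) F Q `^ q +
    kap `^ q * \sum_(Q <- T) wQ Q * (\sum_(P <- Ch Q) a P) `^ q <=
    (C1 + kap `^ q * (C2 * 2 `^ q)) * \sum_(Q <- S) F Q `^ q.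
  rewrite mulrDl lerD ?(ler_wpM2l (ltW C10))// -mulrA ler_wpM2l ?powR_ge0//.
  by rewrite (le_trans B2)// -mulrA ler_wpM2l// ltW.
apply: (le_trans (ler_wpM2l (powR_ge0 _ _) B5)).
rewrite [leLHS]mulrA -[leRHS]mulrA; exact: (ler_wpM2l (ltW C30) B4).
Qed.

Theorem theorem7p3 (R : realType) (n : nat) (c : R) (p q D N : R) :
  0 < c -> 1 < p -> p <= q -> q <= n%:R * p / (n%:R - p) -> p < n%:R ->
  1 <= N ->
  exists2 C : R, 0 < C &
    forall (Omega : set 'rV[R]_n) (W : set (cube R n)),
      whitney Omega W -> boman c W N Omega ->
      let beta := n%:R - q / p * (n%:R - p) in
      doubling Omega (fun x => pt_dist x (bdry Omega) `^ (- beta)) D ->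
      forall u : 'rV[R]_n -> R, lip_loc Omega u ->
        (ereal_inf [set (\int[lebesgue_rV]_(x in Omega)
             (`|u x - k| `^ q *
              pt_dist x (bdry Omega) `^ (- n%:R + q / p * (n%:R - p)))%:E)
              `^ q^-1 | k in [set: R]]
         <= C%:E *
            (\int[lebesgue_rV]_(x in Omega) (enorm (grad u x) `^ p)%:E)
              `^ p^-1)%E.
Proof.
move=> c0 p1 pq qs pn _.
have p0 : 0 < p := lt_trans ltr01 p1.
have q0 : 0 < q := lt_le_trans p0 pq.
have [C C0 H] := @boman_sobolev_poincare R n c p q D N c0 p1 pq qs pn.
exists (C `^ q^-1); first by rewrite powR_gt0.
move=> Omega W HW HB beta dw u lu.
have := @integral_ge0 _ _ _ (@lebesgue_rV R n) Omega
  (fun x => (enorm (grad u x) `^ p)%:E) (fun x _ => powR_ge0 _ _).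
case E : (\int[lebesgue_rV]_(x in Omega) _)%E => [I| |] // I0; last first.
  (* If the gradient integral is infinite, so is the right-hand side, since its constant is
     positive. *)
  rewrite poweRyr ?gt_eqF ?invr_gt0// gt0_muley ?leey//.
  by rewrite lte_fin powR_gt0.
have [k Hk] := H Omega W u I HW HB dw lu E.
apply: le_trans (ereal_inf_lbound _) _; first by exists k.
have -> : - n%:R + q / p * (n%:R - p) = - beta by rewrite /beta opprB addrC.
rewrite lee_fin in I0.
have J0 : (0 <= \int[lebesgue_rV]_(x in Omega) (`|u x - k| `^ q *
    pt_dist x (bdry Omega) `^ (- beta))%:E)%E.
  by apply: integral_ge0 => x _; rewrite lee_fin mulr_ge0 ?powR_ge0.
apply: (@le_trans _ _ (((C * I `^ (q / p))%:E `^ q^-1)%E)).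
  apply: gt0_ler_poweR => //; first by rewrite invr_ge0 ltW.
    by rewrite in_itv/= J0 leey.
  by rewrite in_itv/= leey lee_fin mulr_ge0 ?powR_ge0// ltW.
rewrite !poweR_EFin -EFinM lee_fin powRM ?powR_ge0 ?(ltW C0)// -powRrM.
by have -> : q / p / q = p^-1 by field; rewrite (gt_eqF p0) (gt_eqF q0).
Qed.
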